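(* Let $\rho:\mathbb{C}\to\mathbb{C}$ be an analytic function that is real (i.e. $\rho(\mathbb{R})\subset\mathbb{R}$), and suppose that $I_\rho=\{u\in\mathbb{R}:\rho(u)>0\}$ is nonempty. Then the algebra $\mathcal{A}(\rho,0)$ (that is, $\mathcal{A}(\rho,\varepsilon)$ with $\varepsilon=0$) is the commutative algebra of polynomials in $(x,y,z)$ restricted to the surface $$\mathcal{M}_\rho=\{(x,y,z)\in\mathbb{R}^3: x^2+y^2=\rho(z)\},$$ where $X_0=z$ and $X_\pm=x\pm iy$. The limit of the commutator of $\mathcal{A}(\rho,\varepsilon)$ as $\varepsilon\to0$ gives $\mathcal{M}_\rho$ a Poisson structure, given by $$\{f,g\}=\lim_{\varepsilon\to0}\Bigl(\tfrac1\varepsilon[f,g]\Bigr)=i\left(\frac{\partial f}{\partial\phi}\frac{\partial g}{\partial z}-\frac{\partial g}{\partial\phi}\frac{\partial f}{\partial z}\right).$$ Furthermore, if $I_\rho$ is connected, then one of the following three is true: - $I_\rho$ is bounded and $\mathcal{M}_\rho$ is topologically equivalent (homeomorphic) to the sphere; - $I_\rho$ is bounded from one side only and $\mathcal{M}_\rho$ is topologically equivalent to the disc; - $I_\rho=\mathbb{R}$ and $\mathcal{M}_\rho$ is topologically equivalent to the cylinder.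
   Context: For an analytic function $\rho:\mathbb{C}\to\mathbb{C}$ and a constant $\varepsilon\in\mathbb{C}$, $\mathcal{A}(\rho,\varepsilon)$ is the complex algebra of (noncommutative) polynomials generated by $\{X_0,X_+,X_-\}\cup\{\rho(X_0+r\varepsilon): r\in\mathbb{Z}\}$, quotiented by the ideal generated by $$[X_0,X_+]=\varepsilon X_+,\quad [X_0,X_-]=-\varepsilon X_-,\quad X_+X_-=\rho(X_0),\quad X_-X_+=\rho(X_0+\varepsilon).$$ Here functions of $X_0$ commute with one another, and, as the first two relations express, $h(X_0)X_\pm=X_\pm h(X_0\pm\varepsilon)$ for such functions $h$. The coordinates $(\phi,z)$ on the part of $\mathcal{M}_\rho$ where $\rho(z)>0$ are given by $x=\rho(z)^{1/2}\cos\phi$, $y=\rho(z)^{1/2}\sin\phi$, so that $X_\pm=\rho(z)^{1/2}e^{\pm i\phi}$; $\partial/\partial\phi$ and $\partial/\partial z$ are taken in these coordinates. In the limit formula, $f,g$ are polynomials in the generators; their commutator is computed in $\mathcal{A}(\rho,\varepsilon)$, divided by $\varepsilon$, and its limit as $\varepsilon\to0$ is regarded as a function on $\mathcal{M}_\rho$ through $X_0=z$, $X_\pm=x\pm iy$. ''Disc'' means open disc.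
   Formalization: In the sphere/disc/cylinder trichotomy, M_ρ is replaced by M_ρ minus its isolated points, since real zeros of ρ outside the closure of I_ρ (e.g. ρ(u)=u²(1−u)(u−2)) give M_ρ extra isolated points and make the literal claim false. *)

(* Defs.v *)
From HB Require Import structures.
From mathcomp Require Import all_boot all_order all_algebra.
From mathcomp Require Import all_classical all_reals all_analysis.
From mathcomp Require Import generic_quotient ring_quotient complex.
From mathcomp Require Import -(notations) monalg.
From mathcomp Require mpoly.

Set Implicit Arguments.
Unset Strict Implicit.
Unset Printing Implicit Defensive.

Import Order.TTheory GRing.Theory Num.Theory.
Import numFieldNormedType.Exports.
Local Open Scope classical_set_scope.
Local Open Scope ring_scope.
Local Open Scope quotient_scope.
Local Open Scope complex_scope.

(* The complex numbers are R[i] with R a realType, topologized by the norm `|z|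
   as any numFieldType is. *)
#[non_forgetful_inheritance]
HB.instance Definition _ (R : realType) := NormedModule.copy R[i] R[i]^o.

Definition analytic (R : realType) (rho : R[i] -> R[i]) :=
  forall z0 : R[i], exists a : nat -> R[i],
    \forall z \near z0, series (fun n => a n * (z - z0) ^+ n) @ \oo --> rho z.

Definition real_valued (R : realType) (rho : R[i] -> R[i]) :=
  forall u : R, rho u%:C \is Num.real.

(* [Rho r] stands for the generator rho(X_0 + r eps). *)
Inductive gen := X0 | Xp | Xm | Rho of int.

Definition gen_code (x : gen) : unit + bool + int :=
  match x with
  | X0 => inl (inl tt) | Xp => inl (inr true) | Xm => inl (inr false)
  | Rho r => inr r
  end.

Definition gen_decode (c : unit + bool + int) : gen :=
  match c with
  | inl (inl _) => X0 | inl (inr b) => if b then Xp else Xm | inr r => Rho r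
  end.

Lemma gen_codeK : cancel gen_code gen_decode. Proof. by case. Qed.

HB.instance Definition _ := Countable.copy gen (can_type gen_codeK).

Section Algebra.
Variables (R : realType) (rho : R[i] -> R[i]).
Local Notation C := R[i].

(* Noncommutative polynomials: the monoid algebra of the free monoid. *)
Definition ncpoly := @monalg.malg (monalg.fmonom gen) C.
HB.instance Definition _ := GRing.Lalgebra.on ncpoly.

Definition ncvar (x : gen) : ncpoly := monalg.mkmalgU (monalg.fmu x) 1.

Definition nceval (v : gen -> C) (p : ncpoly) : C :=
  monalg.mmap idfun (fun m : monalg.fmonom gen => \prod_(x <- m : seq gen) v x) p.

Definition x0poly (p : ncpoly) :=
  forall m : monalg.fmonom gen, monalg.mcoeff m p != 0 ->
    (Xp \notin (m : seq gen)) /\ (Xm \notin (m : seq gen)).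

(* The function h such that p, not involving X_+ and X_-, is h(X_0). *)
Definition x0fun (eps : C) (p : ncpoly) (w : C) : C :=
  nceval (fun x => match x with
                   | X0 => w | Rho r => rho (w + r%:~R * eps) | _ => 0
                   end) p.

(* [rel_fun] says that the rho(X_0 + r eps) are functions of X_0: they commute
   with X_0 and with each other, and identities between these functions (such
   as the expression of rho(X_0) in X_0 when rho is a polynomial) hold.
   [rel_rho_p] and [rel_rho_m] are h(X_0) X_pm = X_pm h(X_0 pm eps). *)
Inductive relator (eps : C) : set ncpoly :=
| rel_fun p of x0poly p & x0fun eps p =1 (fun=> 0) : relator eps p
| rel_x0_p : relator eps (ncvar X0 * ncvar Xp - ncvar Xp * ncvar X0
                          - eps *: ncvar Xp)
| rel_x0_m : relator eps (ncvar X0 * ncvar Xm - ncvar Xm * ncvar X0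
                          + eps *: ncvar Xm)
| rel_rho_p r : relator eps (ncvar (Rho r) * ncvar Xp
                             - ncvar Xp * ncvar (Rho (r + 1)))
| rel_rho_m r : relator eps (ncvar (Rho r) * ncvar Xm
                             - ncvar Xm * ncvar (Rho (r - 1)))
| rel_pm : relator eps (ncvar Xp * ncvar Xm - ncvar (Rho 0))
| rel_mp : relator eps (ncvar Xm * ncvar Xp - ncvar (Rho 1)).

Definition two_sided_ideal (I : set ncpoly) :=
  [/\ I 0, forall p q, I p -> I q -> I (p + q)
    & forall a p b, I p -> I (a * p * b)].

Definition relideal (eps : C) : set ncpoly :=
  smallest two_sided_ideal (relator eps).

Lemma relideal_ideal eps : two_sided_ideal (relideal eps).
Proof.
split=> [|p q Ip Iq I hI|a p b Ip I hI].
- by move=> I [[]].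
- by case: (hI) => -[_ hD _] _; exact: hD (Ip _ hI) (Iq _ hI).
- by case: (hI) => -[_ _ hM] _; exact: hM (Ip _ hI).
Qed.

Definition relidealb (eps : C) : {pred ncpoly} := mem (relideal eps).

Lemma relidealP eps p : reflect (relideal eps p) (p \in relidealb eps).
Proof. by apply: (iffP idP) => [/set_mem|/mem_set]. Qed.

Lemma relidealMM eps a p b :
  p \in relidealb eps -> a * p * b \in relidealb eps.
Proof.
case: (relideal_ideal eps) => _ _ hM /relidealP Ip.
by apply/relidealP; exact: hM.
Qed.

Lemma relideal_zmod_closed eps : zmod_closed (relidealb eps).
Proof.
case: (relideal_ideal eps) => h0 hD hM.
split=> [|p q /relidealP Ip /relidealP Iq]; first by apply/relidealP.
apply/relidealP; apply: hD => //.
by have := hM (-1) q 1 Iq; rewrite mulr1 mulN1r.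
Qed.

HB.instance Definition _ eps :=
  GRing.isZmodClosed.Build ncpoly (relidealb eps) (relideal_zmod_closed eps).


Definition alg (eps : C) := Quotient.quot (relidealb eps).
HB.instance Definition _ eps := GRing.Zmodule.on (alg eps).
HB.instance Definition _ eps := EqQuotient.on (alg eps).

Definition cls (eps : C) (p : ncpoly) : alg eps := \pi_(alg eps) p.

Lemma cls_eqP eps p q : reflect (cls eps p = cls eps q) (p - q \in relidealb eps).
Proof. by apply: (iffP idP); rewrite /cls Quotient.idealrBE => /eqP. Qed.

Lemma clsB eps p q : cls eps (p - q) = cls eps p - cls eps q.
Proof. exact: raddfB. Qed.

Lemma clsD eps p q : cls eps (p + q) = cls eps p + cls eps q.
Proof. exact: raddfD. Qed.

Lemma cls_repr eps (a : alg eps) : cls eps (repr a) = a.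
Proof. exact: reprK. Qed.

Definition alg_mul eps (a b : alg eps) : alg eps := cls eps (repr a * repr b).
Definition alg_scale eps (c : C) (a : alg eps) : alg eps := cls eps (c *: repr a).

Lemma clsM eps p q : cls eps (p * q) = alg_mul (cls eps p) (cls eps q).
Proof.
apply/cls_eqP; set p' := repr _; set q' := repr _.
have Ip : p - p' \in relidealb eps by apply/cls_eqP; rewrite cls_repr.
have Iq : q - q' \in relidealb eps by apply/cls_eqP; rewrite cls_repr.
have -> : p * q - p' * q' = (p - p') * q + p' * (q - q').
  by rewrite mulrBl mulrBr addrA subrK.
apply: rpredD; first by rewrite -[p - p']mul1r relidealMM.
by rewrite -[p' * _]mulr1 relidealMM.
Qed.

Lemma clsZ eps c p : cls eps (c *: p) = alg_scale c (cls eps p).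
Proof.
apply/cls_eqP; set p' := repr _.
have Ip : p - p' \in relidealb eps by apply/cls_eqP; rewrite cls_repr.
by rewrite -scalerBr -[p - p']mul1r scalerAl -[_ * _]mulr1 relidealMM.
Qed.

Fact alg_mulA eps : associative (@alg_mul eps).
Proof.
move=> a b c; rewrite -[a]cls_repr -[b]cls_repr -[c]cls_repr.
by rewrite -!clsM mulrA.
Qed.

Fact alg_mul1 eps : left_id (cls eps 1) (@alg_mul eps).
Proof. by move=> a; rewrite -[a]cls_repr -clsM mul1r. Qed.

Fact alg_mulr1 eps : right_id (cls eps 1) (@alg_mul eps).
Proof. by move=> a; rewrite -[a]cls_repr -clsM mulr1. Qed.

Fact alg_mulDl eps : left_distributive (@alg_mul eps) +%R.
Proof.
move=> a b c; rewrite -[a]cls_repr -[b]cls_repr -[c]cls_repr.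
by rewrite -clsD -!clsM -clsD mulrDl.
Qed.

Fact alg_mulDr eps : right_distributive (@alg_mul eps) +%R.
Proof.
move=> a b c; rewrite -[a]cls_repr -[b]cls_repr -[c]cls_repr.
by rewrite -clsD -!clsM -clsD mulrDr.
Qed.

HB.instance Definition _ eps := GRing.Zmodule_isPzRing.Build (alg eps)
  (@alg_mulA eps) (@alg_mul1 eps) (@alg_mulr1 eps)
  (@alg_mulDl eps) (@alg_mulDr eps).

Fact alg_scaleA eps c d (a : alg eps) :
  alg_scale c (alg_scale d a) = alg_scale (c * d) a.
Proof. by rewrite -[a]cls_repr -!clsZ scalerA. Qed.

Fact alg_scale1 eps : left_id 1 (@alg_scale eps).
Proof. by move=> a; rewrite -[a]cls_repr -clsZ scale1r. Qed.

Fact alg_scaleDr eps : right_distributive (@alg_scale eps) +%R.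
Proof.
move=> c a b; rewrite -[a]cls_repr -[b]cls_repr.
by rewrite -clsD -!clsZ -clsD scalerDr.
Qed.

Fact alg_scaleDl eps (a : alg eps) : {morph (@alg_scale eps)^~ a : c d / c + d}.
Proof. by move=> c d; rewrite -[a]cls_repr -!clsZ -clsD scalerDl. Qed.

HB.instance Definition _ eps := GRing.Zmodule_isLmodule.Build C (alg eps)
  (@alg_scaleA eps) (@alg_scale1 eps) (@alg_scaleDr eps) (@alg_scaleDl eps).

Definition rhoR (u : R) : R := complex.Re (rho u%:C).

Definition Irho : set R := [set u | 0 < rhoR u].

Definition Mrho : set (R * R * R) :=
  [set p | p.1.1 ^+ 2 + p.1.2 ^+ 2 = rhoR p.2].

Definition zfun (p : Mrho) : C := (val p).2%:C.
Definition xpfun (p : Mrho) : C := (val p).1.1 +i* (val p).1.2.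
Definition xmfun (p : Mrho) : C := (val p).1.1 -i* (val p).1.2.

Definition polyfun : set (Mrho -> C) :=
  [set F | exists P : mpoly.mpoly 3 C, F = fun p =>
     mpoly.meval (tnth [tuple (val p).1.1%:C; (val p).1.2%:C; (val p).2%:C]) P].

(* A noncommutative polynomial as a function on Mrho, for eps = 0. *)
Definition ncrestr (f : ncpoly) : Mrho -> C := fun p =>
  nceval (fun x => match x with
                   | X0 => zfun p | Xp => xpfun p | Xm => xmfun p
                   | Rho _ => rho (zfun p)
                   end) f.

Definition ladder (k : int) : ncpoly :=
  if (0 <= k)%R then ncvar Xp ^+ `|k|%N else ncvar Xm ^+ `|k|%N.

Definition ladderfun (k : int) (p : Mrho) : C :=
  if (0 <= k)%R then xpfun p ^+ `|k|%N else xmfun p ^+ `|k|%N.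

(* Every element of the algebra is a sum of X_+^k h_k(X_0) and
   X_-^k h_{-k}(X_0).  A family of elements, one for each eps, converges if it
   can be written, for small eps <> 0, with boundedly many functions
   h_{k, eps}, each converging locally uniformly on C; this is expressed by the
   joint limit h_{k, eps}(w) -> h_k(z) as w -> z and eps -> 0. *)
Definition alg_cvg (a : forall eps, alg eps) (L : Mrho -> C) :=
  exists (s : seq int) (c : C -> int -> ncpoly) (h : int -> C -> C),
  [/\ uniq s,
      forall eps k, x0poly (c eps k),
      \forall eps \near (0 : C)^',
        a eps = \sum_(k <- s) cls eps (ladder k * c eps k),
      forall k z, k \in s ->
        (fun we : C * C => x0fun we.2 (c we.2 k) we.1)
          @ filter_prod (nbhs z) (0 : C)^' --> h k z
    & L = fun p => \sum_(k <- s) ladderfun k p * h k (zfun p)].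

Definition alg_lim (a : forall eps, alg eps) (L : Mrho -> C) :=
  alg_cvg a L /\ forall L', alg_cvg a L' -> L' = L.

Definition scaled_commutator (f g : ncpoly) (eps : C) : alg eps :=
  eps^-1 *: (cls eps f * cls eps g - cls eps g * cls eps f).

Definition smooth (F : R * R * R -> R) :=
  forall (vs : seq (R * R * R)) p,
    differentiable (foldr (fun v G q => 'D_v G q) F vs) p.

(* Smooth functions on the possibly singular Mrho are, as usual, restrictions of
   smooth functions on the ambient space. *)
Definition smooth_on_M : set (Mrho -> C) :=
  [set f | exists F G, [/\ smooth F, smooth G &
                           forall p : Mrho, f p = F (val p) +i* G (val p)]].

Definition poisson_bracket (br : (Mrho -> C) -> (Mrho -> C) -> Mrho -> C) :=
  let S := smooth_on_M in
  [/\ forall f g, S f -> S g -> S (br f g),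
      forall (c : C) f g h, S f -> S g -> S h ->
        br (c *: f + g) h = c *: br f h + br g h,
      forall f g, S f -> S g -> br f g = - br g f,
      forall f g h, S f -> S g -> S h ->
        br f (g * h) = br f g * h + g * br f h
    & forall f g h, S f -> S g -> S h ->
        br f (br g h) + br g (br h f) + br h (br f g) = 0].

(* [f] in the coordinates (phi, z); the value 0 is only taken when
   rho(z) < 0. *)
Definition in_chart (f : Mrho -> C) (phi z : R) : C :=
  oapp f 0 (insub (Num.sqrt (rhoR z) * cos phi, Num.sqrt (rhoR z) * sin phi, z)).

End Algebra.

Arguments zfun {R} rho p : assert.
Arguments xpfun {R} rho p : assert.
Arguments xmfun {R} rho p : assert.
Arguments polyfun {R} rho _ : assert.
Arguments ncrestr {R} rho f p : assert.

Definition derive1C (R : realType) (h : R -> R[i]) (t : R) : R[i] :=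
  derive1 (fun u => complex.Re (h u)) t +i* derive1 (fun u => complex.Im (h u)) t.

Definition d_phi (R : realType) (f : R -> R -> R[i]) (phi z : R) : R[i] :=
  derive1C (f^~ z) phi.

Definition d_z (R : realType) (f : R -> R -> R[i]) (phi z : R) : R[i] :=
  derive1C (f phi) z.

(* If rho vanishes at a real point outside the closure of Irho, then Mrho has an
   isolated point on the z-axis besides its two-dimensional part. *)
Definition surface (R : realType) (rho : R[i] -> R[i]) : set (R * R * R) :=
  Mrho rho `\` isolated (Mrho rho).

Definition homeomorphic (T U : topologicalType) (A : set T) (B : set U) :=
  exists (f : T -> U) (g : U -> T),
  [/\ {within A, continuous f}, {within B, continuous g},
      {homo f : x / A x >-> B x}, {homo g : y / B y >-> A y}
    & (forall x, A x -> g (f x) = x) /\ (forall y, B y -> f (g y) = y)].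

Definition sphere (R : realType) : set (R * R * R) :=
  [set p | p.1.1 ^+ 2 + p.1.2 ^+ 2 + p.2 ^+ 2 = 1].

Definition disc (R : realType) : set (R * R) :=
  [set p | p.1 ^+ 2 + p.2 ^+ 2 < 1].

Definition cylinder (R : realType) : set (R * R * R) :=
  [set p | p.1.1 ^+ 2 + p.1.2 ^+ 2 = 1].

Arguments sphere : clear implicits.
Arguments disc : clear implicits.
Arguments cylinder : clear implicits.

(* Main.v *)
(* A family of elements of A(rho, eps) converges when it is a bounded sum of
   ladder terms X_+^k h_k(X_0), X_-^k h_{-k}(X_0) whose h_k converge locally
   uniformly.  Such families are closed under sums and products, because the
   relations only shift the arguments of the h_k by multiples of eps.
   - For the principal filter at eps = 0 this is a normal form in A(rho, 0).  On
     the circle of M_rho over a point of I_rho it is a Laurent polynomial, so if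
     it vanishes on M_rho then all h_k vanish on the open set I_rho, hence
     everywhere by the identity theorem.  So A(rho, 0) embeds into the functions
     on M_rho.
   - For the punctured filter at 0, the Leibniz rule reduces the limit of the
     scaled commutators to those of generators.  The limit is unique since
     A(rho, eps) acts on functions by (X_+ F)(w) = F(w - eps) and
     (X_- F)(w) = rho(w + eps) F(w + eps): for eps <> 0, testing on indicator
     functions isolates each h_k.
   The bracket on M_rho is induced by the ambient bracket on R^3
   i (x (F_y G_z - F_z G_y) - y (F_x G_z - F_z G_x)
      - rho'(z)/2 (F_x G_y - F_y G_x)).
   Where rho > 0 the chart formula shows that it depends only on the
   restrictions to M_rho; where rho = 0 this follows by continuity if
   rho' <> 0, and all coefficients vanish if rho' = 0.
   Without its isolated points M_rho is the surface of revolution over the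
   closure of I_rho, and rescaling the circles turns it into the surface of
   revolution of any other profile with corresponding zeros. *)


Require Import Defs.
From HB Require Import structures.
From mathcomp Require Import all_boot all_order all_algebra.
From mathcomp Require Import all_classical all_reals all_analysis.
From mathcomp Require Import complex.
From mathcomp Require finmap monalg mpoly.
From mathcomp Require Import ring lra zify.

Set Implicit Arguments.
Unset Strict Implicit.
Unset Printing Implicit Defensive.

Import Order.TTheory GRing.Theory Num.Theory.
Import numFieldNormedType.Exports.
Local Open Scope classical_set_scope.
Local Open Scope ring_scope.
Local Open Scope complex_scope.

(** * Functions with Taylor expansions *)

(** Analyticity is given only as local convergence of power series, and three consequences of it are
    needed: isolated zeros, stability under products (the coefficients at eps = 0 are polynomials in
    z and rho), and difference quotients that converge uniformly near each point. All three come
    from one estimate, a Taylor remainder bounded by M (K |w|)^N for every order N at once. The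
    uniqueness of the limit has a delicate point at the zeros of rho. Acting on functions, X_-^n
    h(X_0) produces n values of rho as factors, so in the limit only rho^n h is determined. This is
    enough: where rho vanishes on M_rho, x = y = 0, hence X_- = 0 and the term contributes nothing.
    The ambient bracket is i times the determinant of the gradients of Q, F and G with Q = (x^2 +
    y^2 - rho(z)) / 2. This is the source of its coefficients, of the Jacobi identity and of the
    chart formula, since the cross product of the two coordinate tangent vectors is the gradient of
    Q. *)

Lemma complex_ext (R : rcfType) (z w : R[i]) :
  complex.Re z = complex.Re w -> complex.Im z = complex.Im w -> z = w.
Proof. by case: z w => [a b] [c d] /= -> ->. Qed.

Lemma ex_lt_min (R : realFieldType) (d e : R) : 0 < d -> 0 < e ->
  exists t, [/\ 0 < t, t < d & t < e].
Proof.
move=> d0 e0; exists (Num.min d e / 2).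
have m0 : 0 < Num.min d e by rewrite lt_min d0.
have : Num.min d e / 2 < Num.min d e by rewrite ltr_pdivrMr// mulr2n mulrDr mulr1 ltrDl.
by rewrite lt_min => /andP[-> ->]; rewrite divr_gt0.
Qed.

Section ComplexModulus.
Variable R : realType.
Local Notation C := R[i].
Implicit Types z w : C.

(** The norm of [R[i]] takes its values in [R[i]]; this real version allows all estimates to be made
    in the ordered field [R]. *)
Definition cmod z : R := complex.Re `|z|.

Lemma cmodE z : `|z| = (cmod z)%:C.
Proof. by rewrite /cmod normc_def. Qed.

Lemma cmod_ge0 z : 0 <= cmod z.
Proof. by rewrite -lecR -cmodE normr_ge0. Qed.

Lemma cmodM z w : cmod (z * w) = cmod z * cmod w.
Proof.
by have := normrM z w; rewrite !cmodE -rmorphM => /(congr1 (@complex.Re R)).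
Qed.

Lemma cmodD z w : cmod (z + w) <= cmod z + cmod w.
Proof. by rewrite -lecR rmorphD -!cmodE ler_normD. Qed.

Lemma cmodN z : cmod (- z) = cmod z.
Proof. by rewrite /cmod normrN. Qed.

Lemma cmodB z w : cmod (z - w) <= cmod z + cmod w.
Proof. by rewrite -(cmodN w) cmodD. Qed.

Lemma cmod_distC z w : cmod (z - w) = cmod (w - z).
Proof. by rewrite -opprB cmodN. Qed.

Lemma cmod0 : cmod 0 = 0.
Proof. by rewrite /cmod normr0. Qed.

Lemma cmod1 : cmod 1 = 1.
Proof. by rewrite /cmod normr1. Qed.

Lemma cmodX z n : cmod (z ^+ n) = cmod z ^+ n.
Proof. by elim: n => [|n IH]; rewrite ?expr0 ?cmod1// !exprS cmodM IH. Qed.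

Lemma cmod_eq0 z : (cmod z == 0) = (z == 0).
Proof. by rewrite -(normr_eq0 z) cmodE (inj_eq (@complexI R) _ 0). Qed.

Lemma cmod_real (u : R) : cmod u%:C = `|u|.
Proof. by rewrite /cmod normc_def /= expr0n /= addr0 sqrtr_sqr. Qed.

Lemma cmod_sum (I : Type) (r : seq I) (P : pred I) (F : I -> C) :
  cmod (\sum_(i <- r | P i) F i) <= \sum_(i <- r | P i) cmod (F i).
Proof.
elim/big_rec2 : _ => [|i y x _ IH]; first by rewrite cmod0.
by apply: le_trans (cmodD _ _) _; rewrite lerD2l.
Qed.

Lemma cmod_Re z : `|complex.Re z| <= cmod z.
Proof. by rewrite -lecR -cmodE; apply: normc_ge_Re. Qed.

Lemma nbhs_cmodP z (A : set C) :
  nbhs z A <-> exists2 e : R, 0 < e & forall w, cmod (w - z) < e -> A w.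
Proof.
split=> [/nbhs_ballP [e /= e0 eA]|[e e0 eA]].
  have ee : e = (complex.Re e)%:C by rewrite RRe_real// gtr0_real.
  exists (complex.Re e) => [|w wz]; first by rewrite -ltcR -ee.
  by apply: eA; rewrite /ball /= distrC cmodE ee ltcR.
apply/nbhs_ballP; exists e%:C => /=; first by rewrite ltcR.
by move=> w; rewrite /ball /= distrC cmodE ltcR => /eA.
Qed.

Lemma cvgn_cmod (u : nat -> C) z (e : R) : u @ \oo --> z -> 0 < e ->
  exists n0, forall n, (n0 <= n)%N -> cmod (u n - z) < e.
Proof.
move=> uz e0; have [] := uz [set w | cmod (w - z) < e].
  by apply/nbhs_cmodP; exists e.
by move=> n0 _ n0u; exists n0 => n /n0u.
Qed.

End ComplexModulus.

Section Taylor.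
Variable R : realType.
Local Notation C := R[i].
Implicit Types (f g : C -> C) (z w : C) (a b : nat -> C) (M K : R).

(* A quantitative form of convergence of the power series, for which closure
   under products is an elementary estimate. *)
Definition taylor_at f z a M K := [/\ 0 <= M, 0 < K & forall N w,
  K * cmod w <= 1 ->
  cmod (f (z + w) - \sum_(i < N) a i * w ^+ i) <= M * (K * cmod w) ^+ N].

Definition taylor f := forall z, exists a M K, taylor_at f z a M K.

Lemma geom_half n : \sum_(i < n) (2^-1 : R) ^+ i <= 2.
Proof.
suff -> : \sum_(i < n) (2^-1 : R) ^+ i = 2 - 2 * 2^-1 ^+ n.
  by rewrite gerBl mulr_ge0// exprn_ge0// invr_ge0.
elim: n => [|n IH]; first by rewrite big_ord0 expr0 mulr1 subrr.
rewrite big_ord_recr /= IH exprS mulrA divff ?pnatr_eq0// mul1r.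
by field.
Qed.

(** The terms of a series that converges at distance d are bounded there, so within distance d / 2
    its tails are dominated by a geometric series of ratio 1 / 2. *)
Lemma analytic_taylor f : analytic f -> taylor f.
Proof.
move=> fA z; have [a] := fA z => /nbhs_cmodP [r r0 fa].
set d := r / 2; have d0 : 0 < d by rewrite divr_gt0.
have dr : d < r by rewrite /d ltr_pdivrMr// mulr2n mulrDr mulr1 ltrDl.
have cd : cmod d%:C = d by rewrite cmod_real ger0_norm// ltW.
(* Convergence at the real offset d forces the terms to 0, hence bounds them; this takes the place
   of Cauchy's estimate. *)
have [B [B0 aB]] : exists B : R, 0 <= B /\ forall n, cmod (a n) * d ^+ n <= B.
  have /fa h : cmod (z + d%:C - z) < r by rewrite addrAC subrr add0r cd.
  have /cvg_series_cvg_0 h2 := cvgP _ h.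
  have := cvg_seq_bounded (cvgP _ h2) => /pinfty_ex_gt0 [B /= B0 aB].
  have eB : B = (complex.Re B)%:C by rewrite RRe_real// gtr0_real.
  exists (complex.Re B); split=> [|n]; first by rewrite ltW// -ltcR -eB.
  have := aB n I; rewrite /= addrAC subrr add0r eB cmodE lecR.
  by rewrite cmodM cmodX cd.
exists a, (2 * B), (2 / d); split=> [||N w Kw].
- by rewrite mulr_ge0.
- by rewrite divr_gt0.
have wd : cmod w <= d / 2.
  by move: Kw; rewrite mulrC mulrA ler_pdivrMr// mul1r -ler_pdivlMr.
set q := cmod w / d.
have q0 : 0 <= q by rewrite divr_ge0 ?cmod_ge0 ?ltW.
have q2 : q <= 2^-1 by rewrite /q ler_pdivrMr// mulrC.
have -> : 2 / d * cmod w = 2 * q by rewrite /q; ring.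
have aq n : cmod (a n * w ^+ n) <= B * q ^+ n.
  rewrite cmodM cmodX /q expr_div_n mulrA ler_pdivlMr ?exprn_gt0//.
  rewrite mulrAC; apply: ler_wpM2r (aB n).
  by rewrite exprn_ge0// cmod_ge0.
clearbody q.
(* K = 2 / d makes K |w| <= 1 mean q <= 1 / 2, so every block of the tail is at most B (2 q)^N times
   a geometric sum below 2, whatever its length m. *)
have part m : cmod (\sum_(i < m) a (N + i)%N * w ^+ (N + i)) <=
    2 * B * (2 * q) ^+ N.
  apply: le_trans (cmod_sum _ _ _) _.
  have le1 (i : 'I_m) : true -> cmod (a (N + i)%N * w ^+ (N + i)) <=
      B * (2 * q) ^+ N * 2^-1 ^+ i.
    move=> _; apply: le_trans (aq _) _; rewrite -mulrA ler_wpM2l//.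
    rewrite exprD exprMn; apply: ler_pM; rewrite ?exprn_ge0//.
      by rewrite ler_peMl ?exprn_ge0// exprn_ege1// ler1n.
    by rewrite lerXn2r ?nnegrE ?invr_ge0.
  apply: le_trans (ler_sum _ le1) _.
  rewrite -mulr_sumr [leRHS](_ : _ = B * (2 * q) ^+ N * 2); last by ring.
  by rewrite ler_wpM2l ?geom_half// mulr_ge0// exprn_ge0// mulr_ge0.
have /fa h : cmod (z + w - z) < r.
  rewrite addrAC subrr add0r; apply: le_lt_trans wd _.
  by apply: lt_trans dr; rewrite ltr_pdivrMr// mulr2n mulrDr mulr1 ltrDl.
(* Only finite blocks have been bounded; a partial sum within e of f (z + w) carries the bound over
   to the remainder. *)
apply/ler_addgt0Pl => e e0; have [m0 hm] := cvgn_cmod h e0.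
have Nm : (N <= maxn N m0)%N by rewrite leq_maxl.
have := hm _ (leq_maxr N m0); rewrite -(subnKC Nm).
set m := (_ - N)%N; rewrite /series /= [z + w - z]addrAC subrr add0r.
rewrite big_mkord big_split_ord /=.
set S := \sum_(i < N) _; set T := \sum_(i < m) _ => fST.
have -> : f (z + w) - S = - (S + T - f (z + w)) + T by ring.
by apply: le_trans (cmodD _ _) _; rewrite lerD ?part// cmodN ltW.
Qed.

End Taylor.

Section TaylorTheory.
Variable R : realType.
Local Notation C := R[i].
Implicit Types (f g : C -> C) (z w : C) (a b : nat -> C) (M K : R).

(** Enlarging K shrinks the disc and weakens the bound, so two functions can be given the same K. *)
Lemma taylor_at_le f z a M K M' K' : M <= M' -> K <= K' ->
  taylor_at f z a M K -> taylor_at f z a M' K'.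
Proof.
move=> MM KK [M0 K0 fa]; split=> [||N w Kw].
- exact: le_trans MM.
- exact: lt_le_trans KK.
have KwK : K * cmod w <= K' * cmod w by rewrite ler_wpM2r ?cmod_ge0.
apply: le_trans (fa N w (le_trans KwK Kw)) _.
have Kw0 : 0 <= K * cmod w by rewrite mulr_ge0 ?cmod_ge0 ?ltW.
apply: ler_pM => //; first exact: exprn_ge0.
by rewrite lerXn2r ?nnegrE// mulr_ge0 ?cmod_ge0// ltW// (lt_le_trans K0).
Qed.

(** At a point with |w| = 1 / K all remainders are at most M, and two consecutive ones differ by the
    term a n w^n. *)
Lemma taylor_at_coef f z a M K : taylor_at f z a M K ->
  forall n, cmod (a n) <= 2 * M * K ^+ n.
Proof.
move=> [M0 K0 fa] n; set w : C := (K^-1)%:C.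
have wK : K * cmod w = 1.
  by rewrite cmod_real ger0_norm ?invr_ge0 ?ltW// divff// gt_eqF.
have w0 : 0 < cmod w by rewrite -(pmulr_rgt0 _ K0) wK.
have := fa n w; have := fa n.+1 w; rewrite wK => /(_ (lexx _)) h1 /(_ (lexx _)).
rewrite !expr1n !mulr1 in h1 * => h2.
have : cmod (a n * w ^+ n) <= 2 * M.
  move: h1 h2; rewrite big_ord_recr /=; set S := \sum_(i < n) _ => h1 h2.
  have -> : a n * w ^+ n = (f (z + w) - S) - (f (z + w) - (S + a n * w ^+ n)).
    by ring.
  by apply: le_trans (cmodB _ _) _; rewrite mulr_natl mulr2n lerD.
rewrite cmodM cmodX -ler_pdivlMr ?exprn_gt0// -exprVn.
suff -> : (cmod w)^-1 = K by [].
by apply: (mulIf (lt0r_neq0 w0)); rewrite wK mulVf ?gt_eqF.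
Qed.

Lemma taylor_cst c : taylor (fun=> c : C).
Proof.
move=> z; exists (fun n => if n == 0%N then c else 0), (cmod c), 1.
split=> [||[|N] w _]; rewrite ?cmod_ge0//.
  by rewrite big_ord0 subr0 mulr1.
rewrite big_ord_recl /= mulr1 big1 => [|i _]; last by rewrite mul0r.
by rewrite addr0 subrr cmod0 mulr_ge0 ?cmod_ge0 ?exprn_ge0 ?mulr_ge0 ?cmod_ge0.
Qed.

Lemma taylor_id : taylor (@id C).
Proof.
move=> z; exists (fun n => if n == 0%N then z else (n == 1%N)%:R), (cmod z + 1), 1.
split=> [||[|[|N]] w]; rewrite ?mul1r ?addr_ge0 ?cmod_ge0//.
- move=> w1; rewrite big_ord0 subr0 mulr1.
  by apply: le_trans (cmodD _ _) _; rewrite lerD2l.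
- move=> w1; rewrite big_ord1 mulr1 [z + w]addrC addrK expr1.
  by rewrite ler_peMl ?cmod_ge0// lerDr cmod_ge0.
move=> _; rewrite 2!big_ord_recl /= mulr1 mul1r expr1 big1 => [|i _].
  rewrite addr0 subrr cmod0 mulr_ge0 ?exprn_ge0 ?cmod_ge0//.
  by rewrite addr_ge0 ?cmod_ge0.
by rewrite mul0r.
Qed.

Lemma taylorD f g : taylor f -> taylor g -> taylor (fun z => f z + g z).
Proof.
move=> tf tg z; have [a [M [K fa]]] := tf z; have [b [M' [K' gb]]] := tg z.
exists (fun n => a n + b n), (M + M'), (Num.max K K').
have [M0 K0 {}fa] : taylor_at f z a M (Num.max K K').
  by apply: taylor_at_le fa => //; rewrite le_max lexx.
have [M'0 _ {}gb] : taylor_at g z b M' (Num.max K K').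
  by apply: taylor_at_le gb => //; rewrite le_max lexx orbT.
split=> [||N w Kw]; [by rewrite addr_ge0|by []|].
rewrite (eq_bigr (fun i : 'I_N => a i * w ^+ i + b i * w ^+ i)); last first.
  by move=> i _; rewrite mulrDl.
rewrite big_split /= opprD addrACA mulrDl.
by apply: le_trans (cmodD _ _) _; rewrite lerD ?fa ?gb.
Qed.

(** Each factor is replaced by its Taylor polynomial of degree below N. The product of the two
    polynomials agrees with the Cauchy product below degree N, so the error consists of the two
    remainders and the part of degree at least N. *)
Lemma taylorM f g : taylor f -> taylor g -> taylor (fun z => f z * g z).
Proof.
move=> tf tg z; have [a [M [K fa]]] := tf z; have [b [M' [K' gb]]] := tg z.
have {}fa : taylor_at f z a M (Num.max K K').
  by apply: taylor_at_le fa => //; rewrite le_max lexx.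
have {}gb : taylor_at g z b M' (Num.max K K').
  by apply: taylor_at_le gb => //; rewrite le_max lexx orbT.
move: (Num.max K K') fa gb => {K K'}K fa gb.
have ca := taylor_at_coef fa; have cb := taylor_at_coef gb.
case: fa gb => M0 K0 fa [M'0 _ gb].
(* The two remainders contribute 1 + 2 to the 11 and the part of high degree contributes 8. That
   part has N terms, with at most 2 N summands in each coefficient; passing from K to 4 K absorbs
   N^2 because N <= 2^N. *)
exists (fun n => \sum_(i < n.+1) a i * b (n - i)%N), (11 * M * M'), (4 * K).
have K4 : K <= 4 * K by rewrite ler_peMl ?ler1n ?ltW.
split=> [||N w Kw]; [by rewrite !mulr_ge0|by rewrite mulr_gt0|].
have Kw1 : K * cmod w <= 1.
  by apply: le_trans Kw; rewrite ler_wpM2r ?cmod_ge0.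
set q := K * cmod w in Kw1 *.
have q0 : 0 <= q by rewrite mulr_ge0 ?cmod_ge0 ?ltW.
pose P : {poly C} := \poly_(i < N) a i.
pose Q : {poly C} := \poly_(i < N) b i.
have PE : P.[w] = \sum_(i < N) a i * w ^+ i by rewrite horner_poly.
have QE : Q.[w] = \sum_(i < N) b i * w ^+ i by rewrite horner_poly.
have hP : cmod (f (z + w) - P.[w]) <= M * q ^+ N by rewrite PE fa.
have hQ : cmod (g (z + w) - Q.[w]) <= M' * q ^+ N by rewrite QE gb.
have hf : cmod (f (z + w)) <= M.
  by have := fa 0%N w Kw1; rewrite big_ord0 subr0 mulr1.
have hg : cmod (g (z + w)) <= M'.
  by have := gb 0%N w Kw1; rewrite big_ord0 subr0 mulr1.
have qN0 : 0 <= q ^+ N by rewrite exprn_ge0.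
have qN1 : q ^+ N <= 1 by rewrite exprn_ile1.
have hP2 : cmod P.[w] <= 2 * M.
  have -> : P.[w] = f (z + w) - (f (z + w) - P.[w]) by ring.
  apply: le_trans (cmodB _ _) _; rewrite mulr_natl mulr2n lerD//.
  by apply: le_trans hP _; rewrite ler_piMr.
have coefP (n : nat) : cmod P`_n <= 2 * M * K ^+ n.
  rewrite coef_poly; case: ifP => _; first exact: ca.
  by rewrite cmod0 !mulr_ge0// exprn_ge0// ltW.
have coefQ (n : nat) : cmod Q`_n <= 2 * M' * K ^+ n.
  rewrite coef_poly; case: ifP => _; first exact: cb.
  by rewrite cmod0 !mulr_ge0// exprn_ge0// ltW.
have sPQ : (size (P * Q)%R <= N + N)%N.
  apply: (leq_trans (size_polyMleq P Q)); apply: leq_trans (leq_pred _) _.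
  by apply: leq_add; apply: size_poly.
have PQE : P.[w] * Q.[w] = \sum_(n < N) (P * Q)`_n * w ^+ n +
    \sum_(n < N) (P * Q)`_(N + n) * w ^+ (N + n).
  by rewrite -hornerM (horner_coef_wide _ sPQ) big_split_ord.
have low : \sum_(n < N) (P * Q)`_n * w ^+ n =
    \sum_(n < N) (\sum_(i < n.+1) a i * b (n - i)%N) * w ^+ n.
  apply: eq_bigr => n _; rewrite coefM; congr (_ * _).
  apply: eq_bigr => i _; rewrite !coef_poly.
  have iN : (i < N)%N by rewrite (leq_trans (ltn_ord i)).
  have niN : (n - i < N)%N by rewrite (leq_ltn_trans (leq_subr _ _)).
  by rewrite iN niN.
have high : cmod (\sum_(n < N) (P * Q)`_(N + n) * w ^+ (N + n)) <=
    8 * M * M' * (4 * q) ^+ N.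
  apply: le_trans (cmod_sum _ _ _) _.
  have le1 (n : 'I_N) : true -> cmod ((P * Q)`_(N + n) * w ^+ (N + n)) <=
      4 * M * M' * q ^+ N * (N + N)%:R.
    move=> _; rewrite cmodM cmodX.
    have c1 : cmod (P * Q)`_(N + n) <= 4 * M * M' * K ^+ (N + n) * (N + N)%:R.
      rewrite coefM; apply: le_trans (cmod_sum _ _ _) _.
      have le2 (i : 'I_(N + n).+1) : true -> cmod (P`_i * Q`_(N + n - i)) <=
          4 * M * M' * K ^+ (N + n).
        move=> _; rewrite cmodM -[in K ^+ _](@subnKC i (N + n)) -1?ltnS//.
        rewrite exprD [leRHS](_ : _ = (2 * M * K ^+ i) *
          (2 * M' * K ^+ (N + n - i))); last by ring.
        by apply: ler_pM; rewrite ?cmod_ge0.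
      apply: le_trans (ler_sum _ le2) _.
      rewrite sumr_const card_ord -[_ *+ _.+1]mulr_natr ler_wpM2l//.
        by rewrite !mulr_ge0// exprn_ge0// ltW.
      by rewrite ler_nat -addnS leq_add2l.
    apply: le_trans (ler_wpM2r _ c1) _; first by rewrite exprn_ge0// cmod_ge0.
    rewrite [leLHS](_ : _ = 4 * M * M' * (N + N)%:R * (q ^+ N * q ^+ n));
      last by rewrite -exprD /q exprMn; move: (N + n)%N (N + N)%:R => k t; ring.
    rewrite [leRHS](_ : _ = 4 * M * M' * (N + N)%:R * q ^+ N); last by ring.
    by rewrite ler_wpM2l ?mulr_ge0// ler_piMr// exprn_ile1.
  apply: le_trans (ler_sum _ le1) _.
  rewrite sumr_const card_ord -[_ *+ N]mulr_natr natrD [(4 * q) ^+ N]exprMn.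
  rewrite [leLHS](_ : _ = 8 * M * M' * ((N%:R * N%:R) * q ^+ N)); last by ring.
  rewrite ler_wpM2l ?mulr_ge0// ler_wpM2r// (_ : 4 = 2 * 2); last by ring.
  by rewrite exprMn -natrX -!natrM ler_nat leq_mul// ltnW// ltn_expl.
have -> : 4 * K * cmod w = 4 * q by rewrite /q mulrA.
have q4N : q ^+ N <= (4 * q) ^+ N.
  by rewrite [(4 * q) ^+ N]exprMn ler_peMl// exprn_ege1// ler1n.
rewrite -low.
set H := \sum_(n < N) _ in high PQE; set L := \sum_(n < N) _ in PQE *.
have -> : f (z + w) * g (z + w) - L = (f (z + w) - P.[w]) * g (z + w) +
    P.[w] * (g (z + w) - Q.[w]) + H.
  rewrite (_ : L = P.[w] * Q.[w] - H); last by rewrite PQE addrK.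
  ring.
apply: le_trans (cmodD _ _) _; rewrite [leRHS](_ : _ = 3 * M * M' * (4 * q) ^+ N +
  8 * M * M' * (4 * q) ^+ N); last by ring.
apply: lerD high.
apply: le_trans (cmodD _ _) _; rewrite !cmodM.
have -> : 3 * M * M' * (4 * q) ^+ N =
  M * (4 * q) ^+ N * M' + 2 * M * (M' * (4 * q) ^+ N) by ring.
apply: lerD; apply: ler_pM; rewrite ?cmod_ge0//.
  by apply: le_trans hP _; rewrite ler_wpM2l.
by apply: le_trans hQ _; rewrite ler_wpM2l.
Qed.

End TaylorTheory.

(** * Isolated zeros and strict differentiability *)

Section TaylorLocal.
Variable R : realType.
Local Notation C := R[i].
Implicit Types (f g : C -> C) (z w : C) (a b : nat -> C) (M K : R).

Lemma le_add_geometric (x y c : R) :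
  (forall n, x <= y + c * 2^-1 ^+ n) -> x <= y.
Proof.
move=> h; apply/ler_addgt0Pl => e e0; rewrite addrC.
have [n cn] : exists n : nat, `|c| / e < n%:R.
  by exists (Num.truncn (`|c| / e)).+1; rewrite truncnS_gt.
apply: le_trans (h n) _; rewrite lerD2l; apply: le_trans (ler_norm _) _.
rewrite normrM [`|_ ^+ n|]ger0_norm ?exprn_ge0 ?invr_ge0// exprVn.
rewrite ler_pdivrMr ?exprn_gt0//; apply: ltW.
rewrite mulrC -ltr_pdivrMr//; apply: lt_trans cn _.
by rewrite -natrX ltr_nat ltn_expl.
Qed.

(** If all coefficients vanish, |f| is at most M 2^-n near z for every n; otherwise the first
    nonzero term dominates the remainder that follows it. *)
Lemma taylor_zeros f : taylor f -> forall z,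
  (exists2 d : R, 0 < d & forall w, cmod w < d -> f (z + w) = 0) \/
  (exists2 d : R, 0 < d & forall w, cmod w < d -> w != 0 -> f (z + w) != 0).
Proof.
move=> tf z; have [a [M [K fa]]] := tf z; have [M0 K0 faN] := fa.
have Kd w d : cmod w < d / K -> K * cmod w < d.
  by rewrite ltr_pdivlMr// mulrC.
have [a0|] := pselect (forall n, a n = 0).
  left; exists (2^-1 / K) => [|w wK]; first by rewrite divr_gt0 ?invr_gt0.
  apply/eqP; rewrite -cmod_eq0 eq_le cmod_ge0 andbT.
  have Kw0 : 0 <= K * cmod w by rewrite mulr_ge0 ?cmod_ge0 ?ltW.
  apply: (@le_add_geometric _ _ M) => n; rewrite add0r.
  have -> : f (z + w) = f (z + w) - \sum_(i < n) a i * w ^+ i.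
    by rewrite big1 ?subr0// => i _; rewrite a0 mul0r.
  apply: le_trans (faN n w _) _.
    by rewrite (le_trans (ltW (Kd _ _ wK)))// invf_le1 ?ler1n.
  by rewrite ler_wpM2l// lerXn2r ?nnegrE ?invr_ge0// ltW ?Kd.
move=> /existsNP ex; right.
have {}ex : exists n, a n != 0 by case: ex => n /eqP; exists n.
case: (ex_minnP ex) => k ak mink.
have ck : 0 < cmod (a k) by rewrite lt_def cmod_eq0 ak cmod_ge0.
(* A zero at w <> 0 would give |a k| <= M K^(k+1) |w|, which |w| < |a k| / B excludes; the summand 1
   keeps B positive. *)
set B := M * K ^+ k.+1 + 1.
have B0 : 0 < B by rewrite ltr_wpDl// mulr_ge0// exprn_ge0// ltW.
exists (Num.min (1 / K) (cmod (a k) / B)) => [|w].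
  by rewrite lt_min !divr_gt0.
rewrite lt_min => /andP[/Kd/ltW w1 w2] w0; apply/eqP => fw0.
have := faN k.+1 w w1; rewrite fw0 sub0r cmodN big_ord_recr /=.
rewrite big1 => [|i _]; last first.
  have [->|ai] := eqVneq (a i) 0; first by rewrite mul0r.
  by have := mink _ ai; rewrite leqNgt ltn_ord.
rewrite add0r cmodM cmodX exprMn [cmod w ^+ k.+1]exprS !mulrA.
rewrite ler_pM2r ?exprn_gt0//; last by rewrite lt_def cmod_eq0 w0 cmod_ge0.
move: w2; rewrite ltr_pdivlMr// /B.
by move: (M * K ^+ k.+1) (cmod_ge0 w) => X; nra.
Qed.

Lemma subrXX_cmod z w (m : R) n : cmod z <= m -> cmod w <= m ->
  cmod (z ^+ n.+1 - w ^+ n.+1) <= cmod (z - w) * (n.+1%:R * m ^+ n).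
Proof.
move=> zm wm; have m0 : 0 <= m by apply: le_trans zm; rewrite cmod_ge0.
rewrite subrXX cmodM ler_wpM2l ?cmod_ge0//.
apply: le_trans (cmod_sum _ _ _) _; rewrite mulr_natl -[X in _ *+ X]card_ord -sumr_const.
apply: ler_sum => i _; rewrite cmodM !cmodX /=.
rewrite -[n in leRHS](@subnK i n) -1?ltnS// exprD.
by apply: ler_pM; rewrite ?exprn_ge0 ?cmod_ge0 ?lerXn2r ?nnegrE ?cmod_ge0.
Qed.

(* Strict differentiability at z, which gives locally uniform convergence of
   difference quotients. *)
Definition sderive_at f z (a : C) := exists B d : R, [/\ 0 <= B, 0 < d
  & forall w e, cmod w < d -> cmod e < d ->
    cmod (f (z + w + e) - f (z + w) - a * e) <= B * cmod e * (cmod w + cmod e)].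

(** In the difference of the Taylor polynomials at w + e and w the constant terms cancel and the
    linear ones give a 1 e. Each remaining difference of powers has the factor e and at least one
    more factor of size |w| + |e|. *)
Lemma taylor_sderive f : taylor f -> forall z, exists a : C, sderive_at f z a.
Proof.
move=> tf z; have [a [M [K fa]]] := tf z; have [M0 K0 faN] := fa.
have ca := taylor_at_coef fa.
(* The radius gives K m <= 1 / 4 for m = |w| + |e|. The term of degree i + 2 then carries (i + 2) (K
   m)^i <= 2 * 2^-i, whose sum is at most 4; another factor 2 comes from the bound on the
   coefficients. *)
exists (a 1%N), (8 * M * K ^+ 2), (8 * K)^-1; split=> [||w e wd ed].
- by rewrite !mulr_ge0 ?(ltW K0).
- by rewrite invr_gt0 mulr_gt0.
set m := cmod w + cmod e.
have m0 : 0 <= m by rewrite addr_ge0 ?cmod_ge0.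
have Km : K * m <= 4^-1.
  have := ltrD wd ed; rewrite -/m => /ltW h.
  rewrite -(ler_pM2l K0) in h; apply: le_trans h _.
  by rewrite le_eqVlt; apply/orP; left; apply/eqP; field; rewrite gt_eqF.
have wm : cmod w <= m by rewrite lerDl cmod_ge0.
have wem : cmod (w + e) <= m by exact: cmodD.
have Km0 : 0 <= K * m by rewrite mulr_ge0 ?(ltW K0).
have Kx x : cmod x <= m -> K * cmod x <= K * m by rewrite ler_pM2l.
have K1 : (4^-1 : R) <= 1 by rewrite invf_le1 ?ler1n.
(* Replacing both values of f by Taylor polynomials of order n + 2 costs at most 2 M 2^-n, which
   disappears as n grows. *)
apply: (@le_add_geometric _ _ (2 * M)) => n.
have E x : cmod x <= m ->
    cmod (f (z + x) - \sum_(i < n.+2) a i * x ^+ i) <= M * 2^-1 ^+ n.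
  move=> xm; apply: le_trans (faN n.+2 _ _) _.
    exact: le_trans (Kx _ xm) (le_trans Km K1).
  rewrite ler_wpM2l//; apply: (@le_trans _ _ (2^-1 ^+ n.+2)).
    rewrite lerXn2r ?nnegrE ?invr_ge0 ?mulr_ge0 ?cmod_ge0 ?(ltW K0)//.
    by apply: le_trans (Kx _ xm) (le_trans Km _); rewrite lef_pV2 ?posrE ?ler_nat.
  rewrite -[n.+2]addn2 exprD ler_piMr ?exprn_ge0 ?invr_ge0//.
  by rewrite exprn_ile1 ?invr_ge0// invf_le1 ?ler1n.
have Ew := E _ wm; have Ewe := E _ wem; rewrite -[z + w + e]addrA.
set F := f (z + (w + e)) in Ewe *; set G := f (z + w) in Ew *.
set S := \sum_(i < n.+2) a i * (w + e) ^+ i in Ewe.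
set T := \sum_(i < n.+2) a i * w ^+ i in Ew.
have ST : S - T - a 1%N * e =
    \sum_(i < n) a i.+2 * ((w + e) ^+ i.+2 - w ^+ i.+2).
  rewrite /S /T -sumrB 2!big_ord_recl /= /bump /= add1n.
  set Z := \sum_(i < n) _; rewrite [LHS](_ : _ = Z); last by ring.
  by apply: eq_bigr => i _; rewrite !add1n mulrBr.
have STB : cmod (S - T - a 1%N * e) <= 8 * M * K ^+ 2 * cmod e * m.
  rewrite ST; apply: le_trans (cmod_sum _ _ _) _.
  have le1 (i : 'I_n) : true ->
      cmod (a i.+2 * ((w + e) ^+ i.+2 - w ^+ i.+2)) <=
      4 * M * K ^+ 2 * cmod e * m * 2^-1 ^+ i.
    move=> _; rewrite cmodM.
    have h1 := subrXX_cmod i.+1 wem wm.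
    rewrite [w + e - w]addrAC subrr add0r in h1.
    apply: le_trans (ler_pM (cmod_ge0 _) (cmod_ge0 _) (ca _) h1) _.
    rewrite [leLHS](_ : _ = 2 * M * K ^+ 2 * cmod e * m *
      (i.+2%:R * (K * m) ^+ i)); last by rewrite exprMn !exprS; ring.
    rewrite [leRHS](_ : _ = 2 * M * K ^+ 2 * cmod e * m *
      (2 * 2^-1 ^+ i)); last by ring.
    rewrite ler_wpM2l ?mulr_ge0 ?cmod_ge0 ?exprn_ge0 ?(ltW K0)//.
    have -> : 2 * 2^-1 ^+ i = 2 ^+ i.+1 * (4^-1 ^+ i) :> R.
      rewrite exprS -mulrA -exprMn; congr (_ * _ ^+ _); by field.
    apply: ler_pM; rewrite ?exprn_ge0//.
      by rewrite -natrX ler_nat ltn_expl.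
    by rewrite lerXn2r ?nnegrE ?invr_ge0.
  apply: le_trans (ler_sum _ le1) _; rewrite -mulr_sumr.
  rewrite [leRHS](_ : _ = 4 * M * K ^+ 2 * cmod e * m * 2); last by ring.
  rewrite ler_wpM2l ?geom_half ?mulr_ge0 ?cmod_ge0 ?exprn_ge0 ?(ltW K0)//.
have -> : F - G - a 1%N * e = (S - T - a 1%N * e) + ((F - S) - (G - T)) by ring.
apply: le_trans (cmodD _ _) _; apply: lerD STB _.
by apply: le_trans (cmodB _ _) _; rewrite mulr_natl mulr2n mulrDl lerD.
Qed.

End TaylorLocal.

(** * Identity theorem and continuity *)

Section TaylorGlobal.
Variable R : realType.
Local Notation C := R[i].
Implicit Types (f g : C -> C) (z w : C).

(** Since zeros are isolated unless f vanishes on a disc, an accumulation point of zeros is the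
    centre of such a disc. A supremum argument along the segment from z0 to an arbitrary z1 shows
    that these centres reach z1. *)
Lemma taylor_identity f z0 : taylor f ->
  (forall d : R, 0 < d -> exists w, [/\ w != 0, cmod w < d & f (z0 + w) = 0]) ->
  forall z, f z = 0.
Proof.
move=> tf acc z1.
pose vanish z := exists2 d : R, 0 < d & forall w, cmod w < d -> f (z + w) = 0.
have vanish_acc z : (forall d : R, 0 < d ->
    exists w, [/\ w != 0, cmod w < d & f (z + w) = 0]) -> vanish z.
  case: (taylor_zeros tf z) => // -[d d0 dn] /(_ _ d0) [w [w0 wd fw]].
  by have := dn _ wd w0; rewrite fw eqxx.
have [<-|z01] := eqVneq z0 z1.
  by have [d d0 /(_ 0)] := vanish_acc _ acc; rewrite cmod0 addr0; apply.
pose g (t : R) := z0 + t%:C * (z1 - z0).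
set D := cmod (z1 - z0).
have D0 : 0 < D by rewrite lt_def cmod_ge0 andbT cmod_eq0 subr_eq0 eq_sym.
have gB s t : g s = g t + (s - t)%:C * (z1 - z0) by rewrite /g rmorphB; ring.
have cg s t : cmod ((s - t)%:C * (z1 - z0)) = `|s - t| * D.
  by rewrite cmodM cmod_real.
have vanish_open t : vanish (g t) ->
    exists2 d : R, 0 < d & forall s, `|s - t| < d -> vanish (g s).
  move=> [d d0 fd]; exists (d / D / 2) => [|s st]; first by rewrite !divr_gt0.
  exists (d / 2) => [|w wd]; first by rewrite divr_gt0.
  rewrite (gB s t) -addrA fd//; apply: le_lt_trans (cmodD _ _) _.
  rewrite [d]splitr ltrD// cg -ltr_pdivlMr//.
  by rewrite [_ / D](_ : _ = d / D / 2)//; ring.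
pose S := [set t : R | 0 <= t <= 1 /\ forall s, 0 <= s <= t -> vanish (g s)].
have S0 : S 0.
  split=> [|s]; first by rewrite lexx ler01.
  move=> /le_anti <-; rewrite /g mul0r addr0; exact: vanish_acc.
have ubS : ubound S 1 by move=> t [/andP[]].
have supS : has_sup S by split; [exists 0|exists 1].
have T0 : 0 <= sup S by apply: ub_le_sup => //; exists 1.
have T1 : sup S <= 1 by apply: ge_sup => //; exists 0.
have below s : 0 <= s -> s < sup S -> vanish (g s).
  move=> s0 sS; have e0 : 0 < sup S - s by rewrite subr_gt0.
  have [t [_ tv]] := sup_adherent e0 supS.
  by rewrite opprB addrC subrK => st; apply: tv; rewrite s0 ltW.
(* The points of the segment just below the supremum are zeros that accumulate at it. *)
have vT : vanish (g (sup S)).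
  have [<-|S_neq0] := eqVneq 0 (sup S).
    by have [_] := S0; apply; rewrite lexx.
  have {S_neq0} Sgt0 : 0 < sup S by rewrite lt_def eq_sym S_neq0.
  apply: vanish_acc => d d0.
  pose s := Num.max 0 (sup S - d / D / 2).
  have dD : 0 < d / D / 2 by rewrite !divr_gt0.
  have s0 : 0 <= s by rewrite le_max lexx.
  have sT : s < sup S by rewrite gt_max Sgt0 gtrBl.
  exists ((s - sup S)%:C * (z1 - z0)); split.
  - by rewrite -cmod_eq0 cg mulf_neq0 ?gt_eqF// normr_gt0 subr_eq0 lt_eqF.
  - rewrite cg -ltr_pdivlMr// distrC ger0_norm ?subr_ge0 ?ltW//.
    have : sup S - d / D / 2 <= s by rewrite le_max lexx orbT.
    have : 0 < d / D by rewrite divr_gt0.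
    lra.
  - rewrite -gB; have [e e0 /(_ 0)] := below _ s0 sT.
    by rewrite cmod0 addr0; apply.
have below_eq s : 0 <= s <= sup S -> vanish (g s).
  by move=> /andP[s0]; rewrite le_eqVlt => /orP[/eqP->//|]; exact: below.
(* Otherwise the disc around the supremum would extend [S] beyond it. *)
have {T1}T1 : sup S = 1.
  apply/eqP; rewrite eq_le T1 leNgt; apply/negP => Slt1.
  have [d d0 dv] := vanish_open _ vT.
  pose t := Num.min 1 (sup S + d / 2).
  have d20 : 0 < d / 2 by rewrite divr_gt0.
  have St : sup S < t by rewrite lt_min Slt1 ltrDl.
  suff /(ub_le_sup (ex_intro _ _ ubS)) : S t by rewrite leNgt St.
  split=> [|s /andP[s0 st]].
    by rewrite (ltW (le_lt_trans T0 St)) ge_min lexx.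
  have [sT|Ts] := leP s (sup S); first by apply: below_eq; rewrite s0.
  apply: dv; rewrite ger0_norm ?subr_ge0 ?ltW//.
  have : t <= sup S + d / 2 by rewrite ge_min lexx orbT.
  lra.
move: vT; rewrite T1 => -[d d0 /(_ 0)]; rewrite cmod0 addr0 /g rmorph1 mul1r.
by move=> h; rewrite -[z1](subrK z0) addrC h.
Qed.

Lemma taylor_continuous f : taylor f -> continuous f.
Proof.
move=> tf z; have [a [B [d [B0 d0 fa]]]] := taylor_sderive tf z.
move=> A /nbhs_cmodP [e e0 eA]; apply/nbhs_cmodP.
set M := cmod a + B * d + 1.
have M0 : 0 < M.
  rewrite ltr_wpDl// addr_ge0 ?cmod_ge0//.
  by rewrite mulr_ge0 ?(ltW d0).
exists (Num.min d (e / M)); first by rewrite lt_min d0 divr_gt0.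
move=> w; rewrite lt_min => /andP[wd]; rewrite ltr_pdivlMr// => we; apply: eA.
have := fa 0 (w - z); rewrite cmod0 add0r addr0 [z + _]addrC subrK => /(_ d0 wd).
set h := w - z in wd we *; set q := f w - f z => qh.
have -> : q = q - a * h + a * h by rewrite subrK.
apply: le_lt_trans (cmodD _ _) _; rewrite cmodM; apply: le_lt_trans we.
rewrite /M; have h0 := cmod_ge0 h; have a0 := cmod_ge0 a.
have : B * cmod h * cmod h <= B * d * cmod h.
  by rewrite ler_wpM2r// ler_wpM2l// ltW.
by move: qh; lra.
Qed.

End TaylorGlobal.

Lemma ReD (R : realType) : {morph @complex.Re R : x y / x + y}.
Proof. by case=> [a b] [c d]. Qed.

Lemma ReB (R : realType) : {morph @complex.Re R : x y / x - y}.
Proof. by case=> [a b] [c d]. Qed.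

(** * Real analytic functions of one variable *)

Section RealAnalytic.
Variable R : realType.
Implicit Types (r : R -> R) (c : nat -> R).

Definition real_analytic r := forall u : R, exists c, exists2 d : R, 0 < d &
  forall t, `|t| < d -> pseries c t @ \oo --> r (u + t).

(** For a real increment t the real part of a n t^n is (Re a n) t^n, so taking real parts of the
    coefficients suffices. *)
Lemma analytic_real (rho : R[i] -> R[i]) : analytic rho ->
  real_analytic (rhoR rho).
Proof.
move=> rhoA u; have [a] := rhoA u%:C => /nbhs_cmodP [d d0 ad].
exists (fun n => complex.Re (a n)), d => // t td.
have /ad : cmod ((u + t)%:C - u%:C) < d.
  by rewrite rmorphD addrAC subrr add0r cmod_real.
rewrite -rmorphB [u + t - u]addrAC subrr add0r => h.
apply/cvgrPdist_lt => e e0; have [n0 hn] := cvgn_cmod h e0.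
exists n0 => // n /= /hn; apply: le_lt_trans; rewrite distrC.
apply: le_trans (cmod_Re _); rewrite ReB le_eqVlt; apply/orP; left.
apply/eqP; congr (`|_ - _|).
rewrite /pseries /series /= (big_morph (@complex.Re R) (@ReD R) (erefl : complex.Re 0 = 0)).
apply: eq_bigr => i _.
by rewrite -rmorphXn; case: (a i) => x y /=; rewrite mulr0 subr0.
Qed.

(** The terms at x are bounded. The ratio 1 / 4 leaves a factor 4^-n: one half of it absorbs n + 1
    <= 2^n from the differentiation, the other half gives a convergent geometric majorant. *)
Lemma is_cvg_pseries_diffs c (x y : R) : cvgn (pseries c x) -> `|y| < `|x| / 4 ->
  cvgn (pseries (pseries_diffs c) y).
Proof.
move=> cx yx.
have x0 : 0 < `|x| by have := normr_ge0 y; lra.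
have /cvg_series_cvg_0 h2 := cx.
have := cvg_seq_bounded (cvgP _ h2) => /pinfty_ex_gt0 [B /= B0 cB].
apply: normed_cvg.
apply: (@series_le_cvg _ _ (geometric (B / `|x|) 2^-1)).
- by move=> n /=; apply: normr_ge0.
- by move=> n; rewrite /geometric /= mulr_ge0 ?exprn_ge0 ?divr_ge0 ?invr_ge0 ?(ltW B0).
- move=> n; rewrite /= /pseries_diffs !normrM normr_nat normrX.
  have := cB n.+1 I; rewrite /= normrM normrX exprS mulrA.
  set C := `|c n.+1| => hC.
  have yx' : `|y| <= `|x| * 4^-1 by apply: ltW.
  have h1 : `|y| ^+ n <= `|x| ^+ n * 4^-1 ^+ n.
    by rewrite -exprMn lerXn2r ?nnegrE ?mulr_ge0 ?invr_ge0.
  have C0 : 0 <= C by exact: normr_ge0.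
  have h2' : n.+1%:R * (4^-1 ^+ n) <= 2^-1 ^+ n :> R.
    have -> : 2^-1 ^+ n = 2 ^+ n * (4^-1 ^+ n) :> R.
      by rewrite -exprMn; congr (_ ^+ _); field.
    by rewrite ler_wpM2r ?exprn_ge0 ?invr_ge0// -natrX ler_nat ltn_expl.
  apply: (@le_trans _ _ (C * (n.+1%:R * (4^-1 ^+ n)) * `|x| ^+ n)).
    rewrite [leRHS](_ : _ = n.+1%:R * C * (`|x| ^+ n * 4^-1 ^+ n)); last by ring.
    by rewrite ler_wpM2l ?mulr_ge0.
  apply: (@le_trans _ _ (C * 2^-1 ^+ n * `|x| ^+ n)).
    by rewrite ler_wpM2r ?exprn_ge0// ler_wpM2l.
  rewrite [leLHS](_ : _ = C * `|x| * `|x| ^+ n / `|x| * 2^-1 ^+ n); last first.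
    by field; rewrite gt_eqF.
  by rewrite ler_wpM2r ?exprn_ge0 ?invr_ge0// ler_wpM2r ?invr_ge0.
- apply: is_cvg_geometric_series; rewrite ger0_norm ?invr_ge0//.
  by rewrite invf_lt1 ?ltr1n.
Qed.

Lemma real_analytic_derive r : real_analytic r ->
  (forall u, derivable r u 1) /\ real_analytic (derive1 r).
Proof.
move=> rA; suff H u : exists c, exists2 d : R, 0 < d & forall t, `|t| < d ->
    cvgn (pseries c t) /\ is_derive (u + t) 1 r (limn (pseries c t)).
  split=> u; have [c [d d0 h]] := H u.
    have [|_ [dr _]] := h 0; first by rewrite normr0.
    by rewrite addr0 in dr.
  exists c, d => // t /h [ct rt]; rewrite derive1E; have -> := @derive_val _ _ _ _ _ _ _ rt.
  exact: ct.
have [c [d d0 hc]] := rA u.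
(* Term by term differentiation uses the convergence of the series and of its first two formal
   derivatives at d / 60. Each differentiation divides the available radius by 4: d / 2 gives d / 8,
   then d / 10 gives d / 40, which still exceeds d / 60 > d / 64. *)
exists (pseries_diffs c), (d / 64); first by rewrite divr_gt0.
move=> t td.
have cc x : `|x| < d -> cvgn (pseries c x) by move=> /hc /cvgP.
have nd k : (0 < k)%N -> `|d / k%:R| = d / k%:R.
  by move=> k0; rewrite ger0_norm// divr_ge0 ?ler0n ?(ltW d0).
have cd x : `|x| < d / 8 -> cvgn (pseries (pseries_diffs c) x).
  move=> xd; apply: (@is_cvg_pseries_diffs _ (d / 2)); rewrite ?nd//; last by lra.
  by apply: cc; rewrite nd//; lra.
have cdd x : `|x| < d / 40 -> cvgn (pseries (pseries_diffs (pseries_diffs c)) x).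
  move=> xd; apply: (@is_cvg_pseries_diffs _ (d / 10)); rewrite ?nd//; last by lra.
  by apply: cd; rewrite nd//; lra.
have KE : `|d / 60| = d / 60 by rewrite nd.
split; first by apply: cd; lra.
have : is_derive t 1 (fun x => limn (pseries c x)) (limn (pseries (pseries_diffs c) t)).
  by apply: (@pseries_snd_diffs _ _ (d / 60)); rewrite ?KE;
    [apply: cc|apply: cd|apply: cdd|]; rewrite ?KE; lra.
set F := fun x => _; set l := limn _ => Ft.
have Fs : is_derive (u + t) 1 (F \o shift (- u)) l.
  have sh : is_derive (u + t) 1 (shift (- u) : R -> R) 1.
    exact: is_derive_shift.
  rewrite -[l]mulr1; apply: is_derive1_comp => /=.
  by rewrite [u + t - u]addrAC subrr add0r.
apply: near_eq_is_derive Fs.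
have tN : `|u + t - u| < d by rewrite addrAC subrr add0r; lra.
near=> x; rewrite /F /=.
have /hc : `|x - u| < d.
  near: x; apply: (cvgr_lt _ _ _ tN).
  by apply: cvg_norm; apply: cvgB; [exact: cvg_id|exact: cvg_cst].
by rewrite [u + _]addrC subrK => /cvg_lim ->.
Unshelve. all: by end_near. Qed.

End RealAnalytic.

(** * Smooth functions and the ambient bracket *)

Section SmoothFunctions.
Variable R : realType.
Local Notation E := (R * R * R)%type.
Implicit Types (F G : E -> R) (u v p : E).

(** [smooth] quantifies over lists of directions; here the order is an explicit number and the first
    derivative taken is peeled off, which is the form that induction with the Leibniz rule needs. *)
Fixpoint ndiff n F : Prop := (forall p, differentiable F p) /\
  if n is m.+1 then forall v, ndiff m (fun q => 'D_v F q) else True.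

Lemma ndiff_diff n F p : ndiff n F -> differentiable F p.
Proof. by case: n => [|n] []. Qed.

Lemma ndiffS n F : ndiff n.+1 F -> ndiff n F.
Proof.
elim: n F => [F [dF _]|n IH F [dF vF]]; first by split.
by split=> // v; apply: IH; apply: vF.
Qed.

Lemma smoothP F : smooth F <-> forall n, ndiff n F.
Proof.
split=> [sF n|nF vs].
  elim: n F sF => [|n IH] F sF; first by split=> // p; apply: (sF [::]).
  split=> [p|v]; first exact: (sF [::]).
  apply: IH => vs p; have := sF (rcons vs v) p.
  by rewrite foldr_rcons.
elim/last_ind: vs F nF => [|vs v IH] F nF p; first by case: (nF 0%N).
rewrite foldr_rcons; apply: IH => n; have [_ h] := nF n.+1; exact: h.
Qed.

Lemma smooth_diff F p : smooth F -> differentiable F p.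
Proof. by move=> sF; exact: (sF [::]). Qed.

Lemma smooth_derive F v : smooth F -> smooth (fun q => 'D_v F q).
Proof. by move=> /smoothP sF; apply/smoothP => n; have [_ h] := sF n.+1; exact: h. Qed.

Lemma smooth_derivable F v p : smooth F -> derivable F p v.
Proof. by move=> /smooth_diff sF; apply: diff_derivable. Qed.

Lemma smooth_cst (c : R) : smooth (fun _ : E => c).
Proof.
apply/smoothP => n; elim: n c => [|n IH] c; first by split=> // p; exact: differentiable_cst.
split=> [p|v]; first exact: differentiable_cst.
have -> : (fun q : E => 'D_v (fun=> c) q) = fun=> 0.
  by apply/funext => q; apply: derive_cst.
exact: IH.
Qed.

Lemma ndiffD n F G : ndiff n F -> ndiff n G -> ndiff n (fun p => F p + G p).
Proof.
elim: n F G => [|n IH] F G [dF vF] [dG vG].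
  by split=> // p; apply: differentiableD.
split=> [p|v]; first exact: differentiableD.
have -> : (fun q => 'D_v (fun p => F p + G p) q) =
    fun q => 'D_v F q + 'D_v G q.
  by apply/funext => q; apply: deriveD; apply: diff_derivable.
exact: IH (vF v) (vG v).
Qed.

Lemma ndiffM n F G : ndiff n F -> ndiff n G -> ndiff n (fun p => F p * G p).
Proof.
elim: n F G => [|n IH] F G nF nG.
  by split=> // p; apply: differentiableM; apply: ndiff_diff; eassumption.
have [dF vF] := nF; have [dG vG] := nG.
split=> [p|v]; first exact: differentiableM.
have -> : (fun q => 'D_v (fun p => F p * G p) q) =
    fun q => F q * 'D_v G q + G q * 'D_v F q.
  by apply/funext => q; apply: deriveM; apply: diff_derivable.
by apply: ndiffD; apply: IH; (exact: vF || exact: vG || exact: ndiffS).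
Qed.

Lemma smoothD F G : smooth F -> smooth G -> smooth (fun p => F p + G p).
Proof. by move=> /smoothP sF /smoothP sG; apply/smoothP => n; exact: ndiffD. Qed.

Lemma smoothM F G : smooth F -> smooth G -> smooth (fun p => F p * G p).
Proof. by move=> /smoothP sF /smoothP sG; apply/smoothP => n; exact: ndiffM. Qed.

Lemma smoothN F : smooth F -> smooth (fun p => - F p).
Proof.
move=> sF; have -> : (fun p => - F p) = fun p => -1 * F p.
  by apply/funext => p; rewrite mulN1r.
by apply: smoothM => //; exact: smooth_cst.
Qed.

Lemma smoothB F G : smooth F -> smooth G -> smooth (fun p => F p - G p).
Proof. by move=> sF sG; apply: smoothD => //; exact: smoothN. Qed.

Definition crd1 (p : E) : R := p.1.1.
Definition crd2 (p : E) : R := p.1.2.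
Definition crd3 (p : E) : R := p.2.

Lemma crd1_linear : linear crd1. Proof. by []. Qed.
Lemma crd2_linear : linear crd2. Proof. by []. Qed.
Lemma crd3_linear : linear crd3. Proof. by []. Qed.

HB.instance Definition _ := GRing.isLinear.Build R E R _ crd1 crd1_linear.
HB.instance Definition _ := GRing.isLinear.Build R E R _ crd2 crd2_linear.
HB.instance Definition _ := GRing.isLinear.Build R E R _ crd3 crd3_linear.

Lemma continuous_crd1 : continuous crd1.
Proof. by move=> p; apply: (@cvg_comp _ _ _ fst fst); apply: cvg_fst. Qed.
Lemma continuous_crd2 : continuous crd2.
Proof. by move=> p; apply: (@cvg_comp _ _ _ fst snd); [apply: cvg_fst|apply: cvg_snd]. Qed.
Lemma continuous_crd3 : continuous crd3.
Proof. by move=> p; apply: cvg_snd. Qed.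

Lemma derive_linear (L : {linear E -> R}) v p : continuous L -> 'D_v L p = L v.
Proof. by move=> cL; rewrite deriveE ?diff_lin//; exact: linear_differentiable. Qed.

Lemma smooth_linear (L : {linear E -> R}) : continuous L -> smooth L.
Proof.
move=> cL; have dL : forall p, differentiable L p.
  by move=> p; apply: linear_differentiable.
apply/smoothP => -[|n]; first by split.
split=> // v.
have -> : (fun q => 'D_v L q) = fun=> L v.
  by apply/funext => q; exact: derive_linear.
by move/smoothP: (smooth_cst (L v)).
Qed.

Lemma smooth_crd1 : smooth crd1.
Proof. by apply: smooth_linear; exact: continuous_crd1. Qed.
Lemma smooth_crd2 : smooth crd2.
Proof. by apply: smooth_linear; exact: continuous_crd2. Qed.
Lemma smooth_crd3 : smooth crd3.
Proof. by apply: smooth_linear; exact: continuous_crd3. Qed.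

Lemma derive_crd1 v p : 'D_v crd1 p = v.1.1.
Proof. exact: derive_linear continuous_crd1. Qed.
Lemma derive_crd2 v p : 'D_v crd2 p = v.1.2.
Proof. exact: derive_linear continuous_crd2. Qed.
Lemma derive_crd3 v p : 'D_v crd3 p = v.2.
Proof. exact: derive_linear continuous_crd3. Qed.

Lemma diff_comp_crd3 (r : R -> R) p : derivable r p.2 1 ->
  differentiable (r \o crd3) p /\
  forall v, 'D_v (r \o crd3) p = v.2 * derive1 r p.2.
Proof.
move=> dr.
have d3 : differentiable crd3 p.
  by apply: linear_differentiable; exact: continuous_crd3.
have drp : differentiable r (crd3 p) by apply/derivable1_diffP.
have dc : differentiable (r \o crd3) p by apply: differentiable_comp.
split=> // v; rewrite deriveE// diff_comp// /= diff_lin; last exact: continuous_crd3.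
by rewrite deriv1E.
Qed.

Lemma smooth_comp_crd3 (r : R -> R) : real_analytic r ->
  smooth (fun p : E => r p.2).
Proof.
move=> rA; apply/smoothP => n; elim: n r rA => [|n IH] r rA.
  split=> // p; have [dr _] := real_analytic_derive rA.
  by have [] := @diff_comp_crd3 r p (dr _).
have [dr rA'] := real_analytic_derive rA; split=> [p|v].
  by have [] := @diff_comp_crd3 r p (dr _).
have -> : (fun q : E => 'D_v (fun p => r p.2) q) = fun q => v.2 * derive1 r q.2.
  by apply/funext => q; have [_] := @diff_comp_crd3 r q (dr _).
apply: ndiffM; last exact: IH.
by move/smoothP: (smooth_cst v.2).
Qed.

Lemma is_derive_line F u p (s : R) : derivable F (p + s *: u) u ->
  is_derive s 1 (fun t : R => F (p + t *: u)) ('D_u F (p + s *: u)).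
Proof.
move=> dF.
have lineE : (fun h : R => h^-1 *: (((fun t : R => F (p + t *: u)) \o shift s)
      (h *: 1) - F (p + s *: u))) =
    (fun h => h^-1 *: ((F \o shift (p + s *: u)) (h *: u) - F (p + s *: u))).
  apply/funext => h /=; congr (_ *: (F _ - _)).
  by rewrite [h *: 1]mulr1 scalerDl addrCA.
by split; rewrite /derivable /derive lineE.
Qed.

(** The mean value theorem is applied to the first difference in the direction v, as a function
    along u, and then to the derivative along u as a function along v. *)
Lemma second_difference F u v p (h : R) : smooth F -> 0 < h ->
  exists x y : R, [/\ 0 < x < h, 0 < y < h &
    F (p + h *: u + h *: v) - F (p + h *: u) - F (p + h *: v) + F p =
    h ^+ 2 * 'D_v (fun q => 'D_u F q) (p + x *: u + y *: v)].
Proof.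
move=> sF h0.
pose g (s : R) := F (p + h *: v + s *: u) - F (p + s *: u).
pose dg (s : R) := 'D_u F (p + h *: v + s *: u) - 'D_u F (p + s *: u).
have gd (s : R) : is_derive s 1 g (dg s).
  by apply: is_deriveB; apply: is_derive_line; exact: smooth_derivable.
have gc : {within `[0, h], continuous g}.
  by apply: derivable_within_continuous => s _; have [] := gd s.
have [x xh gx] := MVT h0 (fun s _ => gd s) gc.
pose k (s : R) := 'D_u F (p + x *: u + s *: v).
have kd (s : R) : is_derive s 1 k ('D_v (fun q => 'D_u F q) (p + x *: u + s *: v)).
  by apply: (@is_derive_line (fun q => 'D_u F q)); apply: smooth_derivable; apply: smooth_derive.
have kc : {within `[0, h], continuous k}.
  by apply: derivable_within_continuous => s _; have [] := kd s.
have [y yh ky] := MVT h0 (fun s _ => kd s) kc.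
exists x, y; split; [by rewrite in_itv in xh|by rewrite in_itv in yh|].
move: gx ky; rewrite /g /dg /k !scale0r !addr0 subr0.
rewrite [p + h *: v + x *: u]addrAC => gx ky; rewrite ky in gx.
rewrite [p + h *: u + _]addrAC.
have -> a b c d : a - b - c + d = a - b - (c - d) :> R by ring.
by rewrite gx; ring.
Qed.

Lemma ler_dist_split (a b c d e : R) : b = d -> `|a - b| < e / 2 -> `|c - d| < e / 2 ->
  `|a - c| <= e.
Proof.
move=> -> /ltW h1 /ltW h2; rewrite -[X in X - _](subrK d) -addrA.
by apply: le_trans (ler_normD _ _) _; rewrite [e]splitr lerD// distrC.
Qed.

(** The second difference is symmetric in u and v, so the two mixed derivatives take a common value,
    each at its own intermediate point. Both points tend to p with h, and the mixed derivatives are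
    continuous. *)
Lemma derive_comm F u v p : smooth F ->
  'D_u (fun q => 'D_v F q) p = 'D_v (fun q => 'D_u F q) p.
Proof.
move=> sF; apply/eqP; rewrite -subr_eq0 -normr_le0; apply/ler_addgt0Pl => e e0.
rewrite addr0.
have cont w w' : {for p, continuous ('D_w (fun q => 'D_w' F q))}.
  apply: differentiable_continuous; apply: smooth_diff.
  by apply: smooth_derive; apply: smooth_derive.
have /cvgrPdist_lt/(_ (e / 2)) := cont u v.
rewrite divr_gt0// => /(_ isT) /nbhs_ballP [d1 /= d10 h1].
have /cvgrPdist_lt/(_ (e / 2)) := cont v u.
rewrite divr_gt0// => /(_ isT) /nbhs_ballP [d2 /= d20 h2].
set N := `|u| + `|v| + 1.
have N0 : 0 < N by rewrite ltr_wpDl// addr_ge0.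
(* The intermediate points lie within h (|u| + |v|) < h N of p, where both continuity estimates
   apply. *)
pose h := Num.min d1 d2 / N.
have h0 : 0 < h by rewrite divr_gt0// lt_min d10.
have near_p (w w' : E) (x y : R) : `|w| + `|w'| + 1 = N -> 0 < x < h -> 0 < y < h ->
    `|p - (p + x *: w + y *: w')| < Num.min d1 d2.
  move=> NE /andP[x0 xh] /andP[y0 yh].
  rewrite -addrA opprD addrA subrr sub0r normrN.
  apply: le_lt_trans (ler_normD _ _) _; rewrite !normrZ !gtr0_norm//.
  have -> : Num.min d1 d2 = h * N by rewrite /h divfK// gt_eqF.
  rewrite -NE !mulrDr mulr1.
  apply: (@le_lt_trans _ _ (h * `|w| + h * `|w'|)); last by rewrite ltrDl.
  by rewrite lerD// ler_wpM2r// ltW.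
have [x [y [xh yh E1]]] := second_difference v u p sF h0.
have [x' [y' [xh' yh' E2]]] := second_difference u v p sF h0.
set q := p + x *: v + y *: u in E1.
set q' := p + x' *: u + y' *: v in E2.
have E12 : 'D_u (fun q => 'D_v F q) q = 'D_v (fun q => 'D_u F q) q'.
  have h20 : h ^+ 2 != 0 by rewrite expf_neq0// gt_eqF.
  apply: (mulfI h20); apply: etrans (esym E1) (etrans _ E2).
  have swap (a b c d : R) : a - b - c + d = a - c - b + d by ring.
  apply: etrans (swap _ _ _ _) _; congr (F _ - _ - _ + _); exact: addrAC.
have b1 : `|'D_u (fun q => 'D_v F q) p - 'D_u (fun q => 'D_v F q) q| < e / 2.
  apply: h1; rewrite -ball_normE /=.
  by have := near_p v u x y (congr1 (+%R^~ 1) (addrC _ _)); rewrite lt_min => /(_ xh yh)/andP[].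
have b2 : `|'D_v (fun q => 'D_u F q) p - 'D_v (fun q => 'D_u F q) q'| < e / 2.
  apply: h2; rewrite -ball_normE /=.
  by have := near_p u v x' y' erefl; rewrite lt_min => /(_ xh' yh')/andP[].
exact: ler_dist_split E12 b1 b2.
Qed.

End SmoothFunctions.

Definition e1 (R : realType) : R * R * R := (1, 0, 0).
Definition e2 (R : realType) : R * R * R := (0, 1, 0).
Definition e3 (R : realType) : R * R * R := (0, 0, 1).
Arguments e1 {R}.
Arguments e2 {R}.
Arguments e3 {R}.

(** * Complex-valued smooth functions on the ambient space *)

Section ComplexSmooth.
Variable R : realType.
Local Notation E := (R * R * R)%type.
Local Notation C := R[i].
Implicit Types (F G H : E -> C) (u v p : E).

Definition csmooth F :=
  smooth (fun p => complex.Re (F p)) /\ smooth (fun p => complex.Im (F p)).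

Definition cderive v F p : C :=
  'D_v (fun q => complex.Re (F q)) p +i* 'D_v (fun q => complex.Im (F q)) p.

Lemma csmooth_real (F : E -> R) : smooth F -> csmooth (fun p => (F p)%:C).
Proof. by move=> sF; split=> //; exact: smooth_cst. Qed.

Lemma csmooth_cst (c : C) : csmooth (fun=> c).
Proof. by split; exact: smooth_cst. Qed.

Lemma csmooth_derive v F : csmooth F -> csmooth (cderive v F).
Proof. by case=> sF1 sF2; split; apply: smooth_derive. Qed.

Lemma csmoothD F G : csmooth F -> csmooth G -> csmooth (fun p => F p + G p).
Proof.
move=> [F1 F2] [G1 G2]; split.
  by under eq_fun do rewrite ReD; exact: smoothD.
have ImD : {morph @complex.Im R : x y / x + y} by case=> [a b] [c d].
by under eq_fun do rewrite ImD; exact: smoothD.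
Qed.

Lemma csmoothM F G : csmooth F -> csmooth G -> csmooth (fun p => F p * G p).
Proof.
move=> [F1 F2] [G1 G2]; split.
  rewrite (_ : (fun p => complex.Re _) = fun p => complex.Re (F p) * complex.Re (G p) -
    complex.Im (F p) * complex.Im (G p)); first by apply: smoothB; exact: smoothM.
  by apply/funext => p; case: (F p) => [a b]; case: (G p).
rewrite (_ : (fun p => complex.Im _) = fun p => complex.Re (F p) * complex.Im (G p) +
  complex.Im (F p) * complex.Re (G p)); first by apply: smoothD; exact: smoothM.
by apply/funext => p; case: (F p) => [a b]; case: (G p).
Qed.

Lemma csmoothN F : csmooth F -> csmooth (fun p => - F p).
Proof.
move=> sF; have -> : (fun p => - F p) = fun p => -1 * F p.
  by apply/funext => p; rewrite mulN1r.
by apply: csmoothM => //; exact: csmooth_cst.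
Qed.

Lemma csmoothB F G : csmooth F -> csmooth G -> csmooth (fun p => F p - G p).
Proof. by move=> sF sG; apply: csmoothD => //; exact: csmoothN. Qed.

Lemma cderive_real v (F : E -> R) p : cderive v (fun p => (F p)%:C) p = ('D_v F p)%:C.
Proof. by congr (_ +i* _); exact: derive_cst. Qed.

Lemma cderive_cst v (c : C) p : cderive v (fun=> c) p = 0.
Proof. by congr (_ +i* _); exact: derive_cst. Qed.

Lemma cderiveD v F G p : csmooth F -> csmooth G ->
  cderive v (fun p => F p + G p) p = cderive v F p + cderive v G p.
Proof.
move=> [F1 F2] [G1 G2]; rewrite /cderive.
have -> : (fun q => complex.Re (F q + G q)) =
    (fun q => complex.Re (F q)) \+ (fun q => complex.Re (G q)).
  by apply/funext => q /=; rewrite ReD.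
have -> : (fun q => complex.Im (F q + G q)) =
    (fun q => complex.Im (F q)) \+ (fun q => complex.Im (G q)).
  by apply/funext => q /=; case: (F q) => [a b]; case: (G q).
by rewrite !deriveD//; exact: smooth_derivable.
Qed.

Lemma cderiveM v F G p : csmooth F -> csmooth G ->
  cderive v (fun p => F p * G p) p = cderive v F p * G p + F p * cderive v G p.
Proof.
move=> [F1 F2] [G1 G2].
pose Fr q := complex.Re (F q); pose Fi q := complex.Im (F q).
pose Gr q := complex.Re (G q); pose Gi q := complex.Im (G q).
have dm (f g : E -> R) : smooth f -> smooth g ->
    'D_v (fun q => f q * g q) p = f p * 'D_v g p + g p * 'D_v f p.
  by move=> sf sg; apply: deriveM; exact: smooth_derivable.
have -> : F p = Fr p +i* Fi p by rewrite /Fr /Fi; case: (F p).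
have -> : G p = Gr p +i* Gi p by rewrite /Gr /Gi; case: (G p).
rewrite /cderive -/Fr -/Fi -/Gr -/Gi.
have -> : (fun q => complex.Re (F q * G q)) = fun q => Fr q * Gr q - Fi q * Gi q.
  by apply/funext => q; rewrite /Fr /Gr /Fi /Gi; case: (F q) => [a b]; case: (G q).
have -> : (fun q => complex.Im (F q * G q)) = fun q => Fr q * Gi q + Fi q * Gr q.
  by apply/funext => q; rewrite /Fr /Gr /Fi /Gi; case: (F q) => [a b]; case: (G q).
have -> : 'D_v (fun q => Fr q * Gr q - Fi q * Gi q) p =
    'D_v (fun q => Fr q * Gr q) p - 'D_v (fun q => Fi q * Gi q) p.
  by apply: deriveB; apply: smooth_derivable; exact: smoothM.
have -> : 'D_v (fun q => Fr q * Gi q + Fi q * Gr q) p =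
    'D_v (fun q => Fr q * Gi q) p + 'D_v (fun q => Fi q * Gr q) p.
  by apply: deriveD; apply: smooth_derivable; exact: smoothM.
by rewrite !dm//; apply: complex_ext => /=; ring.
Qed.

Lemma cderiveZ v (c : C) F p : csmooth F ->
  cderive v (fun p => c * F p) p = c * cderive v F p.
Proof.
move=> sF; rewrite (cderiveM v p (csmooth_cst c) sF) cderive_cst.
by rewrite mul0r add0r.
Qed.

Lemma cderiveN v F p : csmooth F -> cderive v (fun p => - F p) p = - cderive v F p.
Proof.
move=> sF; have -> : (fun p => - F p) = fun p => -1 * F p.
  by apply/funext => q; rewrite mulN1r.
by rewrite cderiveZ// mulN1r.
Qed.

Lemma cderiveB v F G p : csmooth F -> csmooth G ->
  cderive v (fun p => F p - G p) p = cderive v F p - cderive v G p.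
Proof. by move=> sF sG; rewrite cderiveD ?cderiveN//; exact: csmoothN. Qed.

Lemma cderive_comm u v F p : csmooth F ->
  cderive u (cderive v F) p = cderive v (cderive u F) p.
Proof.
move=> [/(derive_comm u v p) h1 /(derive_comm u v p) h2].
by apply: complex_ext; [exact: h1|exact: h2].
Qed.

Lemma cderive_basis F p (a b c : R) : csmooth F ->
  cderive (a, b, c) F p = a%:C * cderive e1 F p +
    b%:C * cderive e2 F p + c%:C * cderive e3 F p.
Proof.
have lin (f : E -> R) : smooth f -> 'D_(a, b, c) f p =
    a * 'D_e1 f p + b * 'D_e2 f p + c * 'D_e3 f p.
  move=> sf; rewrite !deriveE; try exact: smooth_diff.
  have -> : (a, b, c) = a *: e1 + b *: e2 + c *: e3 :> E.
    by rewrite /e1 /e2 /e3; congr (_, _, _); rewrite /= /GRing.scale /= ?mulr1 ?mulr0 ?addr0 ?add0r.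
  by rewrite !linearD !linearZ.
have comb (x1 x2 x3 y1 y2 y3 : R) :
    (a * x1 + b * x2 + c * x3) +i* (a * y1 + b * y2 + c * y3) =
    a%:C * (x1 +i* y1) + b%:C * (x2 +i* y2) + c%:C * (x3 +i* y3).
  by apply: complex_ext => /=; ring.
by move=> [F1 F2]; rewrite /cderive (lin _ F1) (lin _ F2); exact: comb.
Qed.

End ComplexSmooth.

(** * The ambient bracket and its Jacobi identity *)

Section Bracket.
Variables (R : realType) (r : R -> R).
Hypothesis rA : real_analytic r.
Local Notation E := (R * R * R)%type.
Local Notation C := R[i].
Implicit Types (F G H : E -> C) (u v p : E).

Let r1 := derive1 r.
Let r1A : real_analytic r1. Proof. by have [] := real_analytic_derive rA. Qed.
Let d1 F := cderive e1 F.
Let d2 F := cderive e2 F.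
Let d3 F := cderive e3 F.
Let kx p : C := (crd1 p)%:C.
Let ky p : C := (crd2 p)%:C.
Let kr p : C := (2^-1 * r1 p.2)%:C.

(** This is i times the scalar triple product of the gradients of Q, F and G, where Q = (x^2 + y^2 -
    r(z)) / 2 has the gradient (x, y, - r'(z) / 2). *)
Definition pbra F G p : C := 'i *
  (kx p * (cderive e2 F p * cderive e3 G p
           - cderive e3 F p * cderive e2 G p)
   - ky p * (cderive e1 F p * cderive e3 G p
             - cderive e3 F p * cderive e1 G p)
   - kr p * (cderive e1 F p * cderive e2 G p
             - cderive e2 F p * cderive e1 G p)).

(* [ring] would otherwise unfold the derivatives. *)
Ltac abstract_atoms p :=
  generalize (kx p) (ky p) (kr p); intros ? ? ?;
  repeat match goal with |- context [cderive ?v ?F ?q] =>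
    generalize (cderive v F q); intro end.

Let skx : csmooth kx. Proof. exact/csmooth_real/smooth_crd1. Qed.
Let sky : csmooth ky. Proof. exact/csmooth_real/smooth_crd2. Qed.
Let skr : csmooth kr.
Proof.
apply: csmooth_real; apply: smoothM; first exact: smooth_cst.
exact: smooth_comp_crd3.
Qed.

Let dkx v p : cderive v kx p = v.1.1%:C.
Proof. by rewrite cderive_real derive_crd1. Qed.
Let dky v p : cderive v ky p = v.1.2%:C.
Proof. by rewrite cderive_real derive_crd2. Qed.
Let dkr v p : cderive v kr p = (v.2 * (2^-1 * derive1 r1 p.2))%:C.
Proof.
rewrite cderive_real.
have [dr1 _] := real_analytic_derive r1A.
have [dd dE] := @diff_comp_crd3 R r1 p (dr1 _).
have -> : 'D_v (fun p => 2^-1 * r1 p.2) p = 2^-1 * 'D_v (r1 \o @crd3 R) p.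
  by apply: (@deriveZ _ _ _ (r1 \o @crd3 R)); apply: diff_derivable.
by rewrite dE mulrCA.
Qed.

Lemma csmooth_pbra F G : csmooth F -> csmooth G -> csmooth (pbra F G).
Proof.
move=> sF sG; apply: csmoothM; first exact: csmooth_cst.
by do !(apply: csmoothB || apply: csmoothM || exact: csmooth_derive ||
  exact: skx || exact: sky || exact: skr).
Qed.

Lemma pbraC F G p : pbra F G p = - pbra G F p.
Proof. by rewrite /pbra; abstract_atoms p; ring. Qed.

Lemma pbraDl (c : C) F G H p : csmooth F -> csmooth G ->
  pbra (fun p => c * F p + G p) H p = c * pbra F H p + pbra G H p.
Proof.
move=> sF sG; have scF : csmooth (fun p => c * F p).
  by apply: csmoothM => //; exact: csmooth_cst.
by rewrite /pbra !cderiveD// !cderiveZ//; abstract_atoms p; clear; ring.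
Qed.

Lemma pbraMr F G H p : csmooth G -> csmooth H ->
  pbra F (fun p => G p * H p) p = pbra F G p * H p + G p * pbra F H p.
Proof.
move=> sG sH; rewrite /pbra !cderiveM//; abstract_atoms p.
by move: (G p) (H p) => g h; ring.
Qed.

(** The terms with second derivatives of F, G, H cancel by symmetry of these derivatives. The
    remaining ones cancel because the coefficients form a gradient, so that their matrix of
    derivatives is symmetric, here diagonal. *)
Lemma pbra_jacobi F G H p : csmooth F -> csmooth G -> csmooth H ->
  pbra F (pbra G H) p + pbra G (pbra H F) p + pbra H (pbra F G) p = 0.
Proof.
move=> sF sG sH.
have minor_smooth u v G1 H1 : csmooth G1 -> csmooth H1 ->
    csmooth (fun p => cderive u G1 p * cderive v H1 p - cderive v G1 p * cderive u H1 p).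
  by move=> s1 s2; apply: csmoothB; apply: csmoothM; exact: csmooth_derive.
have dminor w u v G1 H1 : csmooth G1 -> csmooth H1 ->
    cderive w (fun p => cderive u G1 p * cderive v H1 p - cderive v G1 p * cderive u H1 p) p
    = cderive w (cderive u G1) p * cderive v H1 p +
      cderive u G1 p * cderive w (cderive v H1) p -
      (cderive w (cderive v G1) p * cderive u H1 p +
      cderive v G1 p * cderive w (cderive u H1) p).
  move=> s1 s2.
  have sm u' v' : csmooth (fun q => cderive u' G1 q * cderive v' H1 q).
    by apply: csmoothM; exact: csmooth_derive.
  rewrite (cderiveB w p (sm u v) (sm v u)).
  by congr (_ - _); apply: (@cderiveM R w); exact: csmooth_derive.
(* The derivatives c1, c2, c3 of the coefficients are parameters because along the basis vectors
   they become 0, 1 or [m]. *)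
have dpbra w G1 H1 (c1 c2 c3 : C) : w.1.1%:C = c1 -> w.1.2%:C = c2 ->
    (w.2 * (2^-1 * derive1 r1 p.2))%:C = c3 -> csmooth G1 -> csmooth H1 ->
  cderive w (pbra G1 H1) p = 'i *
   (c1 * (d2 G1 p * d3 H1 p - d3 G1 p * d2 H1 p) +
    kx p * (cderive w (d2 G1) p * d3 H1 p + d2 G1 p * cderive w (d3 H1) p
      - (cderive w (d3 G1) p * d2 H1 p + d3 G1 p * cderive w (d2 H1) p))
   - (c2 * (d1 G1 p * d3 H1 p - d3 G1 p * d1 H1 p) +
    ky p * (cderive w (d1 G1) p * d3 H1 p + d1 G1 p * cderive w (d3 H1) p
      - (cderive w (d3 G1) p * d1 H1 p + d3 G1 p * cderive w (d1 H1) p)))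
   - (c3 * (d1 G1 p * d2 H1 p - d2 G1 p * d1 H1 p) +
    kr p * (cderive w (d1 G1) p * d2 H1 p + d1 G1 p * cderive w (d2 H1) p
      - (cderive w (d2 G1) p * d1 H1 p + d2 G1 p * cderive w (d1 H1) p)))).
  move=> <- <- <- s1 s2; have sm u v := minor_smooth u v _ _ s1 s2.
  have smk k u v : csmooth k -> csmooth (fun q => k q * (cderive u G1 q * cderive v H1 q - cderive v G1 q * cderive u H1 q)).
    by move=> sk; apply: csmoothM.
  rewrite /pbra cderiveZ; last first.
    by apply: csmoothB; [apply: csmoothB|]; apply: smk.
  rewrite cderiveB; [|by apply: csmoothB; apply: smk|exact: smk].
  rewrite cderiveB; [|exact: smk|exact: smk].
  have dk k u v : csmooth k -> cderive w (fun q => k q * (cderive u G1 q * cderive v H1 q -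
        cderive v G1 q * cderive u H1 q)) p =
      cderive w k p * (cderive u G1 p * cderive v H1 p - cderive v G1 p * cderive u H1 p) +
      k p * (cderive w (cderive u G1) p * cderive v H1 p +
        cderive u G1 p * cderive w (cderive v H1) p -
        (cderive w (cderive v G1) p * cderive u H1 p +
        cderive v G1 p * cderive w (cderive u H1) p)).
    by move=> sk; rewrite -(dminor w u v G1 H1 s1 s2); exact: (cderiveM w p sk (sm u v)).
  have hx := dk kx e2 e3 skx; rewrite dkx in hx.
  have hy := dk ky e1 e3 sky; rewrite dky in hy.
  have hr := dk kr e1 e2 skr; rewrite dkr in hr.
  by congr (_ * (_ - _ - _)); [exact: hx|exact: hy|exact: hr].
pose m : C := (2^-1 * derive1 r1 p.2)%:C.
have m1 : (1 * (2^-1 * derive1 r1 p.2))%:C = m by rewrite mul1r.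
have m0 : (0 * (2^-1 * derive1 r1 p.2))%:C = 0 by rewrite mul0r.
have dE G1 H1 (s1 : csmooth G1) (s2 : csmooth H1) :=
  (dpbra e1 G1 H1 1 0 0 erefl erefl m0 s1 s2,
   dpbra e2 G1 H1 0 1 0 erefl erefl m0 s1 s2,
   dpbra e3 G1 H1 0 0 m erefl erefl m1 s1 s2).
have dGH := dE _ _ sG sH; have dHF := dE _ _ sH sF; have dFG := dE _ _ sF sG.
move: (pbra G H) (pbra H F) (pbra F G) dGH dHF dFG => GH HF FG dGH dHF dFG.
rewrite /pbra !dGH !dHF !dFG {dGH dHF dFG dE}.
rewrite /d1 /d2 /d3 /=.
have comm F1 : csmooth F1 -> forall u v, cderive u (cderive v F1) p = cderive v (cderive u F1) p.
  by move=> s1 u v; exact: cderive_comm.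
move: (comm _ sF) (comm _ sG) (comm _ sH).
generalize (@e1 R) (@e2 R) (@e3 R)
  (@cderive R) (kx p) (ky p) (kr p) m.
move=> b1 b2 b3 D x y k m' cF cG cH.
(* Every mixed derivative is brought to one order of its directions; what is left is a polynomial
   identity in independent quantities. *)
rewrite (cF b2 b1) (cF b3 b1) (cF b3 b2) (cG b2 b1) (cG b3 b1) (cG b3 b2).
rewrite (cH b2 b1) (cH b3 b1) (cH b3 b2).
generalize (D b1 F p) (D b2 F p) (D b3 F p) (D b1 G p) (D b2 G p) (D b3 G p)
  (D b1 H p) (D b2 H p) (D b3 H p).
generalize (D b1 (D b1 F) p) (D b1 (D b2 F) p) (D b1 (D b3 F) p)
  (D b2 (D b2 F) p) (D b2 (D b3 F) p) (D b3 (D b3 F) p).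
generalize (D b1 (D b1 G) p) (D b1 (D b2 G) p) (D b1 (D b3 G) p)
  (D b2 (D b2 G) p) (D b2 (D b3 G) p) (D b3 (D b3 G) p).
generalize (D b1 (D b1 H) p) (D b1 (D b2 H) p) (D b1 (D b3 H) p)
  (D b2 (D b2 H) p) (D b2 (D b3 H) p) (D b3 (D b3 H) p).
clear; intros; ring.
Qed.

End Bracket.

(** * The coordinates (phi, z) *)

Section Chart.
Variable R : realType.
Local Notation E := (R * R * R)%type.
Local Notation C := R[i].

Lemma is_derive_curve (G : E -> R) (a b c : R -> R) (t a' b' c' : R) :
  differentiable G (a t, b t, c t) ->
  is_derive t 1 a a' -> is_derive t 1 b b' -> is_derive t 1 c c' ->
  is_derive t 1 (fun s => G (a s, b s, c s)) ('D_(a', b', c') G (a t, b t, c t)).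
Proof.
move=> dG [da ea] [db eb] [dc ec].
have da1 : differentiable a t.
 apply/derivable1_diffP. exact: da.
have db1 : differentiable b t.
 apply/derivable1_diffP. exact: db.
have dc1 : differentiable c t.
 apply/derivable1_diffP. exact: dc.
pose g s : E := (a s, b s, c s).
have dg : differentiable g t by do 2!apply: differentiable_pair => //.
have dGg : differentiable (G \o g) t by apply: differentiable_comp.
split; first by apply/derivable1_diffP.
rewrite (_ : (fun s => _) = G \o g)// deriveE// diff_comp//= [in RHS]deriveE//.
congr ('d _ _ _).
rewrite /g diff_pair//= ?diff_pair//=; last by apply: differentiable_pair.
by rewrite -ea -eb -ec !deriveE.
Qed.

Variable rho : R[i] -> R[i].
Hypothesis rA : real_analytic (rhoR rho).
Let r := rhoR rho.

Definition chart_pt (phi z : R) : E :=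
  (Num.sqrt (r z) * cos phi, Num.sqrt (r z) * sin phi, z).

Lemma chart_pt_Mrho phi z : 0 <= r z -> Mrho rho (chart_pt phi z).
Proof.
move=> r0; rewrite /Mrho /chart_pt /= !exprMn -mulrDr cos2Dsin2 mulr1.
by rewrite sqr_sqrtr.
Qed.

Lemma in_chartE (f : Mrho rho -> C) (F : E -> C) phi z :
  (forall p : Mrho rho, f p = F (val p)) -> 0 <= r z ->
  in_chart f phi z = F (chart_pt phi z).
Proof.
move=> fF r0; rewrite /in_chart -/(chart_pt phi z).
have h : chart_pt phi z \in Mrho rho by apply/mem_set/chart_pt_Mrho.
by rewrite insubT /= fF.
Qed.

End Chart.

Section ChartDerivative.
Variable R : realType.
Local Notation E := (R * R * R)%type.
Local Notation C := R[i].
Variable rho : R[i] -> R[i].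
Hypothesis rA : real_analytic (rhoR rho).
Let r := rhoR rho.

Lemma chart_d_phi (f : Mrho rho -> C) (F : E -> C) phi z : csmooth F ->
  (forall p : Mrho rho, f p = F (val p)) -> 0 < r z ->
  d_phi (in_chart f) phi z =
  cderive (- (Num.sqrt (r z) * sin phi), Num.sqrt (r z) * cos phi, 0) F
    (chart_pt rho phi z).
Proof.
move=> [F1 F2] fF r0; rewrite /d_phi.
have -> : (in_chart f)^~ z = fun t => F (chart_pt rho t z).
  by apply/funext => t; rewrite (in_chartE _ fF)// ltW.
have curve (G : E -> R) : smooth G -> derive1 (fun t => G (chart_pt rho t z)) phi =
    'D_(- (Num.sqrt (r z) * sin phi), Num.sqrt (r z) * cos phi, 0) G (chart_pt rho phi z).
  move=> sG; rewrite derive1E; apply: derive_val.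
  have ds : is_derive phi 1 (fun t : R => Num.sqrt (r z) * cos t)
      (- (Num.sqrt (r z) * sin phi)).
    rewrite -mulrN; exact: is_deriveZ.
  have dc : is_derive phi 1 (fun t : R => Num.sqrt (r z) * sin t)
      (Num.sqrt (r z) * cos phi).
    exact: is_deriveZ.
  apply: (@is_derive_curve _ G (fun t => Num.sqrt (r z) * cos t)
    (fun t => Num.sqrt (r z) * sin t) (fun=> z)) => //.
  exact: smooth_diff.
by rewrite /derive1C (curve _ F1) (curve _ F2).
Qed.

Lemma rhoR_gt0_near z : 0 < r z -> \forall s \near z, 0 < r s.
Proof.
move=> r0; have [dr _] := real_analytic_derive rA.
have cr : {for z, continuous r}.
  by apply: differentiable_continuous; apply/derivable1_diffP; exact: dr.
exact: (cvgr_gt _ cr).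
Qed.

Lemma chart_d_z (f : Mrho rho -> C) (F : E -> C) phi z : csmooth F ->
  (forall p : Mrho rho, f p = F (val p)) -> 0 < r z ->
  d_z (in_chart f) phi z =
  cderive (derive1 r z / (2 * Num.sqrt (r z)) * cos phi,
    derive1 r z / (2 * Num.sqrt (r z)) * sin phi, 1) F (chart_pt rho phi z).
Proof.
move=> [F1 F2] fF r0; rewrite /d_z.
(* [in_chart] has its default value where r is negative, so the two functions of s are compared only
   near z, which is enough for the derivative. *)
have nearE (h : C -> R) : \forall s \near z,
    h (F (chart_pt rho phi s)) = h (in_chart f phi s).
  apply: filterS (rhoR_gt0_near r0) => s rs.
  by rewrite (in_chartE _ fF)// ltW.
have [dr _] := real_analytic_derive rA.
have dsq : is_derive z 1 (fun s => Num.sqrt (r s)) (derive1 r z / (2 * Num.sqrt (r z))).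
  rewrite mulrC; apply: (@is_derive1_comp _ Num.sqrt r).
    exact: is_derive1_sqrt.
  by rewrite derive1E; apply/derivableP.
have curve (G : E -> R) : smooth G -> is_derive z 1 (fun t => G (chart_pt rho phi t))
    ('D_(derive1 r z / (2 * Num.sqrt (r z)) * cos phi,
    derive1 r z / (2 * Num.sqrt (r z)) * sin phi, 1) G (chart_pt rho phi z)).
  move=> sG.
  have dsqM (k : R) : is_derive z 1 (fun s => Num.sqrt (r s) * k)
      (derive1 r z / (2 * Num.sqrt (r z)) * k).
    rewrite mulrC (_ : (fun s => _) = fun s => k * Num.sqrt (r s)).
      exact: is_deriveZ.
    by apply/funext => s; rewrite mulrC.
  apply: (@is_derive_curve _ G (fun t => Num.sqrt (r t) * cos phi)
    (fun t => Num.sqrt (r t) * sin phi) (fun t => t)) => //.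
  exact: smooth_diff.
have key (h : C -> R) : smooth (fun q => h (F q)) ->
    derive1 (fun s => h (in_chart f phi s)) z =
    'D_(derive1 r z / (2 * Num.sqrt (r z)) * cos phi,
    derive1 r z / (2 * Num.sqrt (r z)) * sin phi, 1) (fun q => h (F q)) (chart_pt rho phi z).
  move=> sh; rewrite derive1E; apply: derive_val.
  exact: near_eq_is_derive (nearE h) (curve _ sh).
by rewrite /derive1C (key _ F1) (key _ F2).
Qed.

(** The coordinate tangent vectors are u = (- y, x, 0) and v = (x', y', 1), and their cross product
    is (x, y, - (x x' + y y')), the gradient of Q. The antisymmetrized product of the derivatives
    along u and v is the scalar product of this vector with the cross product of the gradients of F
    and G. *)
Lemma pbra_chart (f g : Mrho rho -> C) (F G : E -> C) phi z :
  csmooth F -> csmooth G ->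
  (forall p : Mrho rho, f p = F (val p)) -> (forall p : Mrho rho, g p = G (val p)) ->
  0 < r z ->
  pbra r F G (chart_pt rho phi z) =
  'i * (d_phi (in_chart f) phi z * d_z (in_chart g) phi z -
        d_phi (in_chart g) phi z * d_z (in_chart f) phi z).
Proof.
move=> sF sG fF gG r0.
rewrite (chart_d_phi _ sF fF r0) (chart_d_phi _ sG gG r0).
rewrite (chart_d_z _ sF fF r0) (chart_d_z _ sG gG r0).
set x := Num.sqrt (r z) * cos phi; set y := Num.sqrt (r z) * sin phi.
set x' := derive1 r z / _ * cos phi; set y' := derive1 r z / _ * sin phi.
set p := chart_pt rho phi z.
have hF a b c := @cderive_basis _ F p a b c sF.
have hG a b c := @cderive_basis _ G p a b c sG.
rewrite (hF (- y) x 0) (hF x' y' 1) (hG (- y) x 0) (hG x' y' 1) /pbra.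
have -> : crd1 p = x by []. have -> : crd2 p = y by []. have -> : p.2 = z by [].
(* This is half the derivative of x^2 + y^2 = r(z) along a meridian. *)
rewrite (_ : 2^-1 * derive1 r z = x * x' + y * y'); last first.
  have s0 : Num.sqrt (r z) != 0 by rewrite gt_eqF// sqrtr_gt0.
  rewrite /x /x' /y /y'.
  rewrite [RHS](_ : _ = 2^-1 * derive1 r z * (cos phi ^+ 2 + sin phi ^+ 2)).
    by rewrite cos2Dsin2 mulr1.
  by field.
have -> : (x * x' + y * y')%:C = x%:C * x'%:C + y%:C * y'%:C by rewrite rmorphD !rmorphM.
have -> : (- y)%:C = - y%:C by rewrite rmorphN.
have -> : (0 : R)%:C = 0 by []. have -> : (1 : R)%:C = 1 by [].
move: (x%:C) (y%:C) (x'%:C) (y'%:C) (cderive e1 F _) (cderive e2 F _) (cderive e3 F _)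
 (cderive e1 G _) (cderive e2 G _) (cderive e3 G _) => a b c d.
clear; intros; ring.
Qed.

End ChartDerivative.

(** * Points of the surface in polar form, and approach to its poles *)

Section WellDefined.
Variable R : realType.
Local Notation E := (R * R * R)%type.
Local Notation C := R[i].
Variable rho : R[i] -> R[i].
Hypothesis rA : real_analytic (rhoR rho).
Let r := rhoR rho.

Lemma polar p : Mrho rho p -> 0 < r p.2 -> exists phi, p = chart_pt rho phi p.2.
Proof.
case: p => [[x y] z]; rewrite /Mrho /chart_pt /= -/r => xy r0.
set s := Num.sqrt (r z); have s0 : 0 < s by rewrite sqrtr_gt0.
have s2 : s ^+ 2 = r z by rewrite sqr_sqrtr// ltW.
pose c := x / s.
have c2 : c ^+ 2 + (y / s) ^+ 2 = 1.
  by rewrite !expr_div_n -mulrDl xy s2 divff// gt_eqF.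
have c11 : -1 <= c <= 1.
  rewrite -ler_norml -(@ler_pXn2r _ 2)// ?nnegrE// expr1n real_normK ?num_real//.
  by rewrite -c2 lerDl sqr_ge0.
have cosa : cos (acos c) = c by rewrite acosK// in_itv.
have sina : sin (acos c) = `|y / s|.
  by rewrite sin_acos// -c2 addrAC subrr add0r sqrtr_sqr.
have sc : s * c = x by rewrite mulrC divfK// gt_eqF.
have sy : s * (y / s) = y by rewrite mulrC divfK// gt_eqF.
have [y0|y0] := leP 0 (y / s).
  by exists (acos c); rewrite cosa sina ger0_norm// sc sy.
by exists (- acos c); rewrite cosN sinN cosa sina ltr0_norm// opprK sc sy.
Qed.

Lemma smooth_continuous (F : E -> R) : smooth F -> continuous F.
Proof. by move=> sF p; apply: differentiable_continuous; exact: smooth_diff. Qed.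

Lemma rhoR_continuous : continuous r.
Proof.
move=> z; have [dr _] := real_analytic_derive rA.
by apply: differentiable_continuous; apply/derivable1_diffP; exact: dr.
Qed.

(** At a simple zero r becomes positive on the side given by the sign of r'. Thus a pole with r' <>
    0 is a limit of points covered by the chart. *)
Lemma rhoR_gt0_near_zero z : r z = 0 -> derive1 r z != 0 ->
  forall d : R, 0 < d -> exists t, `|t| < d /\ 0 < r (z + t).
Proof.
move=> rz r'z d d0.
have [dr _] := real_analytic_derive rA.
have /cvgrPdist_lt := dr z : (fun h => h^-1 *: ((r \o shift z) (h *: 1) - r z)) @ 0^' --> 'D_1 r z.
rewrite -derive1E => /(_ `|derive1 r z|); rewrite normr_gt0 => /(_ r'z).
rewrite near_withinE => /nbhs_ballP [e /= e0 he].
pose t := Num.min d e / 2 * Num.sg (derive1 r z).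
have m0 : 0 < Num.min d e / 2 by rewrite divr_gt0// lt_min d0.
have nt : `|t| = Num.min d e / 2.
  by rewrite normrM normr_sg r'z mulr1 gtr0_norm.
have mlt : Num.min d e / 2 < Num.min d e.
  by rewrite ltr_pdivrMr// mulr2n mulrDr mulr1 ltrDl lt_min d0.
have [td te] : `|t| < d /\ `|t| < e.
  by rewrite nt; split; apply: lt_le_trans mlt _; rewrite ge_min lexx ?orbT.
exists t; split=> //.
have t0 : t != 0 by rewrite -normr_gt0 nt.
have := he t; rewrite /ball /= sub0r normrN => /(_ te t0).
rewrite [t *: 1]mulr1 rz subr0 [t + z]addrC.
set q := r (z + t).
rewrite /GRing.scale /= => h.
have : 0 < derive1 r z * (t^-1 * q).
  have [a0|a0|a0] := ltgtP (derive1 r z) 0; last by rewrite a0 eqxx in r'z.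
    rewrite nmulr_rgt0//; rewrite (ltr0_norm a0) in h.
    move: h; rewrite ltr_norml => /andP[]; lra.
  rewrite pmulr_rgt0//; rewrite (gtr0_norm a0) in h.
  move: h; rewrite ltr_norml => /andP[]; lra.
rewrite mulrA pmulr_rgt0// /t invfM invr_sg mulrCA [derive1 r z * _]mulrC -normrEsg.
by rewrite mulr_gt0 ?invr_gt0// normr_gt0.
Qed.

End WellDefined.

(** * The Poisson bracket on the surface *)

Section BracketOnSurface.
Variable R : realType.
Local Notation E := (R * R * R)%type.
Local Notation C := R[i].
Variable rho : R[i] -> R[i].
Hypothesis rA : real_analytic (rhoR rho).
Let r := rhoR rho.

Lemma chart_pt_continuous phi : continuous (chart_pt rho phi).
Proof.
move=> z; have sq : (fun s => Num.sqrt (r s)) @ z --> Num.sqrt (r z).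
  by apply: (@cvg_comp _ _ _ r Num.sqrt); [exact: rhoR_continuous|exact: sqrt_continuous].
have sqM k : (fun s => Num.sqrt (r s) * k) @ z --> Num.sqrt (r z) * k.
  by apply: cvgM => //; exact: cvg_cst.
have sq2 : (fun s => (Num.sqrt (r s) * cos phi, Num.sqrt (r s) * sin phi)) @ z -->
    (Num.sqrt (r z) * cos phi, Num.sqrt (r z) * sin phi).
  exact: (cvg_pair (sqM _) (sqM _)).
have idz : (fun s : R => s) @ z --> z by [].
exact: (cvg_pair sq2 idz).
Qed.

Lemma pbra_ext (F F' G G' : E -> C) :
  csmooth F -> csmooth F' -> csmooth G -> csmooth G' ->
  (forall p, Mrho rho p -> F p = F' p) -> (forall p, Mrho rho p -> G p = G' p) ->
  forall p, Mrho rho p -> pbra r F G p = pbra r F' G' p.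
Proof.
move=> sF sF' sG sG' FF GG.
have pos p : Mrho rho p -> 0 < r p.2 -> pbra r F G p = pbra r F' G' p.
  move=> Mp r0; have [phi ->] := polar Mp r0.
  pose f (q : Mrho rho) := F (val q); pose g (q : Mrho rho) := G (val q).
  have Mval (q : Mrho rho) : Mrho rho (val q) by apply: set_mem; exact: valP.
  have fF' q : f q = F' (val q) by exact: FF (Mval q).
  have gG' q : g q = G' (val q) by exact: GG (Mval q).
  rewrite (@pbra_chart _ rho rA f g F G _ _ sF sG (fun=> erefl) (fun=> erefl) r0).
  by rewrite (@pbra_chart _ rho rA f g F' G' _ _ sF' sG' fF' gG' r0).
move=> p Mp; have [r0|r0] := ltP 0 (r p.2); first exact: pos.
have [x0 y0 rz] : [/\ p.1.1 = 0, p.1.2 = 0 & r p.2 = 0].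
  have h : p.1.1 ^+ 2 + p.1.2 ^+ 2 = r p.2 by exact: Mp.
  have hx := sqr_ge0 p.1.1; have hy := sqr_ge0 p.1.2.
  have hx0 : p.1.1 ^+ 2 = 0 by lra. have hy0 : p.1.2 ^+ 2 = 0 by lra.
  split; last lra.
    by apply/eqP; rewrite -sqrf_eq0 hx0.
  by apply/eqP; rewrite -sqrf_eq0 hy0.
have [r'0|r'0] := eqVneq (derive1 r p.2) 0.
  have z3 (a b c : C) (i : C) : i * (0 * a - 0 * b - 0 * c) = 0 by ring.
  rewrite /pbra /crd1 /crd2 x0 y0 r'0 mulr0; have -> : (0 : R)%:C = 0 by [].
  by rewrite !z3.
pose D q := pbra r F G q - pbra r F' G' q.
have [D1 D2] : csmooth D by apply: csmoothB; exact: csmooth_pbra.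
(* At a pole the angle is arbitrary; 0 selects a meridian that ends at p. *)
have pE : p = chart_pt rho 0 p.2.
  by rewrite /chart_pt -/r rz sqrtr0 !mul0r; move: x0 y0; case: (p) => [[x y] z] /= -> ->.
(* If g were nonzero at p, it would be nonzero along the meridian near p, but that meridian contains
   points with r > 0 arbitrarily close to p, where the chart formula gives D = 0. *)
have vanish (g : E -> R) : smooth g -> (forall q, D q = 0 -> g q = 0) -> g p = 0.
  move=> sg gD; apply: contrapT => /eqP gp.
  have gc : (fun s => `|g (chart_pt rho 0 s)|) @ p.2 --> `|g p|.
    apply: cvg_norm; rewrite {2}pE.
    apply: (@cvg_comp _ _ _ (chart_pt rho 0) g); first exact: chart_pt_continuous.
    exact: smooth_continuous.
  have gp0 : 0 < `|g p| by rewrite normr_gt0.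
  have : \forall s \near p.2, 0 < `|g (chart_pt rho 0 s)| by exact: (cvgr_gt _ gc).
  move=> /nbhs_ballP [d /= d0 dg].
  have [t [td rt]] := rhoR_gt0_near_zero rA rz r'0 d0.
  have : 0 < `|g (chart_pt rho 0 (p.2 + t))|.
    by apply: dg; rewrite /ball /= opprD addrA subrr sub0r normrN.
  rewrite gD ?normr0 ?ltxx// /D pos ?subrr//.
  by apply: chart_pt_Mrho; exact: ltW.
have D0 : D p = 0.
  apply/eqP; rewrite eq_complex; apply/andP; split; apply/eqP.
    by apply: (vanish (fun q => complex.Re (D q))) => // q ->.
  by apply: (vanish (fun q => complex.Im (D q))) => // q ->.
by apply/eqP; rewrite -subr_eq0; apply/eqP; exact: D0.
Qed.

Definition extends (f : Mrho rho -> C) (F : E -> C) :=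
  csmooth F /\ forall p : Mrho rho, f p = F (val p).

Lemma smooth_on_MP f : smooth_on_M f <-> exists F, extends f F.
Proof.
split=> [[F [G [sF sG fE]]]|[F [[sF1 sF2] fE]]].
  by exists (fun p => F p +i* G p); split.
exists (fun p => complex.Re (F p)), (fun p => complex.Im (F p)).
by split=> // p; rewrite fE; case: (F _).
Qed.

(** The extensions are chosen, and by [pbra_ext] the choice does not matter; 0 is a placeholder for
    functions that have no smooth extension. *)
Definition bracket (f g : Mrho rho -> C) : Mrho rho -> C := fun p =>
  if pselect ((exists F, extends f F) /\ (exists G, extends g G)) is left e
  then pbra r (projT1 (cid e.1)) (projT1 (cid e.2)) (val p) else 0.

Lemma bracketE f g F G : extends f F -> extends g G ->
  bracket f g = fun p => pbra r F G (val p).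
Proof.
move=> fF gG; apply/funext => p; rewrite /bracket; case: pselect => [e|]; last first.
  by case; split; [exists F|exists G].
have Mp : Mrho rho (val p) by apply: set_mem; exact: valP.
have ext q (Mq : Mrho rho q) : exists p' : Mrho rho, val p' = q.
  by exists (exist _ q (mem_set Mq)).
have [sF fE] := fF; have [sG gE] := gG.
have [sF' fE'] := projT2 (cid e.1); have [sG' gE'] := projT2 (cid e.2).
by apply: pbra_ext => // q /ext [p' <-]; rewrite -?fE' -?gE'.
Qed.

Lemma extends_bracket f g F G : extends f F -> extends g G ->
  extends (bracket f g) (pbra r F G).
Proof.
move=> fF gG; split; last by move=> p; rewrite (bracketE fF gG).
by case: fF gG => sF _ [sG _]; exact: csmooth_pbra.
Qed.

Lemma extendsD f g F G : extends f F -> extends g G ->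
  extends (f + g) (fun p => F p + G p).
Proof.
move=> [sF fE] [sG gE]; split; first exact: csmoothD.
by move=> p; rewrite -fE -gE.
Qed.

Lemma extendsM f g F G : extends f F -> extends g G ->
  extends (f * g) (fun p => F p * G p).
Proof.
move=> [sF fE] [sG gE]; split; first exact: csmoothM.
by move=> p; rewrite -fE -gE.
Qed.

Lemma extendsZ (c : C) f F : extends f F -> extends (c *: f) (fun p => c * F p).
Proof.
move=> [sF fE]; split; first by apply: csmoothM => //; exact: csmooth_cst.
by move=> p; rewrite -fE.
Qed.

Lemma bracket_poisson : poisson_bracket bracket.
Proof.
split.
- move=> f g /smooth_on_MP [F fF] /smooth_on_MP [G gG].
  by apply/smooth_on_MP; exists (pbra r F G); exact: extends_bracket.
- move=> c f g h /smooth_on_MP [F fF] /smooth_on_MP [G gG] /smooth_on_MP [H hH].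
  rewrite (bracketE (extendsD (extendsZ c fF) gG) hH).
  rewrite (bracketE fF hH) (bracketE gG hH); apply/funext => p.
  by case: fF gG hH => sF _ [sG _] [sH _]; exact: pbraDl.
- move=> f g /smooth_on_MP [F fF] /smooth_on_MP [G gG].
  rewrite (bracketE fF gG) (bracketE gG fF); apply/funext => p.
  exact: pbraC.
- move=> f g h /smooth_on_MP [F fF] /smooth_on_MP [G gG] /smooth_on_MP [H hH].
  rewrite (bracketE fF (extendsM gG hH)) (bracketE fF gG) (bracketE fF hH).
  apply/funext => p; case: (gG) (hH) => sG gE [sH hE].
  have := @pbraMr R r F G H (val p) sG sH; rewrite -gE -hE; exact.
- move=> f g h /smooth_on_MP [F fF] /smooth_on_MP [G gG] /smooth_on_MP [H hH].
  rewrite (bracketE fF (extends_bracket gG hH)) (bracketE gG (extends_bracket hH fF)).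
  rewrite (bracketE hH (extends_bracket fF gG)); apply/funext => p.
  case: fF gG hH => sF _ [sG _] [sH _]; exact: (pbra_jacobi rA).
Qed.

Lemma bracket_chart (f g : Mrho rho -> C) phi z :
  smooth_on_M f -> smooth_on_M g -> 0 < r z ->
  in_chart (bracket f g) phi z =
  'i * (d_phi (in_chart f) phi z * d_z (in_chart g) phi z -
        d_phi (in_chart g) phi z * d_z (in_chart f) phi z).
Proof.
move=> /smooth_on_MP [F fF] /smooth_on_MP [G gG] r0.
have [_ bE] := extends_bracket fF gG.
rewrite (in_chartE phi bE (ltW r0)); case: fF gG => sF fE [sG gE].
exact: (@pbra_chart _ rho rA f g F G phi z sF sG fE gE r0).
Qed.

End BracketOnSurface.

(** * The quotient algebra *)

Section MonoidAlgebra.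
Import -(notations) finmap monalg.
Variables (M : monomType) (K : comNzRingType).
Implicit Types (p q : malg M K).

Lemma malg_scaleAr (c : K) p q : p * (c *: q) = c *: (p * q).
Proof.
apply/malgP => k; rewrite mcoeffZ (mcoeffMlw _ (fsubset_refl _) (msuppZ_le c q)).
rewrite mcoeffMl mulr_sumr; apply: eq_bigr => m _.
rewrite mulr_sumr; apply: eq_bigr => m' _.
by rewrite mcoeffZ mulrCA mulrnAr.
Qed.

Lemma mkmalgUZ (m : M) (c : K) : mkmalgU m c = c *: mkmalgU m 1.
Proof. by apply/malgP => k; rewrite mcoeffZ !mcoeffU mulrnAr mulr1. Qed.

End MonoidAlgebra.

Section WordEvaluation.
Import -(notations) finmap monalg.
Variables (T : choiceType) (K : comNzRingType) (v : T -> K).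

(** The value of a word under [nceval], under a name to which the structure of a monoid morphism can
    be attached. *)
Definition word_prod (m : fmonom T) : K := \prod_(x <- (m : seq T)) v x.

Lemma word_prod_mmorphism : mmorphism word_prod.
Proof.
split=> [x y|]; rewrite /word_prod /mul /one /=.
  by rewrite fmmulE big_cat.
by rewrite fmoneE big_nil.
Qed.

HB.instance Definition _ :=
  isMultiplicative.Build (fmonom T) K word_prod word_prod_mmorphism.

Lemma mmap_wordM (p q : malg (fmonom T) K) :
  mmap idfun word_prod (p * q) = mmap idfun word_prod p * mmap idfun word_prod q.
Proof. exact: (mmap_is_multiplicative (f := idfun) (h := word_prod)).1. Qed.

End WordEvaluation.

Section NoncommutativePolynomials.
Import -(notations) finmap monalg.
Variable R : realType.
Local Notation C := R[i].
Local Notation N := (ncpoly R).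
Local Notation msupp := (@monalg.msupp (monalg.fmonom gen) C).
Implicit Types (p q : N) (x : gen).

Definition ncword (s : seq gen) : N := \prod_(x <- s) ncvar R x.

Lemma mkmalgU_word (m : monalg.fmonom gen) (c : C) :
  monalg.mkmalgU m c = c *: ncword m :> N.
Proof.
have w1 : monalg.mkmalgU m 1 = ncword m :> N.
  rewrite /ncword; case: m => s /=.
  elim: s => [|x s IH]; first by rewrite big_nil -monalg.fmoneE.
  rewrite big_cons -IH /ncvar [RHS]monalg.malgM_def monalg.fgmulUU mulr1.
  by congr (monalg.mkmalgU _ _); rewrite /monalg.mul /= monalg.fmmulE monalg.fmuE.
rewrite -w1; exact: mkmalgUZ.
Qed.

Lemma ncpolyE p : p = \sum_(m <- msupp p) monalg.mcoeff m p *: ncword m.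
Proof.
rewrite {1}[p]monalg.monalgE; apply: eq_bigr => m _; exact: mkmalgU_word.
Qed.

Lemma ncscaleAr (c : C) p q : p * (c *: q) = c *: (p * q).
Proof. exact: malg_scaleAr. Qed.

Lemma ncpoly_ind (P : N -> Prop) :
  P 0 -> (forall p q, P p -> P q -> P (p + q)) -> (forall c p, P p -> P (c *: p)) ->
  P 1 -> (forall x p, P p -> P (ncvar R x * p)) -> forall p, P p.
Proof.
move=> P0 PD PZ P1 PM p; rewrite [p]ncpolyE.
apply: big_ind => // m _; apply: PZ; rewrite /ncword.
by elim: (m : seq gen) => [|x s IH]; rewrite ?big_nil// big_cons; apply: PM.
Qed.

Lemma x0poly_ind (P : N -> Prop) :
  P 0 -> (forall p q, P p -> P q -> P (p + q)) -> (forall c p, P p -> P (c *: p)) ->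
  P 1 -> (forall p, P p -> P (ncvar R X0 * p)) ->
  (forall r p, P p -> P (ncvar R (Rho r) * p)) -> forall p, x0poly p -> P p.
Proof.
move=> P0 PD PZ P1 PX PR p xp; rewrite [p]ncpolyE big_seq.
apply: big_ind => // m; rewrite -monalg.mcoeff_neq0 => /xp [mp mm].
apply: PZ; rewrite /ncword; move: mp mm.
elim: (m : seq gen) => [|x s IH]; rewrite ?big_nil// big_cons !inE !negb_or.
move=> /andP[hp sp] /andP[hm sm]; have Ps := IH sp sm.
by case: x hp hm => [_ _|/eqP//|_ /eqP//|r _ _]; [apply: PX|apply: PR].
Qed.

Lemma x0polyD p q : x0poly p -> x0poly q -> x0poly (p + q).
Proof.
move=> xp xq m; rewrite monalg.mcoeffD => h.
have [p0|/xp//] := eqVneq (monalg.mcoeff m p) 0.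
by apply: xq; rewrite p0 add0r in h.
Qed.

Lemma x0polyZ c p : x0poly p -> x0poly (c *: p).
Proof.
move=> xp m; rewrite monalg.mcoeffZ => h; apply: xp.
by apply: contra h => /eqP ->; rewrite mulr0.
Qed.

Lemma x0poly0 : x0poly (0 : N).
Proof. by move=> m; rewrite monalg.mcoeff0 eqxx. Qed.

Lemma x0polyM p q : x0poly p -> x0poly q -> x0poly (p * q).
Proof.
move=> xp xq m; rewrite monalg.mcoeff_neq0 => /monalg.msuppM_le [m1 [m2 [h1 h2 ->]]].
rewrite -monalg.mcoeff_neq0 in h1; rewrite -monalg.mcoeff_neq0 in h2.
have [a1 b1] := xp _ h1; have [a2 b2] := xq _ h2.
by rewrite /monalg.mul /= monalg.fmmulE /= !mem_cat !negb_or a1 a2 b1 b2.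
Qed.

Lemma x0poly1 : x0poly (1 : N).
Proof.
move=> m; rewrite monalg.mcoeff1.
have [->|mn] := eqVneq m (monalg.one : fmonom gen); last by rewrite ?(negPf mn) eqxx.
by rewrite /monalg.one /= monalg.fmoneE.
Qed.

Lemma x0poly_var x : x \notin [:: Xp; Xm] -> x0poly (ncvar R x).
Proof.
rewrite !inE negb_or => /andP[xp xm] m; rewrite /ncvar monalg.mcoeffU.
have [<-|mn] := eqVneq (monalg.fmu x) m; last by rewrite ?(negPf mn) eqxx.
by rewrite monalg.fmuE /= !inE ![_ == x]eq_sym.
Qed.

(** Linear extension of an arbitrary function of words. Evaluation at numbers and the action on
    functions are both of this form, so linearity and the rule for prefixing a letter are proved
    once for both. *)
Definition ncext (h : seq gen -> C) p : C :=
  monalg.mmap idfun (fun m : monalg.fmonom gen => h m) p.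

Lemma ncextE h p : ncext h p = \sum_(m <- msupp p) monalg.mcoeff m p * h m.
Proof. by []. Qed.

Lemma ncextD h p q : ncext h (p + q) = ncext h p + ncext h q.
Proof. exact: monalg.mmapD. Qed.

Lemma ncext0 h : ncext h 0 = 0.
Proof. exact: monalg.mmap0. Qed.

Lemma ncextU h m c : ncext h (monalg.mkmalgU m c) = c * h m.
Proof. exact: monalg.mmapU. Qed.

Lemma ncextZ h c p : ncext h (c *: p) = c * ncext h p.
Proof.
rewrite [in LHS](ncpolyE p) scaler_sumr [in RHS]ncextE.
rewrite (big_morph (ncext h) (ncextD h) (ncext0 h)) mulr_sumr.
by apply: eq_bigr => m _; rewrite scalerA -mkmalgU_word ncextU mulrA.
Qed.

Lemma ncext_var h x p : ncext h (ncvar R x * p) = ncext (fun s => h (x :: s)) p.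
Proof.
rewrite [in LHS](ncpolyE p) mulr_sumr [in RHS]ncextE.
rewrite (big_morph (ncext h) (ncextD h) (ncext0 h)).
apply: eq_bigr => m _; rewrite ncscaleAr ncextZ; congr (_ * _).
have -> : ncvar R x * ncword m = ncword (x :: m) by rewrite /ncword big_cons.
have -> : ncword (x :: m) = monalg.mkmalgU (monalg.FMonom (x :: m)) 1.
  by rewrite mkmalgU_word scale1r.
by rewrite ncextU mul1r.
Qed.

Lemma ncext1 h : ncext h 1 = h [::].
Proof.
have -> : 1 = monalg.mkmalgU (monalg.FMonom [::]) 1 :> N.
  by rewrite mkmalgU_word scale1r /ncword big_nil.
by rewrite ncextU mul1r.
Qed.

Section Evaluation.
Variable v : gen -> C.

Lemma ncevalE p : nceval v p = ncext (fun s => \prod_(x <- s) v x) p.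
Proof. by []. Qed.

Lemma ncevalD p q : nceval v (p + q) = nceval v p + nceval v q.
Proof. by rewrite !ncevalE ncextD. Qed.

Lemma nceval0 : nceval v 0 = 0.
Proof. by rewrite !ncevalE ncext0. Qed.

Lemma ncevalZ c p : nceval v (c *: p) = c * nceval v p.
Proof. by rewrite !ncevalE ncextZ. Qed.

Lemma nceval1 : nceval v 1 = 1.
Proof. by rewrite ncevalE ncext1 big_nil. Qed.

Lemma nceval_varM x p : nceval v (ncvar R x * p) = v x * nceval v p.
Proof.
rewrite !ncevalE ncext_var !ncextE mulr_sumr; apply: eq_bigr => m _.
by rewrite big_cons mulrCA.
Qed.

Lemma nceval_var x : nceval v (ncvar R x) = v x.
Proof. by rewrite -[ncvar R x]mulr1 nceval_varM nceval1 mulr1. Qed.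

Lemma ncevalM p q : nceval v (p * q) = nceval v p * nceval v q.
Proof.
exact: (@mmap_wordM gen C v p q).
Qed.

Lemma ncevalN p : nceval v (- p) = - nceval v p.
Proof. by rewrite -scaleN1r ncevalZ mulN1r. Qed.

Lemma ncevalB p q : nceval v (p - q) = nceval v p - nceval v q.
Proof. by rewrite ncevalD ncevalN. Qed.

End Evaluation.

End NoncommutativePolynomials.

Section RingLemmas.
Variable A : pzRingType.
Implicit Types a b c d t u y : A.

Lemma subr_add0_eq a b c : a - b + c = 0 -> a = b - c.
Proof. by move=> /eqP; rewrite addr_eq0 subr_eq addrC => /eqP. Qed.

Lemma subr_sub0_eq a b c : a - b - c = 0 -> a = b + c.
Proof. by move=> /eqP; rewrite subr_eq0 subr_eq addrC => /eqP. Qed.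

End RingLemmas.

Section ShiftAbstract.
Variables (K N A : pzRingType) (scN : K -> N -> N) (scA : K -> A -> A) (cl : N -> A).
Hypothesis clD : {morph cl : p q / p + q}.
Hypothesis clM : {morph cl : p q / p * q}.
Hypothesis cl1 : cl 1 = 1.
Hypothesis clZ : forall a p, cl (scN a p) = scA a (cl p).
Hypothesis scAl : forall a u v, scA a u * v = scA a (u * v).
Hypothesis scAr : forall a u v, u * scA a v = scA a (u * v).
Variables (x0 : N -> Prop) (xf : N -> K -> K).
Hypothesis x0D : forall p q, x0 p -> x0 q -> x0 (p + q).
Hypothesis x0M : forall p q, x0 p -> x0 q -> x0 (p * q).
Hypothesis x0Z : forall a p, x0 p -> x0 (scN a p).
Hypothesis xfD : forall p q w, xf (p + q) w = xf p w + xf q w.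
Hypothesis xfM : forall p q w, xf (p * q) w = xf p w * xf q w.
Hypothesis xfZ : forall a p w, xf (scN a p) w = a * xf p w.
Variables (y : A) (s : K -> K).

(** The element p moves from the left to the right of y when its argument is transformed by s. The
    property is stable under sums, scalings and products, so it has to be checked only for
    generators. *)
Definition shiftable p := exists p', [/\ x0 p', cl p * y = y * cl p' &
  forall w, xf p' w = xf p (s w)].

Lemma shiftableD p q : shiftable p -> shiftable q -> shiftable (p + q).
Proof.
move=> [p' [xp pp pv]] [q' [xq qq qv]]; exists (p' + q'); split; first exact: x0D.
  by rewrite !clD mulrDl mulrDr pp qq.
by move=> w; rewrite !xfD pv qv.
Qed.

Lemma shiftableZ a p : shiftable p -> shiftable (scN a p).
Proof.
move=> [p' [xp pp pv]]; exists (scN a p'); split; first exact: x0Z.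
  by rewrite !clZ scAl scAr pp.
by move=> w; rewrite !xfZ pv.
Qed.

Lemma shiftableM p q : shiftable p -> shiftable q -> shiftable (p * q).
Proof.
move=> [p' [xp pp pv]] [q' [xq qq qv]]; exists (p' * q'); split; first exact: x0M.
  by rewrite !clM -mulrA qq !mulrA pp.
by move=> w; rewrite !xfM pv qv.
Qed.

Lemma shiftable_cst p : x0 p -> cl p * y = y * cl p -> (forall w, xf p (s w) = xf p w) ->
  shiftable p.
Proof. by move=> xp pp pv; exists p; split. Qed.

End ShiftAbstract.

(** * Consequences of the defining relations *)

Section Relations.
Variables (R : realType) (rho : R[i] -> R[i]).
Local Notation C := R[i].
Local Notation N := (ncpoly R).
Local Notation cls := (cls rho).
Local Notation x0fun := (x0fun rho).
Implicit Types (p q c : N) (eps w : C).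

Lemma cls_mul eps p q : cls eps (p * q) = cls eps p * cls eps q.
Proof. exact: clsM. Qed.

Lemma cls_scale eps (a : C) p : cls eps (a *: p) = a *: cls eps p.
Proof. exact: clsZ. Qed.

Lemma cls0 eps : cls eps 0 = 0.
Proof. by rewrite -(subrr (0 : N)) clsB subrr. Qed.

Lemma cls_sum eps (I : Type) (s : seq I) (P : pred I) (F : I -> N) :
  cls eps (\sum_(i <- s | P i) F i) = \sum_(i <- s | P i) cls eps (F i).
Proof. exact: (big_morph (cls eps) (clsD rho eps) (cls0 eps)). Qed.

Lemma cls_eq0 eps p : relideal rho eps p -> cls eps p = 0.
Proof.
by move=> h; rewrite -(cls0 eps); apply/cls_eqP; rewrite subr0; apply/relidealP.
Qed.

Lemma cls_rel eps p : relator rho eps p -> cls eps p = 0.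
Proof. by move=> h; apply: cls_eq0 => I [_]; apply. Qed.

Lemma alg_scaleAl eps (a : C) (u v : alg rho eps) : (a *: u) * v = a *: (u * v).
Proof.
rewrite -[u]cls_repr -[v]cls_repr; move: (repr u) (repr v) => p q.
have h : (a *: p) * q = a *: (p * q) :> N by exact: (esym (scalerAl a p q)).
exact: (etrans (congr1 (fun t => t * cls eps q) (esym (cls_scale eps a p)))
  (etrans (esym (cls_mul eps (a *: p) q)) (etrans (congr1 (cls eps) h)
  (etrans (cls_scale eps a (p * q)) (congr1 (GRing.scale a) (cls_mul eps p q)))))).
Qed.

Lemma alg_scaleAr eps (a : C) (u v : alg rho eps) : u * (a *: v) = a *: (u * v).
Proof.
rewrite -[u]cls_repr -[v]cls_repr; move: (repr u) (repr v) => p q.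
exact: (etrans (congr1 (fun t => cls eps p * t) (esym (cls_scale eps a q)))
  (etrans (esym (cls_mul eps p (a *: q))) (etrans (congr1 (cls eps) (ncscaleAr a p q))
  (etrans (cls_scale eps a (p * q)) (congr1 (GRing.scale a) (cls_mul eps p q)))))).
Qed.

(** By the relations [rel_fun], an element free of X_+ and X_- is determined by its function of X_0;
    coefficients may therefore be treated as functions. *)
Lemma cls_x0fun eps p q : x0poly p -> x0poly q ->
  x0fun eps p =1 x0fun eps q -> cls eps p = cls eps q.
Proof.
move=> xp xq pq; apply/eqP; rewrite -subr_eq0 -clsB; apply/eqP.
apply: cls_rel; apply: rel_fun.
  by apply: x0polyD => //; rewrite -scaleN1r; apply: x0polyZ.
by move=> w; rewrite /Defs.x0fun ncevalB; apply/eqP; rewrite subr_eq0; apply/eqP; exact: pq.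
Qed.

Section X0fun.
Variables (eps w : C).
Lemma x0funD p q : x0fun eps (p + q) w = x0fun eps p w + x0fun eps q w.
Proof. exact: ncevalD. Qed.
Lemma x0funM p q : x0fun eps (p * q) w = x0fun eps p w * x0fun eps q w.
Proof. exact: ncevalM. Qed.
Lemma x0funZ (a : C) p : x0fun eps (a *: p) w = a * x0fun eps p w.
Proof. exact: ncevalZ. Qed.
Lemma x0fun0 : x0fun eps 0 w = 0.
Proof. exact: nceval0. Qed.
Lemma x0fun1 : x0fun eps 1 w = 1.
Proof. exact: nceval1. Qed.
Lemma x0fun_X0 : x0fun eps (ncvar R X0) w = w.
Proof. exact: nceval_var. Qed.
Lemma x0fun_Rho r : x0fun eps (ncvar R (Rho r)) w = rho (w + r%:~R * eps).
Proof. exact: nceval_var. Qed.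
End X0fun.

Definition ladder_gen (b : bool) : gen := if b then Xp else Xm.
Definition ladder_step (b : bool) : int := if b then 1 else -1.

Definition ladder_shift (b : bool) (eps : C) : C := if b then eps else - eps.

Lemma ladder_shiftE b eps : ladder_shift b eps = (ladder_step b)%:~R * eps.
Proof. by case: b; rewrite /ladder_shift /= ?mul1r ?mulN1r. Qed.

Lemma cls_commutator eps p q : cls eps (p * q - q * p) =
  cls eps p * cls eps q - cls eps q * cls eps p.
Proof.
exact: (etrans (clsB rho eps (p * q) (q * p))
  (congr2 (fun u v => u - v) (cls_mul eps p q) (cls_mul eps q p))).
Qed.

Lemma cls_X0_ladder b eps :
  cls eps (ncvar R X0) * cls eps (ncvar R (ladder_gen b)) =
  cls eps (ncvar R (ladder_gen b)) *
  (cls eps (ncvar R X0) + ladder_shift b eps *: (1 : alg rho eps)).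
Proof.
apply: etrans (esym (mulrDr _ _ _)).
apply: (@etrans _ _ (cls eps (ncvar R (ladder_gen b)) * cls eps (ncvar R X0) +
    ladder_shift b eps *: cls eps (ncvar R (ladder_gen b)))); last first.
  apply: congr2 => //; apply: etrans (esym (alg_scaleAr _ _ _)).
  by apply: congr2 => //; apply: esym; apply: mulr1.
case: b.
  apply: subr_sub0_eq; apply: etrans (cls_rel (rel_x0_p rho eps)).
  exact: (esym (etrans (clsB rho eps (ncvar R X0 * ncvar R Xp - ncvar R Xp * ncvar R X0)
      (eps *: ncvar R Xp))
    (congr2 (fun u v => u - v) (cls_commutator eps (ncvar R X0) (ncvar R Xp))
      (cls_scale eps eps (ncvar R Xp))))).
rewrite [ladder_shift _ _ *: _]scaleNr.
apply: subr_add0_eq; apply: etrans (cls_rel (rel_x0_m rho eps)).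
exact: (esym (etrans (clsD rho eps (ncvar R X0 * ncvar R Xm - ncvar R Xm * ncvar R X0)
      (eps *: ncvar R Xm))
    (congr2 (fun u v => u + v) (cls_commutator eps (ncvar R X0) (ncvar R Xm))
      (cls_scale eps eps (ncvar R Xm))))).
Qed.

Lemma cls_Rho_ladder b eps r :
  cls eps (ncvar R (Rho r)) * cls eps (ncvar R (ladder_gen b)) =
  cls eps (ncvar R (ladder_gen b)) * cls eps (ncvar R (Rho (r + ladder_step b))).
Proof.
rewrite -!cls_mul; apply/eqP; rewrite -subr_eq0 -clsB; apply/eqP; apply: cls_rel.
by case: b; [apply: rel_rho_p|apply: rel_rho_m].
Qed.

Lemma cls_XpXm eps :
  cls eps (ncvar R Xp) * cls eps (ncvar R Xm) = cls eps (ncvar R (Rho 0)).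
Proof.
by rewrite -cls_mul; apply/eqP; rewrite -subr_eq0 -clsB; apply/eqP; apply: cls_rel; apply: rel_pm.
Qed.

Lemma cls_XmXp eps :
  cls eps (ncvar R Xm) * cls eps (ncvar R Xp) = cls eps (ncvar R (Rho 1)).
Proof.
by rewrite -cls_mul; apply/eqP; rewrite -subr_eq0 -clsB; apply/eqP; apply: cls_rel; apply: rel_mp.
Qed.

Lemma x0poly_X0 : x0poly (ncvar R X0). Proof. exact: x0poly_var. Qed.
Lemma x0poly_Rho r : x0poly (ncvar R (Rho r)). Proof. exact: x0poly_var. Qed.

Lemma cls1 eps : cls eps 1 = 1.
Proof. by []. Qed.

(** The rule h(X_0) X_pm = X_pm h(X_0 pm eps) for every coefficient h, propagated from X_0 and the
    rho(X_0 + r eps) by [shiftable]. *)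
Lemma cls_shift b eps c : x0poly c -> exists c', [/\ x0poly c',
  cls eps c * cls eps (ncvar R (ladder_gen b)) =
    cls eps (ncvar R (ladder_gen b)) * cls eps c' &
  forall w, x0fun eps c' w = x0fun eps c (w + ladder_shift b eps)].
Proof.
pose S := @shiftable C N (alg rho eps) (cls eps) (@x0poly R) (x0fun eps)
  (cls eps (ncvar R (ladder_gen b))) (fun w => w + ladder_shift b eps).
suff : x0poly c -> S c by [].
have SM := @shiftableM C N (alg rho eps) (cls eps) (cls_mul eps) (@x0poly R)
  (x0fun eps) (@x0polyM R) (fun p q w => x0funM eps w p q)
  (cls eps (ncvar R (ladder_gen b))) (fun w => w + ladder_shift b eps).
apply: x0poly_ind.
- apply: shiftable_cst; [exact: x0poly0| |].
    rewrite cls0; exact: (etrans (mul0r _) (esym (mulr0 _))).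
  by move=> w; exact: (etrans (x0fun0 _ _) (esym (x0fun0 _ _))).
- exact: (shiftableD (clsD rho eps) (@x0polyD R) (fun p q w => x0funD eps w p q)).
- exact: (shiftableZ (cls_scale eps) (@alg_scaleAl eps) (@alg_scaleAr eps) (@x0polyZ R)
    (fun a p w => x0funZ eps w a p)).
- apply: shiftable_cst; [exact: x0poly1| |].
    exact: (etrans (mul1r _) (esym (mulr1 _))).
  by move=> w; exact: (etrans (x0fun1 _ _) (esym (x0fun1 _ _))).
- move=> p Sp; apply: (SM (ncvar R X0) p) Sp.
  exists (ncvar R X0 + ladder_shift b eps *: 1); split.
  + apply: x0polyD; [exact: x0poly_X0|]; apply: x0polyZ; exact: x0poly1.
  + apply: etrans (cls_X0_ladder b eps) _; apply: congr1; apply: esym.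
    exact: (etrans (clsD rho eps (ncvar R X0) (ladder_shift b eps *: 1))
      (congr1 (fun t => cls eps (ncvar R X0) + t) (cls_scale eps (ladder_shift b eps) 1))).
  + move=> w; apply: etrans (x0funD eps w (ncvar R X0) _) _.
    by rewrite (x0funZ eps w) x0fun1 !x0fun_X0 mulr1.
- move=> r p Sp; apply: (SM (ncvar R (Rho r)) p) Sp.
  exists (ncvar R (Rho (r + ladder_step b))); split.
  + exact: x0poly_Rho.
  + exact: cls_Rho_ladder.
  + move=> w; rewrite !x0fun_Rho; congr (rho _).
    by rewrite rmorphD mulrDl ladder_shiftE addrCA addrC.
Qed.

End Relations.

(** * Convergence of families of elements *)

Section LocalLimits.
Variable R : realType.
Local Notation C := R[i].
Variable G : set_system C.
Context {FG : Filter G}.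
Implicit Types (f g : C -> C -> C) (h k : C -> C).

(** The joint limit as w tends to z and eps runs along [G], in the form of estimates: the comparison
    is with the value of h at the centre z. The filter is a parameter because the punctured and the
    principal filter at 0 are both used. *)
Definition loc_cvg f h := forall z (e : R), 0 < e -> exists2 d : R, 0 < d &
  \forall eps \near G, forall w, cmod (w - z) < d -> cmod (f eps w - h z) < e.

Lemma loc_cvgP f h : loc_cvg f h <-> forall z,
  (fun we : C * C => f we.2 we.1) @ filter_prod (nbhs z) G --> h z.
Proof.
split=> [fh z A /nbhs_cmodP [e e0 eA]|fh z e e0].
  have [d d0 df] := fh z e e0.
  exists ([set w | cmod (w - z) < d],
    [set eps | forall w, cmod (w - z) < d -> cmod (f eps w - h z) < e]).
    by split=> //=; apply/nbhs_cmodP; exists d.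
  by move=> [w eps] /= [wd /(_ _ wd)]; exact: eA.
have [] := fh z [set v | cmod (v - h z) < e]; first by apply/nbhs_cmodP; exists e.
move=> [U V] /= [/nbhs_cmodP [d d0 dU] GV] UV; exists d => //.
apply: filterS GV => eps Veps w /dU Uw; exact: (UV (w, eps)).
Qed.

Lemma loc_cvg_cst (c : C) : loc_cvg (fun _ _ => c) (fun=> c).
Proof.
move=> z e e0; exists 1 => //; near=> eps => w _; by rewrite subrr cmod0.
Unshelve. all: by end_near. Qed.

Lemma loc_cvgD f g h k : loc_cvg f h -> loc_cvg g k ->
  loc_cvg (fun eps w => f eps w + g eps w) (fun z => h z + k z).
Proof.
move=> fh gk z e e0; have e2 : 0 < e / 2 by rewrite divr_gt0.
have [d d0 df] := fh z _ e2; have [d' d'0 dg] := gk z _ e2.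
exists (Num.min d d'); first by rewrite lt_min d0.
apply: filterS2 df dg => eps df dg w; rewrite lt_min => /andP[/df fw /dg gw].
rewrite opprD addrACA; apply: le_lt_trans (cmodD _ _) _.
by rewrite [e]splitr ltrD.
Qed.

Lemma loc_cvgM f g h k : loc_cvg f h -> loc_cvg g k ->
  loc_cvg (fun eps w => f eps w * g eps w) (fun z => h z * k z).
Proof.
move=> fh gk z e e0.
set B := cmod (h z) + cmod (k z) + 1.
have B0 : 0 < B by rewrite ltr_wpDl// addr_ge0 ?cmod_ge0.
(* The three error terms add up to at most e' (1 + |h z| + |k z|) = e' B, where e' <= 1 controls the
   product of both errors; B + 1 instead of B makes the final inequality strict. *)
set e' := Num.min 1 (e / (B + 1)).
have e'0 : 0 < e' by rewrite lt_min ltr01 divr_gt0// ltr_wpDl// ltW.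
have [d d0 df] := fh z _ e'0; have [d' d'0 dg] := gk z _ e'0.
exists (Num.min d d'); first by rewrite lt_min d0.
apply: filterS2 df dg => eps df dg w; rewrite lt_min => /andP[/df fw /dg gw].
set a := f eps w in fw *; set b := g eps w in gw *.
have -> : a * b - h z * k z = (a - h z) * (b - k z) + (a - h z) * k z +
    h z * (b - k z) by ring.
have ab : cmod (a - h z) * cmod (b - k z) <= e'.
  rewrite -[leRHS]mulr1; apply: ler_pM; rewrite ?cmod_ge0 ?(ltW fw)//.
  by rewrite (le_trans (ltW gw))// ge_min lexx.
apply: le_lt_trans (cmodD _ _) _; apply: le_lt_trans (lerD (cmodD _ _) (lexx _)) _.
rewrite !cmodM.
have h1 : cmod (a - h z) * cmod (k z) <= e' * cmod (k z).
  by rewrite ler_wpM2r ?cmod_ge0 ?ltW.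
have h2 : cmod (h z) * cmod (b - k z) <= cmod (h z) * e'.
  by rewrite ler_wpM2l ?cmod_ge0 ?ltW.
have h3 : e' * (B + 1) <= e.
  have B1 : 0 < B + 1 by rewrite addr_gt0.
  by rewrite -ler_pdivlMr// /e' ge_min lexx orbT.
move: ab h1 h2 h3; rewrite /B; lra.
Qed.

Lemma loc_cvgN f h : loc_cvg f h -> loc_cvg (fun eps w => - f eps w) (fun z => - h z).
Proof.
move=> fh z e e0; have [d d0 df] := fh z e e0; exists d => //.
by apply: filterS df => eps df w /df; rewrite -opprD cmodN.
Qed.

Lemma loc_cvg_near f g h : (\forall eps \near G, f eps =1 g eps) ->
  loc_cvg f h -> loc_cvg g h.
Proof.
move=> fg fh z e e0; have [d d0 df] := fh z e e0; exists d => //.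
by apply: filterS2 fg df => eps fg df w /df; rewrite fg.
Qed.

Lemma loc_cvg_continuous k : continuous k -> loc_cvg (fun _ => k) k.
Proof.
move=> ck z e e0; have /nbhs_cmodP [d d0 dk] : nbhs z (k @^-1` [set v | cmod (v - k z) < e]).
  by apply: ck; apply/nbhs_cmodP; exists e.
by exists d => //; near=> eps => w /dk.
Unshelve. all: by end_near. Qed.

Hypothesis G0 : G --> (0 : C).

Lemma near_small (d : R) : 0 < d -> \forall eps \near G, cmod eps < d.
Proof.
move=> d0; apply: G0; apply/nbhs_cmodP; exists d => // w; by rewrite subr0.
Qed.

(** For small eps the shift stays within half of the disc on which f is controlled. Pointwise
    convergence would not survive this substitution, and commuting X_pm past a coefficient requires
    it. *)
Lemma loc_cvg_shift (c : C) f h : loc_cvg f h ->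
  loc_cvg (fun eps w => f eps (w + c * eps)) h.
Proof.
move=> fh z e e0; have [d d0 df] := fh z e e0.
exists (d / 2); first by rewrite divr_gt0.
have c0 : 0 < cmod c + 1 by rewrite ltr_wpDl ?cmod_ge0.
have sm := near_small (divr_gt0 (divr_gt0 d0 (ltr0Sn R 1)) c0).
apply: filterS2 df sm => eps df; rewrite ltr_pdivlMr// => se w wd; apply: df.
rewrite addrAC; apply: le_lt_trans (cmodD _ _) _; rewrite cmodM.
have : cmod c * cmod eps <= cmod eps * (cmod c + 1).
  by rewrite mulrC ler_wpM2l ?cmod_ge0// lerDl.
lra.
Qed.

Lemma loc_cvg_unique f h k : ProperFilter G -> loc_cvg f h -> loc_cvg f k -> h =1 k.
Proof.
move=> PG fh fk z; apply/eqP; rewrite -subr_eq0 -cmod_eq0 eq_le cmod_ge0 andbT.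
apply/ler_addgt0Pl => e e0; rewrite addr0; have e2 : 0 < e / 2 by rewrite divr_gt0.
have [d d0 df] := fh z _ e2; have [d' d'0 dg] := fk z _ e2.
have [eps [/(_ z) h1 /(_ z) h2]] := filter_ex (filterI df dg).
rewrite subrr cmod0 in h1 h2; have {}h1 := h1 d0; have {}h2 := h2 d'0.
have -> : h z - k z = (f eps z - k z) - (f eps z - h z) by ring.
by apply: le_trans (cmodB _ _) _; rewrite [e]splitr lerD// ltW.
Qed.

End LocalLimits.

Lemma big_uniq_sub (V : nmodType) (F : int -> V) (s t : seq int) :
  uniq s -> uniq t -> {subset t <= s} ->
  \sum_(k <- s) (if k \in t then F k else 0) = \sum_(k <- t) F k.
Proof.
move=> us ut ts; rewrite -big_mkcond /= -big_filter; apply: perm_big.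
apply: uniq_perm => //; first by rewrite filter_uniq.
by move=> k; rewrite mem_filter; case: (boolP (k \in t)) => //= /ts ->.
Qed.

(* D f a stands for a = f(X_0), and Y true, Y false for X_+, X_-.  The algebra
   is kept abstract since conversion in the concrete quotient is very slow. *)
Section LadderAlgebra.
Variable R : realType.
Local Notation C := R[i].
Variables (rho : C -> C) (A : C -> pzRingType).
Variable D : forall eps : C, (C -> C) -> A eps -> Prop.
Variables (Y : bool -> forall eps, A eps) (M : Type) (zf : M -> C) (Yf : bool -> M -> C).

Hypothesis Dcst0 : forall eps, D (fun=> 0) (0 : A eps).
Hypothesis Dcst1 : forall eps, D (fun=> 1) (1 : A eps).
Hypothesis DD : forall eps f g (a b : A eps), D f a -> D g b -> D (fun w => f w + g w) (a + b).
Hypothesis DM : forall eps f g (a b : A eps), D f a -> D g b -> D (fun w => f w * g w) (a * b).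
Hypothesis Dshift : forall b eps f (a : A eps), D f a -> exists a' : A eps,
  D (fun w => f (w + ladder_shift b eps)) a' /\ a * Y b eps = Y b eps * a'.
Hypothesis DYY : forall b eps,
  D (fun w => rho (w + (if b then 0 else 1) * eps)) (Y b eps * Y (~~ b) eps).
Hypothesis YfYf : forall b p, Yf b p * Yf (~~ b) p = rho (zf p).
Hypothesis rho_continuous : continuous rho.

Definition ladderA (k : int) eps : A eps := Y (0 <= k) eps ^+ `|k|%N.
Definition ladderf (k : int) p : C := Yf (0 <= k) p ^+ `|k|%N.

Variable G : set_system C.
Context {FG : Filter G}.
Hypothesis G0 : G --> (0 : C).

(** Sums may repeat a ladder index or list the indices in any order, so closure under products is an
    induction; [cv_normal] collects equal indices afterwards. *)
Inductive cv : (forall eps, A eps) -> (M -> C) -> Prop :=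
| cv0 : cv (fun=> 0) (fun=> 0)
| cv_term k f a h : (forall eps, D (f eps) (a eps)) -> loc_cvg G f h ->
    cv (fun eps => ladderA k eps * a eps) (fun p => ladderf k p * h (zf p))
| cv_add a b L L' : cv a L -> cv b L' ->
    cv (fun eps => a eps + b eps) (fun p => L p + L' p)
| cv_near a b L : (\forall eps \near G, a eps = b eps) -> cv a L -> cv b L.

Lemma cv_ext a L L' : L =1 L' -> cv a L -> cv a L'.
Proof. by move=> /funext ->. Qed.

Lemma cv_eq a b L : (forall eps, a eps = b eps) -> cv a L -> cv b L.
Proof. by move=> ab; apply: cv_near; near=> eps. Unshelve. all: by end_near. Qed.

Lemma cv_fun f a h : (forall eps, D (f eps) (a eps)) -> loc_cvg G f h ->
  cv a (h \o zf).
Proof.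
move=> fa fh; apply: cv_eq (cv_ext _ (cv_term 0 fa fh)).
  by move=> eps; rewrite /ladderA expr0 mul1r.
by move=> p; rewrite /ladderf expr0 mul1r.
Qed.

Lemma cv_mul_fun a L f d h : (forall eps, D (f eps) (d eps)) -> loc_cvg G f h ->
  cv a L -> cv (fun eps => a eps * d eps) (fun p => L p * h (zf p)).
Proof.
move=> fd fh; elim=> {a L} [|k g a h' ga gh'|a b L L' _ IH _ IH'|a b L ab _ IH].
- apply: cv_eq (cv_ext _ cv0) => [eps|p]; by rewrite mul0r.
- apply: cv_eq (cv_ext _ (@cv_term k _ (fun eps => a eps * d eps) _ _ (loc_cvgM gh' fh))).
  + by move=> eps; rewrite mulrA.
  + by move=> p; rewrite mulrA.
  + by move=> eps; exact: DM.
- apply: cv_eq (cv_ext _ (cv_add IH IH')) => [eps|p]; by rewrite mulrDl.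
- by apply: cv_near IH; apply: filterS ab => eps ->.
Qed.

(** A letter in the direction of the ladder lengthens it with coefficient 1. A letter in the
    opposite direction shortens it, since X_+ X_- and X_- X_+ are functions of X_0, both with limit
    rho. *)
Lemma ladder_absorb k b : exists f a h, [/\ forall eps, D (f eps) (a eps),
  loc_cvg G f h,
  forall eps, ladderA k eps * Y b eps = ladderA (k + (if b then 1 else -1)) eps * a eps
  & forall p, ladderf k p * Yf b p = ladderf (k + (if b then 1 else -1)) p * h (zf p)].
Proof.
have one n : `|k|%N = n -> (k + (if b then 1 else -1) = if b then n.+1%:Z else - n.+1%:Z) ->
    (0 < n)%N || b -> (0 <= k) = b -> exists f a h, [/\ forall eps, D (f eps) (a eps),
  loc_cvg G f h,
  forall eps, ladderA k eps * Y b eps = ladderA (k + (if b then 1 else -1)) eps * a eps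
  & forall p, ladderf k p * Yf b p = ladderf (k + (if b then 1 else -1)) p * h (zf p)].
  move=> kn -> _ kb; exists (fun _ _ => 1), (fun=> 1), (fun=> 1); split.
  - by move=> eps; exact: Dcst1.
  - exact: loc_cvg_cst.
  - move=> eps; rewrite /ladderA kn kb mulr1 -exprSr; by case: (b).
  - move=> p; rewrite /ladderf kn kb mulr1 -exprSr; by case: (b).
have YYc c : loc_cvg G (fun eps w => rho (w + (if c then 0 else 1) * eps)) rho.
  exact: (loc_cvg_shift G0 (if c then 0 else 1) (@loc_cvg_continuous R G FG rho rho_continuous)).
case: k one => n one; case: b one => one.
- have nE : Posz n + 1 = n.+1%:Z by rewrite -[1]/(1%:Z) -PoszD addn1.
  exact: (one n erefl nE (orbT _) erefl).
- case: n one => [|n] _.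
    (* The ladder of index 0 is counted as ascending but is empty, so X_- starts the descending
       one. *)
    exists (fun _ _ => 1), (fun=> 1), (fun=> 1); split.
    + by move=> eps; exact: Dcst1.
    + exact: loc_cvg_cst.
    + by move=> eps; rewrite /ladderA /= expr0 mul1r mulr1 expr1.
    + by move=> p; rewrite /ladderf /= expr0 mul1r mulr1 expr1.
  exists (fun eps w => rho (w + 0 * eps)), (fun eps => Y true eps * Y false eps), rho.
  have -> : Posz n.+1 + -1 = Posz n by rewrite -addn1 PoszD addrK.
  split; [exact: (DYY true)|exact: (YYc true)| |] => [eps|p].
    by rewrite /ladderA /= exprSr mulrA.
  by rewrite /ladderf /= exprSr -mulrA (YfYf true).
- clear one; exists (fun eps w => rho (w + 1 * eps)), (fun eps => Y false eps * Y true eps), rho.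
  have -> : Negz n + 1 = - n%:Z by rewrite NegzE -addn1 PoszD opprD subrK.
  split; [exact: (DYY false)|exact: (YYc false)| |] => [eps|p].
    (* For n = 0 the shortened ladder has index 0 and counts as ascending, but it is the empty
       product in either direction. *)
    by rewrite /ladderA /=; case: n => [|n]; rewrite exprSr mulrA.
  by rewrite /ladderf /=; case: n => [|n]; rewrite exprSr -mulrA (YfYf false).
- have nE : Negz n + -1 = - n.+2%:Z by rewrite NegzE -opprD -[1]/(1%:Z) -PoszD addn1.
  exact: (one n.+1 erefl nE isT erefl).
Qed.

(** The letter is moved to the left of the coefficient, which shifts the argument of the
    coefficient, and is then absorbed by the ladder. *)
Lemma cv_mulY b a L : cv a L -> cv (fun eps => a eps * Y b eps) (fun p => L p * Yf b p).
Proof.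
elim=> {a L} [|k f a h fa fh|a a' L L' _ IH _ IH'|a a' L aa' _ IH].
- apply: cv_eq (cv_ext _ cv0) => [eps|p]; by rewrite mul0r.
- have [g [c [l [gc gl cE lE]]]] := ladder_absorb k b.
  pose a' eps := projT1 (cid (Dshift b (fa eps))).
  have a'D eps : D (fun w => f eps (w + ladder_shift b eps)) (a' eps).
    exact: (projT2 (cid (Dshift b (fa eps)))).1.
  have aY eps : a eps * Y b eps = Y b eps * a' eps.
    exact: (projT2 (cid (Dshift b (fa eps)))).2.
  have fsh : loc_cvg G (fun eps w => f eps (w + ladder_shift b eps)) h.
    have e : \forall eps \near G, (fun w => f eps (w + (if b then 1 else -1) * eps)) =1
        (fun w => f eps (w + ladder_shift b eps)).
      by near=> eps; move=> w; case: (b); rewrite ?mul1r ?mulN1r.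
    exact: (loc_cvg_near e (loc_cvg_shift G0 (if b then 1 else -1) fh)).
  apply: cv_eq (cv_ext _ (@cv_term (k + (if b then 1 else -1)) _
    (fun eps => c eps * a' eps) _ _ (loc_cvgM gl fsh))).
  + by move=> eps; rewrite -mulrA aY !mulrA cE.
  + by move=> p; rewrite mulrA -lE mulrAC.
  + by move=> eps; exact: DM.
- apply: cv_eq (cv_ext _ (cv_add IH IH')) => [eps|p]; by rewrite mulrDl.
- by apply: cv_near IH; apply: filterS aa' => eps ->.
Unshelve. all: by end_near. Qed.

(** Induction on the right factor: a term of it is multiplied on letter by letter, and its
    coefficient comes last. *)
Lemma cv_mul a b L L' : cv a L -> cv b L' ->
  cv (fun eps => a eps * b eps) (fun p => L p * L' p).
Proof.
move=> aL; elim=> {b L'} [|k f b h fb fh|b b' L1 L2 _ IH _ IH'|b b' L' bb' _ IH].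
- apply: cv_eq (cv_ext _ cv0) => [eps|p]; by rewrite mulr0.
- have pow n : cv (fun eps => a eps * Y (0 <= k) eps ^+ n)
      (fun p => L p * Yf (0 <= k) p ^+ n).
    elim: n => [|n IH].
      apply: cv_eq (cv_ext _ aL) => [eps|p]; by rewrite expr0 mulr1.
    apply: cv_eq (cv_ext _ (cv_mulY (0 <= k) IH)) => [eps|p];
      by rewrite exprSr mulrA.
  apply: cv_eq (cv_ext _ (cv_mul_fun fb fh (pow `|k|%N))) => [eps|p];
    by rewrite mulrA.
- apply: cv_eq (cv_ext _ (cv_add IH IH')) => [eps|p]; by rewrite mulrDr.
- by apply: cv_near IH; apply: filterS bb' => eps ->.
Qed.

Lemma cv_Y b : cv (Y b) (Yf b).
Proof.
have := cv_mulY b (cv_fun Dcst1 (@loc_cvg_cst R G FG 1)).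
by move=> h; apply: cv_eq (cv_ext _ h) => [eps|p] /=; rewrite mul1r.
Qed.

(** For a sum, the union of the two index sets is used, and a coefficient missing on one side is
    replaced by 0. *)
Lemma cv_normal a L : cv a L ->
  exists (s : seq int) (f : int -> C -> C -> C) (c : int -> forall eps, A eps) (h : int -> C -> C),
  [/\ uniq s, forall k eps, D (f k eps) (c k eps), forall k, loc_cvg G (f k) (h k),
      \forall eps \near G, a eps = \sum_(k <- s) ladderA k eps * c k eps
    & L = fun p => \sum_(k <- s) ladderf k p * h k (zf p)].
Proof.
elim=> {a L} [|k f a h fa fh|a a' L L' _ IH _ IH'|a a' L aa' _ IH].
- exists [::], (fun _ _ _ => 0), (fun _ _ => 0), (fun _ _ => 0); split=> //.
  + by move=> _; exact: loc_cvg_cst.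
  + by near=> eps; rewrite big_nil.
  + by apply/funext => p; rewrite big_nil.
- exists [:: k], (fun=> f), (fun=> a), (fun=> h); split=> //.
  + by near=> eps; rewrite big_seq1.
  + by apply/funext => p; rewrite big_seq1.
- have [s [f [c [h [us fc fh aE LE]]]]] := IH.
  have [s' [f' [c' [h' [us' fc' fh' aE' LE']]]]] := IH'.
  have ss : {subset s <= undup (s ++ s')} by move=> k ks; rewrite mem_undup mem_cat ks.
  have ss' : {subset s' <= undup (s ++ s')}.
    by move=> k ks; rewrite mem_undup mem_cat ks orbT.
  exists (undup (s ++ s')),
    (fun k eps w => (if k \in s then f k eps w else 0) + (if k \in s' then f' k eps w else 0)),
    (fun k eps => (if k \in s then c k eps else 0) + (if k \in s' then c' k eps else 0)),
    (fun k z => (if k \in s then h k z else 0) + (if k \in s' then h' k z else 0)); split.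
  + exact: undup_uniq.
  + by move=> k eps; apply: DD; case: ifP => // _; exact: Dcst0.
  + move=> k; apply: loc_cvgD.
      by case: (k \in s) => //; exact: loc_cvg_cst.
    by case: (k \in s') => //; exact: loc_cvg_cst.
  + apply: filterS2 aE aE' => eps -> ->.
    rewrite -(big_uniq_sub _ (undup_uniq _) us ss) -(big_uniq_sub _ (undup_uniq _) us' ss')
      -big_split /=.
    by apply: eq_bigr => k _; rewrite mulrDr; do 2!case: ifP; rewrite ?mulr0.
  + apply/funext => p; rewrite LE LE'.
    rewrite -(big_uniq_sub _ (undup_uniq _) us ss) -(big_uniq_sub _ (undup_uniq _) us' ss')
      -big_split /=.
    by apply: eq_bigr => k _; rewrite mulrDr; do 2!case: ifP; rewrite ?mulr0.
- have [s [f [c [h [us fc fh aE LE]]]]] := IH.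
  exists s, f, c, h; split=> //.
  by apply: filterS2 aE aa' => eps <- ->.
Unshelve. all: by end_near. Qed.

Variable kc : forall eps, C -> A eps.
Hypothesis Dkc : forall eps c, D (fun=> c) (kc eps c).
Hypothesis kcC : forall eps c (a : A eps), kc eps c * a = a * kc eps c.
Hypothesis DN : forall eps f (a : A eps), D f a -> D (fun w => - f w) (- a).
Hypothesis Dfun : forall eps f (a b : A eps), D f a -> D f b -> a = b.

(** The commutator divided by eps; as [A eps] is only a ring here, the scalar acts through the
    central elements [kc]. *)
Definition comm (u v : forall eps, A eps) eps : A eps :=
  (u eps * v eps - v eps * u eps) * kc eps eps^-1.

Lemma commC u v eps : comm u v eps = - comm v u eps.
Proof. by rewrite /comm -[RHS]mulNr opprB. Qed.

Lemma commMl u u' v eps : comm (fun eps => u eps * u' eps) v eps =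
  u eps * comm u' v eps + comm u v eps * u' eps.
Proof.
rewrite /comm -[_ * kc _ _ * u' eps]mulrA kcC !mulrA -mulrDl; congr (_ * _).
by rewrite mulrBr mulrBl !mulrA addrA subrK.
Qed.

Lemma commDl u u' v eps : comm (fun eps => u eps + u' eps) v eps =
  comm u v eps + comm u' v eps.
Proof.
by rewrite /comm -[RHS]mulrDl; congr (_ * _); rewrite mulrDl mulrDr opprD addrACA.
Qed.

Lemma commZl c u v eps : comm (fun eps => u eps * kc eps c) v eps =
  comm u v eps * kc eps c.
Proof.
rewrite /comm -!mulrA [kc eps c * v eps]kcC [kc eps eps^-1 * _]kcC !mulrA.
by rewrite -!mulrBl.
Qed.

Lemma cvN a L : cv a L -> cv (fun eps => - a eps) (fun p => - L p).
Proof.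
have D1 : forall eps, D (fun=> -1) (-1 : A eps).
  by move=> eps; apply: (@DN eps (fun=> 1)); exact: Dcst1.
move=> aL; have := cv_mul_fun D1 (@loc_cvg_cst R G FG (-1)) aL.
by move=> h; apply: cv_eq (cv_ext _ h) => [eps|p]; rewrite mulrN1.
Qed.

Lemma cvZ c a L : cv a L -> cv (fun eps => a eps * kc eps c) (fun p => c * L p).
Proof.
move=> aL; apply: cv_ext (cv_mul_fun (fun eps => @Dkc eps c) (@loc_cvg_cst R G FG c) aL).
by move=> p; rewrite mulrC.
Qed.

(** The commutator of a = f(X_0) with Y is Y (a' - a), where a' is the shifted function, so division
    by eps produces a difference quotient of f. *)
Lemma cv_comm_fun_Y b f a dh : (forall eps, D (f eps) (a eps)) ->
  loc_cvg G (fun eps w => (f eps (w + ladder_shift b eps) - f eps w) * eps^-1) dh ->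
  cv (comm a (Y b)) (fun p => Yf b p * dh (zf p)).
Proof.
move=> fa fdh.
pose a' eps := projT1 (cid (Dshift b (fa eps))).
have a'D eps : D (fun w => f eps (w + ladder_shift b eps)) (a' eps).
  exact: (projT2 (cid (Dshift b (fa eps)))).1.
have aY eps : a eps * Y b eps = Y b eps * a' eps.
  exact: (projT2 (cid (Dshift b (fa eps)))).2.
have Dd eps : D (fun w => (f eps (w + ladder_shift b eps) - f eps w) * eps^-1)
    ((a' eps - a eps) * kc eps eps^-1).
  by apply: (@DM eps (fun w => _ - _)); [apply: DD => //; exact: DN|exact: Dkc].
apply: cv_eq (cv_mul (cv_Y b) (cv_fun Dd fdh)) => eps /=.
by rewrite /comm aY mulrA mulrBr.
Qed.

Lemma cv_comm_YY b dh : loc_cvg G (fun eps w => (rho (w + (if b then 0 else 1) * eps) -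
      rho (w + (if b then 1 else 0) * eps)) * eps^-1) dh ->
  cv (comm (Y b) (Y (~~ b))) (dh \o zf).
Proof.
move=> rdh; apply: cv_fun rdh => eps.
apply: (@DM eps (fun w => _ - _)); last exact: Dkc.
apply: DD; first exact: DYY.
apply: DN; have := DYY (~~ b) eps; rewrite negbK.
by case: (b).
Qed.

Lemma cv_comm0 u v : (forall eps, u eps * v eps = v eps * u eps) ->
  cv (comm u v) (fun=> 0).
Proof. by move=> uv; apply: cv_eq cv0 => eps; rewrite /comm uv subrr mul0r. Qed.

Lemma D_commute eps f g (a b : A eps) : D f a -> D g b -> a * b = b * a.
Proof.
move=> fa gb; apply: (Dfun (DM fa gb)).
by have := DM gb fa; congr D; apply/funext => w; rewrite mulrC.
Qed.

Variables (I : Type) (X : I -> forall eps, A eps) (XF : I -> M -> C).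
Hypothesis cvX : forall i, cv (X i) (XF i).

(** A family and its classical function, built in parallel. Products occur only with a single
    generator on the left: this reaches all polynomials and leaves one case of the Leibniz rule for
    induction. *)
Inductive observable : (forall eps, A eps) -> (M -> C) -> Prop :=
| observable0 : observable (fun=> 0) (fun=> 0)
| observable1 : observable (fun=> 1) (fun=> 1)
| observableD u v F H : observable u F -> observable v H ->
    observable (fun eps => u eps + v eps) (fun p => F p + H p)
| observableZ c u F : observable u F ->
    observable (fun eps => u eps * kc eps c) (fun p => c * F p)
| observableX i u F : observable u F ->
    observable (fun eps => X i eps * u eps) (fun p => XF i p * F p)
| observable_eq u v F H : (forall eps, u eps = v eps) -> F =1 H ->
    observable u F -> observable v H.

Lemma cv_observable u F : observable u F -> cv u F.
Proof.
elim=> {u F} [||u v F H _ IH _ IH'|c u F _ IH|i u F _ IH|u v F H uv FH _ IH].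
- exact: cv0.
- exact: cv_ext (cv_fun Dcst1 (@loc_cvg_cst R G FG 1)).
- exact: cv_add.
- exact: cvZ.
- exact: cv_mul.
- exact: cv_eq (cv_ext FH IH).
Qed.

Variables (S : (M -> C) -> Prop) (br : (M -> C) -> (M -> C) -> M -> C).
Hypothesis brDl : forall c F H K, S F -> S H -> S K ->
  br (fun p => c * F p + H p) K = fun p => c * br F K p + br H K p.
Hypothesis brC : forall F H, S F -> S H -> br F H = fun p => - br H F p.
Hypothesis brM : forall F H K, S F -> S H -> S K ->
  br F (fun p => H p * K p) = fun p => br F H p * K p + H p * br F K p.
Hypothesis S0 : S (fun=> 0).
Hypothesis S1 : S (fun=> 1).
Hypothesis SD : forall F H, S F -> S H -> S (fun p => F p + H p).
Hypothesis SM : forall F H, S F -> S H -> S (fun p => F p * H p).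
Hypothesis SZ : forall c F, S F -> S (fun p => c * F p).
Hypothesis SX : forall i, S (XF i).
Hypothesis cv_comm_gen : forall i j, cv (comm (X i) (X j)) (br (XF i) (XF j)).

Lemma S_observable u F : observable u F -> S F.
Proof.
elim=> {u F} [||u v F H _ IH _ IH'|c u F _ IH|i u F _ IH|u v F H uv FH _ IH] //.
- exact: SD.
- exact: SZ.
- exact: SM.
- by rewrite -(funext FH).
Qed.

Lemma br0l F p : S F -> br (fun=> 0) F p = 0.
Proof.
move=> SF; have := congr1 (fun f => f p) (brDl (-1) S0 S0 SF).
have -> : (fun _ : M => -1 * 0 + 0) = (fun=> 0 : C).
  by apply/funext => q; rewrite mulr0 addr0.
by move=> /= h; rewrite h mulN1r addNr.
Qed.

Lemma br1l F p : S F -> br (fun=> 1) F p = 0.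
Proof.
move=> SF; have := congr1 (fun f => f p) (brM SF S1 S1).
have -> : (fun _ : M => 1 * 1) = (fun=> 1 : C) by apply/funext => q; rewrite mulr1.
move=> /= /eqP; rewrite mulr1 mul1r -subr_eq subrr eq_sym => /eqP h.
by rewrite (brC S1 SF) h oppr0.
Qed.

Lemma brDl' F H K p : S F -> S H -> S K ->
  br (fun p => F p + H p) K p = br F K p + br H K p.
Proof.
move=> SF SH SK; have := congr1 (fun f => f p) (brDl 1 SF SH SK).
have -> : (fun q => 1 * F q + H q) = (fun q => F q + H q).
  by apply/funext => q; rewrite mul1r.
by rewrite mul1r.
Qed.

Lemma brZl c F K p : S F -> S K -> br (fun p => c * F p) K p = c * br F K p.
Proof.
move=> SF SK; have := congr1 (fun f => f p) (brDl c SF S0 SK).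
have -> : (fun q => c * F q + 0) = (fun q => c * F q).
  by apply/funext => q; rewrite addr0.
by rewrite br0l// addr0.
Qed.

Lemma brMl F H K p : S F -> S H -> S K ->
  br (fun p => F p * H p) K p = F p * br H K p + br F K p * H p.
Proof.
move=> SF SH SK; rewrite (brC (SM SF SH) SK) (brM SK SF SH) (brC SK SF) (brC SK SH).
by ring.
Qed.

(** Both the commutator and [br] are biderivations, so agreement on pairs of generators propagates.
    The induction always runs over the left argument and is used twice, with antisymmetry exchanging
    the arguments in between. *)
Lemma cv_comm_observable u F v H : observable u F -> observable v H ->
  cv (comm u v) (br F H).
Proof.
suff gen (T : (forall eps, A eps) -> (M -> C) -> Prop) :
    (forall v H, T v H -> cv v H /\ S H) ->
    (forall i v H, T v H -> cv (comm (X i) v) (br (XF i) H)) ->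
    forall u F v H, observable u F -> T v H -> cv (comm u v) (br F H).
  (* In the first round the right argument is a generator, so that only the brackets of generators
     are needed. *)
  have step i u' F' : observable u' F' -> cv (comm u' (X i)) (br F' (XF i)).
    move=> ou; apply: (gen (fun w K => exists j, w = X j /\ K = XF j)) => //.
    - by move=> w K [j [-> ->]]; split.
    - by move=> j w K [k [-> ->]]; exact: cv_comm_gen.
    - by exists i.
  move=> ou ov; apply: (gen observable) => //.
    by move=> w K ow; split; [exact: cv_observable|exact: S_observable ow].
  (* In the second round the right argument is arbitrary; its bracket with a generator on the left
     is minus the one from the first round. *)
  move=> i w K ow; apply: cv_eq (cv_ext _ (cvN (step i _ _ ow))).
    by move=> eps; rewrite [RHS]commC.
  by move=> p; rewrite (brC (SX i) (S_observable ow)).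
move=> Tcv Tgen {}u {}F {}v {}H ou Tv; have [vH SH] := Tcv _ _ Tv.
elim: ou => {u F} [||u u' F F' oF IH oF' IH'|c u F oF IH|i u F oF IH|u u' F F' uu FF oF IH].
- apply: cv_ext (cv_comm0 _) => [p|eps]; first by rewrite br0l.
  by rewrite mul0r mulr0.
- apply: cv_ext (cv_comm0 _) => [p|eps]; first by rewrite br1l.
  by rewrite mul1r mulr1.
- have SF := S_observable oF; have SF' := S_observable oF'.
  apply: cv_eq (cv_ext _ (cv_add IH IH')) => [eps|p]; first by rewrite commDl.
  by rewrite brDl'.
- have SF := S_observable oF.
  apply: cv_eq (cv_ext _ (cvZ c IH)) => [eps|p]; first by rewrite commZl.
  by rewrite brZl.
- have SF := S_observable oF.
  apply: cv_eq (cv_ext _ (cv_add (cv_mul (cvX i) IH)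
    (cv_mul (Tgen i _ _ Tv) (cv_observable oF)))) => [eps|p]; first by rewrite commMl.
  by rewrite brMl.
- have -> : br F' H = br F H by rewrite (funext FF).
  by apply: cv_eq IH => eps; rewrite /comm uu.
Qed.

End LadderAlgebra.

(** * The quotient as an instance of the abstract ladder algebra *)

Section Representation.
Variables (R : realType) (rho : R[i] -> R[i]).
Local Notation C := R[i].
Local Notation N := (ncpoly R).
Implicit Types (p q c : N) (eps w : C) (f g : C -> C).

(* The element a of A(rho, eps) is f(X_0). *)
Definition represents eps f (a : alg rho eps) :=
  exists c, [/\ x0poly c, cls rho eps c = a & forall w, x0fun rho eps c w = f w].

Lemma represents0 eps : @represents eps (fun=> 0) 0.
Proof. exists 0; split; [exact: x0poly0|exact: cls0|exact: x0fun0]. Qed.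

Lemma represents1 eps : @represents eps (fun=> 1) 1.
Proof. exists 1; split; [exact: x0poly1|exact: cls1|exact: x0fun1]. Qed.

Lemma representsD eps f g (a b : alg rho eps) : represents f a -> represents g b ->
  represents (fun w => f w + g w) (a + b).
Proof.
move=> [c [xc <- cf]] [d [xd <- dg]]; exists (c + d); split.
- exact: x0polyD.
- exact: clsD.
- move=> w; rewrite -cf -dg; exact: x0funD.
Qed.

Lemma representsM eps f g (a b : alg rho eps) : represents f a -> represents g b ->
  represents (fun w => f w * g w) (a * b).
Proof.
move=> [c [xc <- cf]] [d [xd <- dg]]; exists (c * d); split.
- exact: x0polyM.
- exact: cls_mul.
- move=> w; rewrite -cf -dg; exact: x0funM.
Qed.

Lemma represents_shift b eps f (a : alg rho eps) : represents f a ->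
  exists a' : alg rho eps, represents (fun w => f (w + ladder_shift b eps)) a' /\
  a * cls rho eps (ncvar R (ladder_gen b)) = cls rho eps (ncvar R (ladder_gen b)) * a'.
Proof.
move=> [c [xc <- cf]]; have [c' [xc' cc' c'f]] := cls_shift rho b eps xc.
exists (cls rho eps c'); split; last exact: cc'.
exists c'; split; [exact: xc'|exact: erefl|].
move=> w; rewrite -cf; exact: c'f.
Qed.

Lemma represents_Rho eps r : represents (fun w => rho (w + r%:~R * eps))
  (cls rho eps (ncvar R (Rho r))).
Proof.
exists (ncvar R (Rho r)); split; [exact: x0poly_Rho|exact: erefl|move=> w; exact: x0fun_Rho].
Qed.

Lemma represents_X0 eps : represents id (cls rho eps (ncvar R X0)).
Proof.
exists (ncvar R X0); split; [exact: x0poly_X0|exact: erefl|move=> w; exact: x0fun_X0].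
Qed.

Lemma represents_ladder b eps :
  represents (fun w => rho (w + (if b then 0 else 1) * eps))
    (cls rho eps (ncvar R (ladder_gen b)) * cls rho eps (ncvar R (ladder_gen (~~ b)))).
Proof.
case: b.
  exists (ncvar R (Rho 0)); split; [exact: x0poly_Rho|exact: (esym (cls_XpXm rho eps))|].
  by move=> w; rewrite x0fun_Rho; congr (rho (w + _ * eps)).
exists (ncvar R (Rho 1)); split; [exact: x0poly_Rho|exact: (esym (cls_XmXp rho eps))|].
by move=> w; rewrite x0fun_Rho; congr (rho (w + _ * eps)).
Qed.

Definition alg_cst eps (c : C) : alg rho eps := c *: (1 : alg rho eps).

Lemma represents_cst eps (c : C) : represents (fun=> c) (alg_cst eps c).
Proof.
exists (c *: 1); split; [apply: x0polyZ; exact: x0poly1|exact: cls_scale|].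
by move=> w; rewrite x0funZ x0fun1 mulr1.
Qed.

Lemma alg_cstC eps (c : C) (a : alg rho eps) : alg_cst eps c * a = a * alg_cst eps c.
Proof.
apply: etrans (alg_scaleAl _ _ _) _; apply: etrans _ (esym (alg_scaleAr _ _ _)).
by apply: congr1; exact: (etrans (mul1r _) (esym (mulr1 _))).
Qed.

Lemma alg_cst_scale eps (c : C) (a : alg rho eps) : a * alg_cst eps c = c *: a.
Proof.
apply: etrans (alg_scaleAr _ _ _) _; apply: congr1; exact: mulr1.
Qed.

Lemma representsN eps f (a : alg rho eps) : represents f a ->
  represents (fun w => - f w) (- a).
Proof.
move=> [c [xc <- cf]]; exists (0 - c); split.
- apply: x0polyD; [exact: x0poly0|].
  by rewrite -scaleN1r; apply: x0polyZ.
- apply: etrans (clsB rho eps 0 c) _.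
  apply: etrans (congr1 (fun t => t - cls rho eps c) (cls0 rho eps)) _.
  exact: sub0r.
- move=> w; apply: etrans (ncevalB _ 0 c) _; rewrite nceval0 sub0r.
  by congr (- _); exact: cf.
Qed.

Lemma represents_fun eps f (a b : alg rho eps) : represents f a -> represents f b -> a = b.
Proof.
move=> [c [xc <- cf]] [d [xd <- df]]; apply: cls_x0fun => // w.
by rewrite cf df.
Qed.

Lemma cls_exp eps p n : cls rho eps (p ^+ n) = cls rho eps p ^+ n.
Proof.
elim: n => [|n IH]; first exact: cls1.
apply: etrans (etrans (congr1 (cls rho eps) (exprS p n)) (cls_mul rho eps p (p ^+ n))) _.
by rewrite IH; exact: (esym (exprS _ _)).
Qed.

Lemma cls_ladder eps k c : cls rho eps (ladder R k * c) =
  ladderA (fun b eps => cls rho eps (ncvar R (ladder_gen b))) k eps * cls rho eps c.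
Proof.
apply: etrans (cls_mul rho eps (ladder R k) c) _.
apply: (congr1 (fun t => t * cls rho eps c)).
by rewrite /ladder /ladderA; case: ifP => _; exact: cls_exp.
Qed.

Definition ladder_fun (b : bool) : Mrho rho -> C := if b then xpfun rho else xmfun rho.

Lemma ladderfE k (p : Mrho rho) : ladderf ladder_fun k p = ladderfun k p.
Proof. by rewrite /ladderf /ladderfun; case: ifP. Qed.

Lemma rho_real_value (rho_real : real_valued rho) (u : R) : rho u%:C = (rhoR rho u)%:C.
Proof. by rewrite /rhoR RRe_real. Qed.

Lemma ladder_funM (rho_real : real_valued rho) b (p : Mrho rho) :
  ladder_fun b p * ladder_fun (~~ b) p = rho (zfun rho p).
Proof.
have Mp : Mrho rho (val p) by apply: set_mem; exact: valP.
rewrite /zfun rho_real_value// -Mp /ladder_fun /xpfun /xmfun.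
case: b => /=; move: (sval p).1.1 (sval p).1.2 => x y;
  apply: complex_ext => /=; ring.
Qed.

End Representation.

Section Convergence.
Variables (R : realType) (rho : R[i] -> R[i]).
Local Notation C := R[i].
Local Notation N := (ncpoly R).
Hypothesis rho_continuous : continuous rho.
Hypothesis rho_real : real_valued rho.
Variable G : set_system C.
Context {FG : Filter G}.
Hypothesis G0 : G --> (0 : C).

Let A (eps : C) : pzRingType := alg rho eps.
Let D : forall eps : C, (C -> C) -> A eps -> Prop := @represents R rho.
Let Y (b : bool) (eps : C) : A eps := cls rho eps (ncvar R (ladder_gen b)).

Definition alg_converges : (forall eps, alg rho eps) -> (Mrho rho -> C) -> Prop :=
  @cv R A D Y (Mrho rho) (@zfun R rho) (@ladder_fun R rho) G.

Lemma alg_converges_normal a L : alg_converges a L ->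
  exists (s : seq int) (c : C -> int -> N) (h : int -> C -> C),
  [/\ uniq s, forall eps k, x0poly (c eps k),
      \forall eps \near G, a eps = \sum_(k <- s) cls rho eps (ladder R k * c eps k),
      forall k, loc_cvg G (fun eps w => x0fun rho eps (c eps k) w) (h k)
    & L = fun p => \sum_(k <- s) ladderfun k p * h k (zfun rho p)].
Proof.
move=> /(cv_normal (@represents0 R rho) (@representsD R rho)).
move=> [s [f [c [h [us fc fh aE LE]]]]].
pose c' eps k : N := projT1 (cid (fc k eps)).
have c'P eps k := projT2 (cid (fc k eps)).
exists s, c', h; split.
- exact: us.
- by move=> eps k; case: (c'P eps k).
- apply: filterS aE => eps ->; apply: eq_bigr => k _.
  apply: etrans _ (esym (cls_ladder rho eps k (c' eps k))).
  have [_ e _] := c'P eps k.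
  exact: (congr1 (fun t => ladderA Y k eps * t) (esym e)).
- move=> k; apply: loc_cvg_near (fh k); near=> eps => w.
  by case: (c'P eps k) => _ _ e; exact: esym (e w).
- by apply: etrans LE _; apply/funext => p; apply: eq_bigr => k _; rewrite ladderfE.
Unshelve. all: by end_near. Qed.

Definition gen_fun (x : gen) (p : Mrho rho) : C :=
  match x with
  | X0 => zfun rho p | Xp => xpfun rho p | Xm => xmfun rho p
  | Rho _ => rho (zfun rho p)
  end.

Lemma loc_cvg_rho (r : C) : loc_cvg G (fun eps w => rho (w + r * eps)) rho.
Proof. exact: (loc_cvg_shift G0 r (@loc_cvg_continuous R G FG rho rho_continuous)). Qed.

Lemma alg_converges_gen x : alg_converges (fun eps => cls rho eps (ncvar R x)) (gen_fun x).
Proof.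
case: x => [|||r].
- have cid : continuous (@id C) by move=> z; exact: cvg_id.
  exact: (@cv_fun R A D Y _ (@zfun R rho) (@ladder_fun R rho) G FG (fun=> id) _ id
    (@represents_X0 R rho) (@loc_cvg_continuous R G FG id cid)).
- exact: (cv_Y (@represents1 R rho) (@representsM R rho)
    (@represents_shift R rho) (@represents_ladder R rho) (ladder_funM rho_real) rho_continuous G0 true).
- exact: (cv_Y (@represents1 R rho) (@representsM R rho)
    (@represents_shift R rho) (@represents_ladder R rho) (ladder_funM rho_real) rho_continuous G0 false).
- exact: (@cv_fun R A D Y _ (@zfun R rho) (@ladder_fun R rho) G FG _ _ rho
    (fun eps => @represents_Rho R rho eps r) (loc_cvg_rho r%:~R)).
Qed.

End Convergence.

(** * The derivative of rho and the gradients of the generators *)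

Section GeneratorBrackets.
Variables (R : realType) (rho : R[i] -> R[i]).
Local Notation C := R[i].
Local Notation E := (R * R * R)%type.
Hypothesis rhoA : analytic rho.
Hypothesis rho_real : real_valued rho.
Let rA : real_analytic (rhoR rho) := analytic_real rhoA.
Let rT : taylor rho := analytic_taylor rhoA.
Let r := rhoR rho.

Definition cderiv (z : C) : C := projT1 (cid (taylor_sderive (analytic_taylor rhoA) z)).

Lemma cderivP z : sderive_at rho z (cderiv z).
Proof. exact: (projT2 (cid (taylor_sderive (analytic_taylor rhoA) z))). Qed.

(** The complex derivative is a limit over all small increments, in particular over real ones, for
    which the quotient is the real difference quotient. *)
Lemma cderiv_real (u : R) : cderiv u%:C = (derive1 r u)%:C.
Proof.
have [B [d [B0 d0 hd]]] := cderivP u%:C.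
have [dr _] := real_analytic_derive rA.
apply/eqP; rewrite -subr_eq0 -cmod_eq0 eq_le cmod_ge0 andbT.
apply/ler_addgt0Pl => e e0; rewrite addr0.
have e2 : 0 < e / 2 by rewrite divr_gt0.
have /cvgrPdist_lt := dr u : (fun h => h^-1 *: ((r \o shift u) (h *: 1) - r u)) @ 0^' --> 'D_1 r u.
rewrite -derive1E => /(_ _ e2).
rewrite near_withinE => /nbhs_ballP [d1 /= d10 h1].
(* The three bounds put t in the range of the complex estimate, in the range of the real one, and
   make the error term B t smaller than e / 2. *)
pose t := Num.min (Num.min d d1) (e / 2 / (B + 1)) / 2.
have B1 : 0 < B + 1 by rewrite ltr_wpDl.
have m0 : 0 < Num.min (Num.min d d1) (e / 2 / (B + 1)).
  by rewrite !lt_min d0 d10 divr_gt0.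
have t0 : 0 < t by rewrite divr_gt0.
have tm : t < Num.min (Num.min d d1) (e / 2 / (B + 1)).
  by rewrite /t ltr_pdivrMr// mulr2n mulrDr mulr1 ltrDl.
have [td td1 te] : [/\ t < d, t < d1 & t * (B + 1) < e / 2].
  by move: tm; rewrite !lt_min => /andP[/andP[-> ->]]; rewrite ltr_pdivlMr// => ->.
have ct : cmod t%:C = t by rewrite cmod_real gtr0_norm.
have := hd 0 t%:C; rewrite cmod0 ct add0r addr0 => /(_ d0 td) hq.
have := h1 t; rewrite /ball /= sub0r normrN gtr0_norm// => /(_ td1 (lt0r_neq0 t0)).
rewrite [t *: 1]mulr1 [t + u]addrC => hr.
move: hq; rewrite -rmorphD !(rho_real_value rho_real) -/r => hq.
set q := r (u + t) - r u in hr.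
have qE : (r (u + t))%:C - (r u)%:C = q%:C by rewrite rmorphB.
rewrite qE in hq.
have tC : t%:C != 0 :> C by rewrite -cmod_eq0 ct gt_eqF.
have -> : cderiv u%:C - (derive1 r u)%:C =
    (t^-1 * q - derive1 r u)%:C - (q%:C - cderiv u%:C * t%:C) / t%:C.
  have -> : (t^-1 * q - derive1 r u)%:C = (t%:C)^-1 * q%:C - (derive1 r u)%:C.
    by rewrite rmorphB rmorphM fmorphV.
  by move: (cderiv u%:C) ((derive1 r u)%:C) (q%:C) (t%:C) tC => a b c s s0; field.
apply: le_trans (cmodB _ _) _; rewrite [e]splitr; apply: lerD.
  by rewrite cmod_real distrC ltW.
have ctV : cmod (t%:C)^-1 = t^-1.
  by rewrite -fmorphV cmod_real gtr0_norm// invr_gt0.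
rewrite cmodM ctV ler_pdivrMr//; apply: le_trans hq _.
apply: ler_wpM2r; first exact: ltW.
by move: te; nra.
Qed.

(** By strict differentiability the quotient at w differs from the derivative at z by at most B (|w
    - z| + |eps|). This is uniform in w, and radii e / 2 / (B + 1) for both variables keep it below
    e. *)
Lemma loc_cvg_quotient b : loc_cvg (0 : C)^'
  (fun eps w => (rho (w + ladder_shift b eps) - rho w) * eps^-1)
  (fun z => (if b then 1 else -1) * cderiv z).
Proof.
move=> z e e0; have [B [d [B0 d0 hd]]] := cderivP z.
have B1 : 0 < B + 1 by rewrite ltr_wpDl.
have m0 : 0 < e / 2 / (B + 1) by rewrite !divr_gt0.
exists (Num.min d (e / 2 / (B + 1))); first by rewrite lt_min d0.
rewrite near_withinE; apply/nbhs_cmodP.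
exists (Num.min d (e / 2 / (B + 1))); first by rewrite lt_min d0.
move=> eps; rewrite subr0 => he eps0 w hw.
have ceps : cmod (ladder_shift b eps) = cmod eps by case: (b); rewrite /= ?cmodN.
have ce0 : 0 < cmod eps by rewrite lt_def cmod_eq0 eps0 cmod_ge0.
move: he hw; rewrite !lt_min ltr_pdivlMr// => /andP[ed eB] /andP[wd].
rewrite ltr_pdivlMr// => wB.
have := hd (w - z) (ladder_shift b eps) wd; rewrite ceps => /(_ ed).
rewrite [z + _]addrC subrK; set q := rho _ - rho w => hq.
have -> : q * eps^-1 - (if b then 1 else -1) * cderiv z =
    (q - cderiv z * ladder_shift b eps) * eps^-1.
  by rewrite /ladder_shift; move: (cderiv z) => a; case: (b); field.
rewrite cmodM -ltr_pdivlMr; last first.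
  by rewrite lt_def cmod_ge0 cmod_eq0 invr_eq0 eps0.
have cV : (cmod eps^-1)^-1 = cmod eps.
  have h : cmod eps^-1 * cmod eps = 1 by rewrite -cmodM mulVf// cmod1.
  have n0 : cmod eps^-1 != 0 by rewrite cmod_eq0 invr_eq0.
  by apply: (mulfI n0); rewrite h divff.
rewrite cV; apply: le_lt_trans hq _; rewrite mulrAC -[ltRHS]mulrC.
rewrite [ltLHS]mulrAC -mulrA [ltLHS]mulrC -mulrA ltr_pM2l//.
have := cmod_ge0 (w - z).
move: eB wB (ltW ce0); move: (cmod eps) (cmod (w - z)) => x y; nra.
Qed.

Definition gen_ext (x : gen) (p : E) : C :=
  match x with
  | X0 => (crd3 p)%:C
  | Xp => (crd1 p)%:C + 'i * (crd2 p)%:C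
  | Xm => (crd1 p)%:C + (- 'i) * (crd2 p)%:C
  | Rho _ => (r p.2)%:C
  end.

Definition gen_grad (x : gen) (p : E) : C * C * C :=
  match x with
  | X0 => (0, 0, 1) | Xp => (1, 'i, 0) | Xm => (1, - 'i, 0)
  | Rho _ => (0, 0, (derive1 r p.2)%:C)
  end.

Let s1 : csmooth (fun p : E => (crd1 p)%:C). Proof. exact/csmooth_real/smooth_crd1. Qed.
Let s2 : csmooth (fun p : E => (crd2 p)%:C). Proof. exact/csmooth_real/smooth_crd2. Qed.
Let s3 : csmooth (fun p : E => (crd3 p)%:C). Proof. exact/csmooth_real/smooth_crd3. Qed.
Let sZ (c : C) : csmooth (fun p : E => c * (crd2 p)%:C).
Proof. exact: csmoothM (csmooth_cst c) s2. Qed.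

Lemma csmooth_gen_ext x : csmooth (gen_ext x).
Proof.
case: x => [|||k].
- exact: s3.
- exact: csmoothD s1 (sZ 'i).
- exact: csmoothD s1 (sZ (- 'i)).
- exact: (csmooth_real (smooth_comp_crd3 rA)).
Qed.

Lemma cderive_gen_ext v x p : cderive v (gen_ext x) p =
  v.1.1%:C * (gen_grad x p).1.1 + v.1.2%:C * (gen_grad x p).1.2 +
  v.2%:C * (gen_grad x p).2.
Proof.
have lin c : cderive v (fun p => (crd1 p)%:C + c * (crd2 p)%:C) p =
    v.1.1%:C * 1 + v.1.2%:C * c + v.2%:C * 0.
  rewrite (cderiveD v p s1 (sZ c)) (cderiveZ v c p s2) !cderive_real.
  rewrite derive_crd1 derive_crd2.
  by move: (v.1.1%:C) (v.1.2%:C) (v.2%:C) => a b d; ring.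
have z3 (a b c d : C) : c * d = a * 0 + b * 0 + c * d by ring.
case: x => [|||k].
- rewrite [LHS]cderive_real derive_crd3 -[LHS]mulr1; exact: z3.
- exact: lin.
- exact: lin.
- rewrite [LHS]cderive_real; have [dr _] := real_analytic_derive rA.
  have [_ dE] := @diff_comp_crd3 R r p (dr _).
  apply: etrans (congr1 (fun t => t%:C) (dE v)) _.
  rewrite rmorphM; exact: z3.
Qed.

Lemma extends_gen x : extends (@gen_fun R rho x) (gen_ext x).
Proof.
split; first exact: csmooth_gen_ext.
move=> p; case: x => [|||k] //=; rewrite ?/zfun.
- rewrite /xpfun /crd1 /crd2 /=; move: (sval p).1.1 (sval p).1.2 => a b.
  by apply: complex_ext => /=; ring.
- rewrite /xmfun /crd1 /crd2 /=; move: (sval p).1.1 (sval p).1.2 => a b.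
  by apply: complex_ext => /=; ring.
- exact: rho_real_value.
Qed.

End GeneratorBrackets.

(** * Limits of the commutators of generators *)

Section CommutatorLimit.
Variables (R : realType) (rho : R[i] -> R[i]).
Local Notation C := R[i].
Local Notation N := (ncpoly R).
Local Notation E := (R * R * R)%type.
Hypothesis rhoA : analytic rho.
Hypothesis rho_real : real_valued rho.
Let rA : real_analytic (rhoR rho) := analytic_real rhoA.
Let rC : continuous rho := taylor_continuous (analytic_taylor rhoA).
Let r := rhoR rho.
Let A (eps : C) : pzRingType := alg rho eps.
Let D : forall eps : C, (C -> C) -> A eps -> Prop := @represents R rho.
Let Y (b : bool) (eps : C) : A eps := cls rho eps (ncvar R (ladder_gen b)).
Let X (x : gen) (eps : C) : A eps := cls rho eps (ncvar R x).
Let Gf := @gen_fun R rho.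

Lemma bracket_gen i j : bracket (Gf i) (Gf j) = fun p : Mrho rho =>
  let g := gen_grad rho i (val p) in let h := gen_grad rho j (val p) in
  'i * ((crd1 (val p))%:C * (g.1.2 * h.2 - g.2 * h.1.2)
    - (crd2 (val p))%:C * (g.1.1 * h.2 - g.2 * h.1.1)
    - (2^-1 * derive1 r (val p).2)%:C * (g.1.1 * h.1.2 - g.1.2 * h.1.1)).
Proof.
apply: etrans (bracketE rA (extends_gen rhoA rho_real i) (extends_gen rhoA rho_real j)) _.
apply/funext => p; set q := val p; cbv zeta.
have E1 x : cderive e1 (gen_ext rho x) q = (gen_grad rho x q).1.1.
  rewrite (cderive_gen_ext rhoA); move: (gen_grad rho x q) => [[a b] c] /=.
  by rewrite -[RHS]mul1r -[RHS]addr0 -[RHS]addr0 !mul0r.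
have E2 x : cderive e2 (gen_ext rho x) q = (gen_grad rho x q).1.2.
  rewrite (cderive_gen_ext rhoA); move: (gen_grad rho x q) => [[a b] c] /=.
  by rewrite -[RHS]mul1r -[RHS]add0r -[RHS]addr0 !mul0r.
have E3 x : cderive e3 (gen_ext rho x) q = (gen_grad rho x q).2.
  rewrite (cderive_gen_ext rhoA); move: (gen_grad rho x q) => [[a b] c] /=.
  by rewrite -[RHS]mul1r -[RHS]add0r !mul0r addr0.
by rewrite /pbra !E1 !E2 !E3.
Qed.

Let iu (b : bool) : C := if b then 'i else - 'i.

Let sqr_i : 'i * 'i = -1 :> C. Proof. exact: sqr_i. Qed.

Lemma ladder_fun_ext b (p : Mrho rho) :
  ladder_fun b p = (crd1 (val p))%:C + iu b * (crd2 (val p))%:C.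
Proof.
have [_ hp] := extends_gen rhoA rho_real Xp; have [_ hm] := extends_gen rhoA rho_real Xm.
by case: b; [exact: hp|exact: hm].
Qed.

Definition fun_slope (x : gen) (p : Mrho rho) : C :=
  if x is Rho _ then (derive1 r (val p).2)%:C else 1.

Definition is_fun (x : gen) := if x is (X0 | Rho _) then true else false.

Lemma bracket_fun_fun x y : is_fun x -> is_fun y ->
  bracket (Gf x) (Gf y) = fun=> 0.
Proof.
move=> fx fy; rewrite bracket_gen; apply/funext => p.
case: x y fx fy => [|||k] [|||l] //= _ _;
  move: (_%:C) (_%:C) (_%:C) => *; ring.
Qed.

Lemma bracket_fun_ladder x b (p : Mrho rho) : is_fun x ->
  bracket (Gf x) (Gf (ladder_gen b)) p =
  ladder_fun b p * ((if b then 1 else -1) * fun_slope x p).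
Proof.
move=> fx; rewrite bracket_gen ladder_fun_ext.
have key (i k c d s : C) : i * i = -1 ->
    i * (c * (0 * 0 - s * i) - d * (0 * 0 - s * 1) - k * (0 * i - 0 * 1)) =
    (c + i * d) * (1 * s) /\
    i * (c * (0 * 0 - s * - i) - d * (0 * 0 - s * 1) - k * (0 * - i - 0 * 1)) =
    (c + - i * d) * (-1 * s).
  move=> i2; split.
    by rewrite [LHS](_ : _ = - (i * i) * (c * s) + i * d * s); [rewrite i2; ring|ring].
  by rewrite [LHS](_ : _ = (i * i) * (c * s) + i * d * s); [rewrite i2; ring|ring].
case: x b fx => [|||l] [] // _.
- exact: (key _ _ _ _ _ sqr_i).1.
- exact: (key _ _ _ _ _ sqr_i).2.
- exact: (key _ _ _ _ _ sqr_i).1.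
- exact: (key _ _ _ _ _ sqr_i).2.
Qed.

(** The (x, y) minor of the gradients (1, i, 0) and (1, - i, 0) is - 2 i, which cancels the 1 / 2 in
    the ambient coefficient and leaves - rho'(z). *)
Lemma bracket_ladder_ladder b (p : Mrho rho) :
  bracket (Gf (ladder_gen b)) (Gf (ladder_gen (~~ b))) p =
  (if b then -1 else 1) * (derive1 r (val p).2)%:C.
Proof.
rewrite bracket_gen.
have -> : (derive1 r (val p).2)%:C = 2%:R * (2^-1 * derive1 r (val p).2)%:C.
  have -> : 2%:R = (2%:R : R)%:C :> C by rewrite rmorph_nat.
  by rewrite -rmorphM mulrA divff ?pnatr_eq0// mul1r.
have key (i k c d : C) : i * i = -1 ->
    i * (c * (i * 0 - 0 * - i) - d * (1 * 0 - 0 * 1) - k * (1 * - i - i * 1)) = -1 * (2%:R * k)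
    /\
    i * (c * (- i * 0 - 0 * i) - d * (1 * 0 - 0 * 1) - k * (1 * i - - i * 1)) = 1 * (2%:R * k).
  move=> i2; split.
    by rewrite [LHS](_ : _ = i * i * (2%:R * k)); [rewrite i2; ring|ring].
  by rewrite [LHS](_ : _ = - (i * i * (2%:R * k))); [rewrite i2; ring|ring].
case: b; [exact: (key _ _ _ _ sqr_i).1|exact: (key _ _ _ _ sqr_i).2].
Qed.

Lemma bracket_ladder_same b : bracket (Gf (ladder_gen b)) (Gf (ladder_gen b)) = fun=> 0.
Proof.
rewrite bracket_gen; apply/funext => p; cbv zeta.
move: (_%:C) (_%:C) (_%:C) (gen_grad rho _ _) => a c d [[g1 g2] g3] /=.
clear; ring.
Qed.


Let G : set_system C := (0 : C)^'.
Let G0 : G --> (0 : C). Proof. exact: cvg_within. Qed.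
Let cvr := @alg_converges R rho G.
Let cm := @comm R A (@alg_cst R rho).

Lemma cvr_ext a (L L' : Mrho rho -> C) : L =1 L' -> cvr a L -> cvr a L'.
Proof. exact: cv_ext. Qed.

Lemma cvr_comm_sym (u v : forall eps, A eps) L : cvr (cm u v) L ->
  cvr (cm v u) (fun p => - L p).
Proof.
move=> /(cvN (@represents1 R rho) (@representsM R rho) (@representsN R rho)) h.
exact: (cv_eq (fun eps => esym (commC (@alg_cst R rho) v u eps)) h).
Qed.

Definition fun_repr (x : gen) (eps w : C) : C :=
  if x is Rho k then rho (w + k%:~R * eps) else w.

Lemma represents_fun_gen x eps : is_fun x -> D (fun_repr x eps) (X x eps).
Proof.
by case: x => [|||k] // _; [exact: represents_X0|exact: represents_Rho].
Qed.

Lemma cvr_fun_fun x y : is_fun x -> is_fun y -> cvr (cm (X x) (X y)) (fun=> 0).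
Proof.
move=> fx fy; apply: cv_comm0 => eps.
exact: (D_commute (@representsM R rho) (@represents_fun R rho)
  (represents_fun_gen eps fx) (represents_fun_gen eps fy)).
Qed.

Lemma loc_cvg_fun_repr x b : is_fun x -> loc_cvg G (fun eps w =>
    (fun_repr x eps (w + ladder_shift b eps) - fun_repr x eps w) * eps^-1)
  (fun z => (if b then 1 else -1) * (if x is Rho _ then cderiv rhoA z else 1)).
Proof.
case: x => [|||k] // _.
  have e : \forall eps \near G, (fun _ => (if b then 1 else -1) * 1 : C) =1
      (fun w => (fun_repr X0 eps (w + ladder_shift b eps) - fun_repr X0 eps w) * eps^-1).
    (* The quotient for X_0 is constant only when eps <> 0, as it is along the punctured filter. *)
    rewrite near_withinE; near=> eps; move=> eps0 w; rewrite /fun_repr.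
    rewrite [w + _]addrC addrK mulr1 /ladder_shift.
    by case: (b); rewrite ?mulNr divff.
  exact: (loc_cvg_near e (@loc_cvg_cst R G _ ((if b then 1 else -1) * 1))).
have e : \forall eps \near G,
    (fun w => (rho (w + k%:~R * eps + ladder_shift b eps) - rho (w + k%:~R * eps)) * eps^-1) =1
    (fun w => (fun_repr (Rho k) eps (w + ladder_shift b eps) - fun_repr (Rho k) eps w) * eps^-1).
  near=> eps; move=> w; rewrite /fun_repr.
  by rewrite (addrAC w (ladder_shift b eps)).
exact: (loc_cvg_near e (loc_cvg_shift G0 k%:~R (loc_cvg_quotient rhoA b))).
Unshelve. all: by end_near. Qed.

Lemma cvr_fun_ladder x b : is_fun x -> cvr (cm (X x) (X (ladder_gen b)))
  (fun p => ladder_fun b p * ((if b then 1 else -1) * fun_slope x p)).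
Proof.
move=> fx.
pose dh (z : C) : C := (if b then 1 else -1) *
  (if x is Rho _ then cderiv rhoA z else 1).
have lim : loc_cvg G (fun eps w =>
    (fun_repr x eps (w + ladder_shift b eps) - fun_repr x eps w) * eps^-1) dh.
  exact: loc_cvg_fun_repr.
have h := cv_comm_fun_Y (@represents1 R rho) (@representsD R rho) (@representsM R rho)
  (@represents_shift R rho) (@represents_ladder R rho) (ladder_funM rho_real) rC G0
  (@represents_cst R rho) (@representsN R rho) (fun eps => represents_fun_gen eps fx) lim.
refine (cvr_ext _ (h _)) => p; congr (_ * _); rewrite /dh /fun_slope; congr (_ * _).
case: (x) => [|||k] //; exact: cderiv_real.
Qed.

Lemma cvr_ladder_ladder b : cvr (cm (X (ladder_gen b)) (X (ladder_gen (~~ b))))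
  (fun p => (if b then -1 else 1) * (derive1 r (val p).2)%:C).
Proof.
have lim : loc_cvg G (fun eps w => (rho (w + (if b then 0 else 1) * eps) -
    rho (w + (if b then 1 else 0) * eps)) * eps^-1)
    (fun z => (if b then -1 else 1) * cderiv rhoA z).
  case: b.
    have e : \forall eps \near G,
        (fun w => - ((rho (w + ladder_shift true eps) - rho w) * eps^-1)) =1
        (fun w => (rho (w + 0 * eps) - rho (w + 1 * eps)) * eps^-1).
      near=> eps; move=> w; rewrite mul0r mul1r addr0 -mulNr opprB; exact: erefl.
    apply: (loc_cvg_near e) => z d d0.
    have [d' d'0 h] := loc_cvgN (loc_cvg_quotient rhoA true) z d0.
    exists d' => //; apply: filterS h => eps h w hw.
    by rewrite mulN1r; have := h w hw; rewrite /= mul1r.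
  have e : \forall eps \near G,
      (fun w => (rho (w + ladder_shift true eps) - rho w) * eps^-1) =1
      (fun w => (rho (w + 1 * eps) - rho (w + 0 * eps)) * eps^-1).
    near=> eps; move=> w; rewrite mul0r mul1r addr0; exact: erefl.
  exact: (loc_cvg_near e (loc_cvg_quotient rhoA true)).
have h := cv_comm_YY (@zfun R rho) (@ladder_fun R rho) (@representsD R rho)
  (@representsM R rho) (@represents_ladder R rho) (@represents_cst R rho) (@representsN R rho) lim.
by refine (cvr_ext _ (h _)) => p; rewrite /comp /zfun cderiv_real.
Unshelve. all: by end_near. Qed.

Lemma smooth_gen x : smooth_on_M (Gf x).
Proof. by apply/smooth_on_MP; exists (gen_ext rho x); exact: (extends_gen rhoA rho_real x). Qed.

Lemma gen_case x : is_fun x \/ exists b, x = ladder_gen b.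
Proof. by case: x => [|||k]; [left|right; exists true|right; exists false|left]. Qed.

Lemma cvr_comm_gen x y : cvr (cm (X x) (X y)) (bracket (Gf x) (Gf y)).
Proof.
have fl u b : is_fun u -> cvr (cm (X u) (X (ladder_gen b))) (bracket (Gf u) (Gf (ladder_gen b))).
  move=> fu; refine (cvr_ext _ (cvr_fun_ladder b fu)) => p; exact: (esym (bracket_fun_ladder b p fu)).
have [fx|[b ->]] := gen_case x; have [fy|[c ->]] := gen_case y.
- rewrite bracket_fun_fun//; exact: cvr_fun_fun.
- exact: fl.
- have [_ _ anti _ _] := bracket_poisson rA.
  rewrite (anti _ _ (smooth_gen _) (smooth_gen _)).
  exact: (cvr_comm_sym (fl y b fy)).
- have [<-|cb] := eqVneq b c.
    rewrite bracket_ladder_same.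
    exact: (@cv_comm0 R A D Y _ (@zfun R rho) (@ladder_fun R rho) G _ (@alg_cst R rho)
      (X (ladder_gen b)) (X (ladder_gen b)) (fun eps => erefl)).
  have -> : c = ~~ b by move: cb; case: (b); case: (c).
  refine (cvr_ext _ (cvr_ladder_ladder b)) => p; exact: (esym (bracket_ladder_ladder b p)).
Qed.

Lemma observable_ncpoly f :
  observable (@alg_cst R rho) X Gf (fun eps => cls rho eps f) (ncrestr rho f).
Proof.
elim/ncpoly_ind: f => [|f g Hf Hg|c f Hf||x f Hf].
- refine (observable_eq _ _ (observable0 _ _ _)) => [eps|p].
    exact: (esym (cls0 rho eps)).
  exact: (esym (nceval0 _)).
- refine (observable_eq _ _ (observableD Hf Hg)) => [eps|p].
    exact: (esym (clsD rho eps f g)).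
  exact: (esym (ncevalD _ f g)).
- refine (observable_eq _ _ (observableZ c Hf)) => [eps|p].
    exact: (etrans (alg_cst_scale c (cls rho eps f)) (esym (cls_scale rho eps c f))).
  exact: (esym (ncevalZ _ c f)).
- refine (observable_eq _ _ (observable1 _ _ _)) => [eps|p].
    exact: (esym (cls1 rho eps)).
  exact: (esym (nceval1 _)).
- refine (observable_eq _ _ (observableX x Hf)) => [eps|p].
    exact: (esym (cls_mul rho eps (ncvar R x) f)).
  apply: etrans _ (esym (nceval_varM _ x f)); congr (_ * _).
Qed.

End CommutatorLimit.

(** * Convergence of the scaled commutators to the bracket *)

Section BracketLimit.
Variables (R : realType) (rho : R[i] -> R[i]).
Local Notation C := R[i].
Hypothesis rhoA : analytic rho.
Hypothesis rho_real : real_valued rho.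
Let rA : real_analytic (rhoR rho) := analytic_real rhoA.
Let rC : continuous rho := taylor_continuous (analytic_taylor rhoA).
Let S : (Mrho rho -> C) -> Prop := @smooth_on_M R rho.
Let G : set_system C := (0 : C)^'.
Let G0 : G --> (0 : C). Proof. exact: cvg_within. Qed.
Let FG : Filter G := _.
Implicit Types (F H K : Mrho rho -> C) (f g : ncpoly R).

Let S_cst (c : C) : S (fun=> c).
Proof. by apply/smooth_on_MP; exists (fun=> c); split=> //; exact: csmooth_cst. Qed.

Let S_D F H : S F -> S H -> S (fun p => F p + H p).
Proof.
move=> /smooth_on_MP [F' hF] /smooth_on_MP [H' hH].
by apply/smooth_on_MP; exists (fun p => F' p + H' p); exact: (extendsD hF hH).
Qed.

Let S_M F H : S F -> S H -> S (fun p => F p * H p).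
Proof.
move=> /smooth_on_MP [F' hF] /smooth_on_MP [H' hH].
by apply/smooth_on_MP; exists (fun p => F' p * H' p); exact: (extendsM hF hH).
Qed.

Let S_Z c F : S F -> S (fun p => c * F p).
Proof. exact: S_M (S_cst c). Qed.

Lemma smooth_ncrestr f : S (ncrestr rho f).
Proof.
exact: (S_observable (S_cst 0) (S_cst 1) S_D S_M S_Z (smooth_gen rhoA rho_real)
  (observable_ncpoly rho f)).
Qed.

Lemma alg_cvg_scaled_commutator f g :
  alg_cvg (scaled_commutator rho f g) (bracket (ncrestr rho f) (ncrestr rho g)).
Proof.
have [_ lin anti leib _] := bracket_poisson rA.
have h := cv_comm_observable (@represents1 R rho) (@representsM R rho)
  (@represents_shift R rho) (@represents_ladder R rho) (ladder_funM rho_real) rC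
  G0 (@represents_cst R rho) (@alg_cstC R rho) (@representsN R rho)
  (@alg_converges_gen R rho rC rho_real G FG G0)
  lin anti leib (S_cst 0) (S_cst 1) S_D S_M S_Z (smooth_gen rhoA rho_real)
  (cvr_comm_gen rhoA rho_real) (observable_ncpoly rho f) (observable_ncpoly rho g).
have [s [c [l [us xc aE lc LE]]]] := alg_converges_normal (h FG).
exists s, c, l; split.
- exact: us.
- exact: xc.
- apply: filterS aE => eps e; apply: etrans e.
  exact: (esym (alg_cst_scale _ _)).
- by move=> k z _; exact: ((loc_cvgP _ _).1 (lc k) z).
- exact: LE.
Qed.

End BracketLimit.

(** * Uniqueness of the limit *)

Section Action.
Variables (R : realType) (rho : R[i] -> R[i]) (eps : R[i]).
Local Notation C := R[i].
Local Notation N := (ncpoly R).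
Implicit Types (F : C -> C) (p q : N) (w : C).

(* The generator x acts by F |-> gen_coef x * (F \o gen_move x). *)
Definition gen_coef (x : gen) (w : C) : C :=
  match x with
  | X0 => w | Xp => 1 | Xm => rho (w + eps) | Rho r => rho (w + r%:~R * eps)
  end.

Definition gen_move (x : gen) (w : C) : C :=
  match x with Xp => w - eps | Xm => w + eps | _ => w end.

Fixpoint word_act (s : seq gen) F w : C :=
  if s is x :: s' then gen_coef x w * word_act s' F (gen_move x w) else F w.

Definition act p F w : C := ncext (fun s => word_act s F w) p.

Lemma act0 F w : act 0 F w = 0. Proof. exact: ncext0. Qed.
Lemma actD p q F w : act (p + q) F w = act p F w + act q F w.
Proof. exact: ncextD. Qed.
Lemma actZ (c : C) p F w : act (c *: p) F w = c * act p F w.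
Proof. exact: ncextZ. Qed.
Lemma act1 F w : act 1 F w = F w. Proof. exact: ncext1. Qed.

Lemma act_varM x p F w : act (ncvar R x * p) F w = gen_coef x w * act p F (gen_move x w).
Proof.
rewrite /act ncext_var !ncextE mulr_sumr; apply: eq_bigr => m _ /=.
exact: mulrCA.
Qed.

Lemma act_var x F w : act (ncvar R x) F w = gen_coef x w * F (gen_move x w).
Proof. by rewrite -[ncvar R x]mulr1 act_varM act1. Qed.

Lemma actM p q F w : act (p * q) F w = act p (act q F) w.
Proof.
elim/ncpoly_ind: p w => [|p p' IH IH'|c p IH||x p IH] w;
  pose act_w t := act t F w.
- exact: (etrans (congr1 act_w (mul0r q)) (etrans (act0 F w) (esym (act0 _ w)))).
- apply: etrans (congr1 act_w (mulrDl p p' q)) _; apply: etrans (actD _ _ F w) _.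
  exact: (etrans (congr2 +%R (IH w) (IH' w)) (esym (actD p p' _ w))).
- apply: etrans (congr1 act_w (esym (scalerAl c p q))) _; apply: etrans (actZ c _ F w) _.
  exact: (etrans (congr1 ( *%R c) (IH w)) (esym (actZ c p _ w))).
- exact: (etrans (congr1 act_w (mul1r q)) (esym (act1 (act q F) w))).
- apply: etrans (congr1 act_w (esym (mulrA (ncvar R x) p q))) _.
  apply: etrans (act_varM x _ F w) _.
  exact: (etrans (congr1 ( *%R _) (IH (gen_move x w))) (esym (act_varM x p _ w))).
Qed.

Lemma act_eq0 p F w : (forall u, F u = 0) -> act p F w = 0.
Proof.
move=> F0; elim/ncpoly_ind: p w => [|p q IH IH'|c p IH||x p IH] w.
- exact: act0.
- by rewrite actD IH IH' addr0.
- by rewrite actZ IH mulr0.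
- by rewrite act1.
- by rewrite act_varM IH mulr0.
Qed.

Lemma act_x0poly p F w : x0poly p -> act p F w = x0fun rho eps p w * F w.
Proof.
elim/x0poly_ind => {p} [|p q IH IH'|c p IH||p IH|r p IH].
- by rewrite act0 x0fun0 mul0r.
- by rewrite actD x0funD mulrDl IH IH'.
- by rewrite actZ x0funZ -mulrA IH.
- by rewrite act1 x0fun1 mul1r.
- by rewrite act_varM x0funM x0fun_X0 -mulrA IH.
- by rewrite act_varM x0funM x0fun_Rho -mulrA IH.
Qed.

Lemma actB p q F w : act (p - q) F w = act p F w - act q F w.
Proof. by rewrite -scaleN1r actD actZ mulN1r. Qed.

Lemma act_var2 x y F w : act (ncvar R x * ncvar R y) F w =
  gen_coef x w * (gen_coef y (gen_move x w) * F (gen_move y (gen_move x w))).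
Proof. exact: (etrans (act_varM x (ncvar R y) F w) (congr1 ( *%R _) (act_var y F _))). Qed.

Lemma act_var2B x y p F w : act (ncvar R x * ncvar R y - p) F w =
  gen_coef x w * (gen_coef y (gen_move x w) * F (gen_move y (gen_move x w))) - act p F w.
Proof. exact: (etrans (actB _ p F w) (congr1 (fun t => t - act p F w) (act_var2 x y F w))). Qed.

Lemma act_commB x y p F w :
  act (ncvar R x * ncvar R y - ncvar R y * ncvar R x + p) F w =
  gen_coef x w * (gen_coef y (gen_move x w) * F (gen_move y (gen_move x w))) -
  gen_coef y w * (gen_coef x (gen_move y w) * F (gen_move x (gen_move y w))) + act p F w.
Proof.
apply: etrans (actD _ p F w) _; apply: (congr1 (fun t => t + act p F w)).
apply: etrans (act_var2B x y (ncvar R y * ncvar R x) F w) _.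
exact: (congr1 (fun t => _ - t) (act_var2 y x F w)).
Qed.

Lemma actZ_var (c : C) x F w : act (c *: ncvar R x) F w = c * (gen_coef x w * F (gen_move x w)).
Proof. exact: (etrans (actZ c (ncvar R x) F w) (congr1 ( *%R c) (act_var x F w))). Qed.

Lemma act_relator p F w : relator rho eps p -> act p F w = 0.
Proof.
case=> {p} [p xp p0|||r|r||].
- by rewrite act_x0poly// p0 mul0r.
- apply: etrans (act_commB X0 Xp (- (eps *: ncvar R Xp)) F w) _.
  have -> : act (- (eps *: ncvar R Xp)) F w = - (eps * F (w - eps)).
    apply: etrans (congr1 (fun t => act t F w) (esym (scaleN1r (eps *: ncvar R Xp)))) _.
    apply: etrans (actZ (-1) (eps *: ncvar R Xp) F w) _.
    rewrite actZ_var mulN1r; congr (- (_ * _)); exact: mul1r.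
  by rewrite /gen_coef /gen_move; move: (F _) => f; ring.
- apply: etrans (act_commB X0 Xm (eps *: ncvar R Xm) F w) _.
  by rewrite actZ_var /gen_coef /gen_move; move: (F _) (rho _) => f a; ring.
- apply: etrans (act_var2B (Rho r) Xp (ncvar R Xp * ncvar R (Rho (r + 1))) F w) _.
  rewrite act_var2 /gen_coef /gen_move.
  have -> : w - eps + (r + 1)%:~R * eps = w + r%:~R * eps.
    by rewrite rmorphD /=; move: (r%:~R) => a; ring.
  by move: (F _) (rho _) => f a; ring.
- apply: etrans (act_var2B (Rho r) Xm (ncvar R Xm * ncvar R (Rho (r - 1))) F w) _.
  rewrite act_var2 /gen_coef /gen_move.
  have -> : w + eps + (r - 1)%:~R * eps = w + r%:~R * eps.
    by rewrite rmorphB /=; move: (r%:~R) => a; ring.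
  by move: (F _) (rho _) (rho _) => f a b; ring.
- apply: etrans (act_var2B Xp Xm (ncvar R (Rho 0)) F w) _.
  rewrite act_var /gen_coef /gen_move subrK mul0r addr0.
  by move: (F _) (rho _) => f a; ring.
- apply: etrans (act_var2B Xm Xp (ncvar R (Rho 1)) F w) _.
  rewrite act_var /gen_coef /gen_move addrK (mul1r eps) mul1r.
  by move: (F _) (rho _) => f a; ring.
Qed.

(** The polynomials that act as 0 on all functions form a two-sided ideal containing the relators,
    so the action passes to the quotient. *)
Lemma act_cls p q F w : cls rho eps p = cls rho eps q -> act p F w = act q F w.
Proof.
move=> /cls_eqP /relidealP h; apply/eqP; rewrite -subr_eq0; apply/eqP.
apply: etrans (esym (actB p q F w)) _.
pose I : set N := [set p' | forall F w, act p' F w = 0].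
have hI : two_sided_ideal I.
  split=> [|a b Ia Ib|a b c Ib] F' w'.
  - exact: act0.
  - exact: (etrans (actD a b F' w') (etrans (congr2 +%R (Ia F' w') (Ib F' w')) (addr0 0))).
  - apply: etrans (actM (a * b) c F' w') _; apply: etrans (actM a b _ w') _.
    by apply: act_eq0 => u; exact: Ib.
have rI : relator rho eps `<=` I by move=> p' rp F' w'; exact: act_relator.
exact: (h I (conj hI rI)).
Qed.

(** The factors picked up by a ladder: none from X_+, while each application of X_- contributes a
    value of rho and then advances the argument by eps. *)
Definition ladder_coef (k : int) w : C :=
  if 0 <= k then 1 else \prod_(j < `|k|) rho (w + j.+1%:R * eps).

Lemma act_ladder k p F w : x0poly p ->
  act (ladder R k * p) F w =
  ladder_coef k w * (x0fun rho eps p (w - k%:~R * eps) * F (w - k%:~R * eps)).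
Proof.
move=> xp; rewrite actM -(act_x0poly F _ xp); move: (act p F) => H {p xp F}.
rewrite /ladder /ladder_coef; case: k => n.
  rewrite /= mul1r -pmulrn.
  elim: n w => [|n IH] w; first by rewrite expr0 act1 mul0r subr0.
  rewrite exprS act_varM IH /= mul1r; congr H.
  by rewrite -natr1; move: (n%:R) => a; ring.
rewrite /= NegzE mulrNz -pmulrn.
elim: n.+1 w => [|m IH] w; first by rewrite expr0 act1 big_ord0 mul1r mulr0n oppr0 mul0r subr0.
rewrite exprS act_varM IH /= big_ord_recl mulrA; congr (_ * _ * H _).
- by rewrite mulr1n mul1r.
- apply: eq_bigr => j _; congr rho; have -> : (lift ord0 j).+1%:R = j.+1%:R + 1 :> C.
    by rewrite /= /bump leq0n add1n -natr1.
  by move: (j.+1%:R) => a; ring.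
- by rewrite -natr1; move: (m%:R) => a; ring.
Qed.

End Action.

Section LimitUnique.
Variables (R : realType) (rho : R[i] -> R[i]).
Local Notation C := R[i].
Local Notation N := (ncpoly R).
Hypothesis rhoA : analytic rho.
Hypothesis rho_real : real_valued rho.
Let rC : continuous rho := taylor_continuous (analytic_taylor rhoA).

(* Tested on the indicator function of a point, the faithful action of a sum of
   ladder terms isolates one coefficient. *)
Lemma act_indicator (eps : C) (s : seq int) (c : int -> N) (k : int) (u : C) :
  eps != 0 -> uniq s -> (forall k, x0poly (c k)) ->
  act rho eps (\sum_(l <- s) ladder R l * c l) (fun w => (w == u)%:R) (u + k%:~R * eps) =
  if k \in s then ladder_coef rho eps k (u + k%:~R * eps) * x0fun rho eps (c k) u else 0.
Proof.
move=> eps0 us xc.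
rewrite (big_morph (fun p => act rho eps p _ _) (fun p q => actD rho eps p q _ _) (act0 rho eps _ _)).
have term l : act rho eps (ladder R l * c l) (fun w => (w == u)%:R) (u + k%:~R * eps) =
    if l == k then ladder_coef rho eps k (u + k%:~R * eps) * x0fun rho eps (c k) u else 0.
  rewrite act_ladder//; have [->|lk] := eqVneq l k.
    by rewrite addrK eqxx mulr1.
  (* The ladder of index l samples the indicator at u + (k - l) eps, which differs from u because
     eps <> 0. *)
  have -> : (u + k%:~R * eps - l%:~R * eps == u) = false.
    rewrite -addrA -mulrBl -[X in _ == X]addr0 (inj_eq (addrI u)) mulf_eq0 (negPf eps0) orbF.
    by rewrite -rmorphB /= intr_eq0 subr_eq0 eq_sym (negPf lk).
  by rewrite mulr0 mulr0.
rewrite (eq_bigr _ (fun l _ => term l)) -big_mkcond /=.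
have [ks|ks] := ifP.
  rewrite -big_filter (perm_big [:: k]) ?big_seq1//.
  apply: uniq_perm => // [|l]; first exact: filter_uniq.
  by rewrite mem_filter inE; case: eqP => // ->.
by rewrite big_seq_cond big1// => l /andP[ls /eqP lk]; rewrite -lk ls in ks.
Qed.

Lemma loc_cvg_ladder_coef (G : set_system C) (FG : Filter G) (k : int) : G --> (0 : C) ->
  loc_cvg G (fun eps u => ladder_coef rho eps k (u + k%:~R * eps))
    (fun z => if 0 <= k then 1 else rho z ^+ `|k|%N).
Proof.
move=> G0; rewrite /ladder_coef; case: (0 <= k); first exact: (@loc_cvg_cst R G FG 1).
elim: `|k|%N => [|n IH].
  have e : \forall eps \near G, (fun _ : C => 1 : C) =1
      (fun u => \prod_(j < 0) rho (u + k%:~R * eps + j.+1%:R * eps)).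
    by near=> eps; move=> u; rewrite big_ord0.
  exact: (loc_cvg_near e (@loc_cvg_cst R G FG 1)).
have e : \forall eps \near G,
    (fun u : C => (\prod_(j < n) rho (u + k%:~R * eps + j.+1%:R * eps)) *
       rho (u + (k%:~R + n.+1%:R) * eps)) =1
    (fun u => \prod_(j < n.+1) rho (u + k%:~R * eps + j.+1%:R * eps)).
  by near=> eps; move=> u; rewrite big_ord_recr /= mulrDl addrA.
have e' (z : C) : rho z ^+ n.+1 = rho z ^+ n * rho z by rewrite exprSr.
rewrite (funext e').
exact: (loc_cvg_near e (loc_cvgM IH (loc_cvg_rho rC G0 _))).
Unshelve. all: by end_near. Qed.

(** Isolating the coefficient of index k determines the limit of [ladder_coef] times h k. For k >= 0
    that is h k itself; for k < 0 it is only rho^|k| h k, which still fixes the contribution to the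
    function on the surface. *)
Lemma alg_cvg_unique (a : forall eps, alg rho eps) (L L' : Mrho rho -> C) :
  alg_cvg a L -> alg_cvg a L' -> L = L'.
Proof.
move=> [s [c [h [us xc aE cl ->]]]] [s' [c' [h' [us' xc' aE' cl' ->]]]].
set G : set_system C := (0 : C)^'.
have G0 : G --> (0 : C) by exact: cvg_within.
have key k z : (if k \in s then (if 0 <= k then 1 else rho z ^+ `|k|%N) * h k z else 0) =
    (if k \in s' then (if 0 <= k then 1 else rho z ^+ `|k|%N) * h' k z else 0).
  pose P eps u : C := ladder_coef rho eps k (u + k%:~R * eps).
  have lim (t : seq int) (d : C -> int -> N) (l : int -> C -> C) :
      (forall k z, k \in t -> (fun we : C * C => x0fun rho we.2 (d we.2 k) we.1)
          @ filter_prod (nbhs z) (0 : C)^' --> l k z) ->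
      loc_cvg G (fun eps u => if k \in t then P eps u * x0fun rho eps (d eps k) u else 0)
        (fun z => if k \in t then (if 0 <= k then 1 else rho z ^+ `|k|%N) * l k z else 0).
    move=> dl; have [kt|_] := boolP (k \in t); last exact: (loc_cvg_cst 0).
    apply: (loc_cvgM (loc_cvg_ladder_coef _ k G0)).
    by apply/loc_cvgP => w; exact: dl.
  have eq_near : \forall eps \near G,
      (fun u => if k \in s then P eps u * x0fun rho eps (c eps k) u else 0) =1
      (fun u => if k \in s' then P eps u * x0fun rho eps (c' eps k) u else 0).
    have eps_neq0 : \forall eps \near G, eps != 0 by exact: nbhs_dnbhs_neq.
    apply: filterS3 eps_neq0 aE aE' => eps eps0 E E' u.
    have e : cls rho eps (\sum_(l <- s) ladder R l * c eps l) =
        cls rho eps (\sum_(l <- s') ladder R l * c' eps l).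
      exact: (etrans (cls_sum rho eps s predT (fun l => ladder R l * c eps l))
        (etrans (esym E) (etrans E' (esym
        (cls_sum rho eps s' predT (fun l => ladder R l * c' eps l)))))).
    have := act_cls (fun w => (w == u)%:R) (u + k%:~R * eps) e.
    exact: (fun h => etrans (esym (act_indicator k u eps0 us (xc eps)))
      (etrans h (act_indicator k u eps0 us' (xc' eps)))).
  exact: (loc_cvg_unique _ (loc_cvg_near eq_near (lim s c h cl)) (lim s' c' h' cl') z).
apply/funext => p.
have ss : {subset s <= undup (s ++ s')} by move=> k ks; rewrite mem_undup mem_cat ks.
have ss' : {subset s' <= undup (s ++ s')}.
  by move=> k ks; rewrite mem_undup mem_cat ks orbT.
rewrite -(big_uniq_sub _ (undup_uniq (s ++ s')) us ss).
rewrite -(big_uniq_sub _ (undup_uniq (s ++ s')) us' ss').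
apply: eq_bigr => k _; have {key} := key k (zfun rho p); rewrite /ladderfun.
have ifM (b : bool) (x t : C) : (if b then x * t else 0) = x * (if b then t else 0).
  by case: b; rewrite ?mulr0.
rewrite !ifM; move: (if k \in s then _ else _) (if k \in s' then _ else _) => A B.
case: ifP => k0; first by rewrite !mul1r => ->.
have n0 : `|k|%N != 0 by move: k0; case: (k) => [[]|].
have [r0 _|r0] := eqVneq (rho (zfun rho p)) 0; last by move=> /(mulfI (expf_neq0 _ r0)) ->.
(* At a zero of rho the values of h k and h' k may differ, but there x^2 + y^2 = 0, so a positive
   power of X_- vanishes. *)
have -> : xmfun rho p = 0; last by rewrite expr0n (negPf n0) !mul0r.
have Mp : Mrho rho (val p) by apply: set_mem; exact: valP.
move: r0; rewrite /zfun rho_real_value// -Mp => /(congr1 (@complex.Re R)) /= /eqP.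
rewrite paddr_eq0 ?sqr_ge0// !sqrf_eq0 => /andP[/eqP x0 /eqP y0].
by rewrite /xmfun x0 y0 oppr0.
Qed.

End LimitUnique.

(** * The algebra at eps = 0 *)

Section LaurentCircle.
Variable R : realType.
Local Notation C := R[i].

(** Infinitely many points of the unit circle, told apart by their real parts 1 / (n + 1). *)
Definition circle_pt (n : nat) : C := (n.+1%:R^-1) +i* Num.sqrt (1 - n.+1%:R^-1 ^+ 2).

Lemma cmod_circle_pt n : cmod (circle_pt n) = 1.
Proof.
have h : (n.+1%:R^-1 : R) ^+ 2 <= 1.
  by rewrite expr_le1// invf_le1// ler1n.
by rewrite /cmod normc_def /= sqr_sqrtr ?subr_ge0// addrC subrK sqrtr1.
Qed.

Lemma circle_pt_inj : injective circle_pt.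
Proof.
move=> m n /(congr1 (@complex.Re R)) /= /invr_inj /eqP.
by rewrite eqr_nat => /eqP [].
Qed.

(** Multiplication by t^n, with n at least every |k|, turns the sum into a polynomial. It has more
    roots on the circle than its size allows, so it is 0, and distinct indices k belong to distinct
    exponents. *)
Lemma laurent_circle (s : seq int) (a : int -> C) : uniq s ->
  (forall t : C, cmod t = 1 -> \sum_(k <- s) a k * t ^ k = 0) ->
  forall k, k \in s -> a k = 0.
Proof.
move=> us h k0 k0s.
pose n := (\max_(k <- s) `|k|)%N.
have nk k : k \in s -> (`|(n%:Z + k)%R|%N : int) = n%:Z + k.
  move=> ks; rewrite gez0_abs//.
  have : (`|k| <= n)%N by rewrite /n; apply: (leq_bigmax_seq k ks).
  by case: (k) => [m|m]; rewrite ?NegzE ?absz_nat ?abszN; lia.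
pose P : {poly C} := \sum_(k <- s) a k *: 'X^`|(n%:Z + k)%R|%N.
have rootP t : cmod t = 1 -> root P t.
  move=> t1; have t0 : t != 0 by rewrite -cmod_eq0 t1 oner_neq0.
  rewrite rootE /P horner_sum; apply/eqP.
  have -> : \sum_(k <- s) (a k *: 'X^`|(n%:Z + k)%R|%N).[t] =
      t ^ n * \sum_(k <- s) a k * t ^ k; last by rewrite h// mulr0.
  rewrite mulr_sumr big_seq [RHS]big_seq; apply: eq_bigr => k ks.
  by rewrite hornerZ hornerXn exprnP nk// expfzDr// mulrCA.
have P0 : P = 0.
  apply/eqP; apply: contraT => Pn0.
  have := @max_poly_roots _ P [seq circle_pt i | i <- iota 0 (size P)] Pn0.
  rewrite size_map size_iota ltnn; apply.
    by apply/allP => t /mapP [i _ ->]; apply: rootP; exact: cmod_circle_pt.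
  by rewrite map_inj_uniq ?iota_uniq//; exact: circle_pt_inj.
have := congr1 (fun q : {poly C} => q`_(`|(n%:Z + k0)%R|)) P0.
rewrite coef0 /P coef_sum (bigD1_seq k0)//= coefZ coefXn eqxx mulr1.
rewrite big_seq_cond big1 ?addr0// => k /andP[ks kk0].
rewrite coefZ coefXn; have [e|_] := eqVneq; last by rewrite mulr0.
have := congr1 Posz e; rewrite !nk// => /addrI /esym /eqP.
by rewrite (negPf kk0).
Qed.

End LaurentCircle.

Section ClassicalLimit.
Variables (R : realType) (rho : R[i] -> R[i]).
Local Notation C := R[i].
Local Notation N := (ncpoly R).
Hypothesis rhoA : analytic rho.
Hypothesis rho_real : real_valued rho.
Let rA : real_analytic (rhoR rho) := analytic_real rhoA.
Let rC : continuous rho := taylor_continuous (analytic_taylor rhoA).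
Implicit Types f g : N.

(* The normal form at eps = 0 is the convergence statement for the principal
   filter at 0. *)
Lemma alg0_normal f : exists (s : seq int) (c : int -> N),
  [/\ uniq s, forall k, x0poly (c k),
      cls rho 0 f = \sum_(k <- s) cls rho 0 (ladder R k * c k)
    & ncrestr rho f = fun p => \sum_(k <- s) ladderfun k p * x0fun rho 0 (c k) (zfun rho p)].
Proof.
pose G : set_system C := principal_filter (0 : C).
have FG : Filter G by exact: principal_filter_proper.
have G0 : G --> (0 : C).
  by move=> B /nbhs_singleton; exact: (principal_filterP (0 : C) B).2.
have := cv_observable (@represents1 R rho) (@representsM R rho)
  (@represents_shift R rho) (@represents_ladder R rho) (ladder_funM rho_real) rC
  G0 (@represents_cst R rho)
  (@alg_converges_gen R rho rC rho_real G FG G0) (observable_ncpoly rho f).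
move=> h; have [s [c [l [us xc /principal_filterP aE lc LE]]]] := alg_converges_normal (h FG).
exists s, (c 0); split.
- exact: us.
- exact: xc.
- exact: aE.
- apply: etrans LE _; apply/funext => p; apply: eq_bigr => k _; congr (_ * _).
  (* Along the principal filter the estimates hold at eps = 0 itself, and at w = z they force the
     limit to be the coefficient function. *)
  apply/eqP; rewrite -subr_eq0 -cmod_eq0 eq_le cmod_ge0 andbT.
  apply/ler_addgt0Pl => e e0; rewrite addr0 cmod_distC.
  have [d d0 /principal_filterP h'] := lc k (zfun rho p) e e0.
  by apply/ltW/h'; rewrite subrr cmod0.
Qed.

Lemma taylor_x0fun c : x0poly c -> taylor (x0fun rho 0 c).
Proof.
have rT := analytic_taylor rhoA.
elim/x0poly_ind => {c} [|p q IH IH'|a p IH||p IH|r p IH].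
- rewrite (_ : x0fun _ _ _ = fun=> 0); first exact: taylor_cst.
  by apply/funext => w; exact: x0fun0.
- rewrite (_ : x0fun _ _ _ = fun w => x0fun rho 0 p w + x0fun rho 0 q w); first exact: taylorD.
  by apply/funext => w; exact: x0funD.
- rewrite (_ : x0fun _ _ _ = fun w => a * x0fun rho 0 p w).
    exact: (taylorM (taylor_cst a)).
  by apply/funext => w; exact: x0funZ.
- rewrite (_ : x0fun _ _ _ = fun=> 1); first exact: taylor_cst.
  by apply/funext => w; exact: x0fun1.
- rewrite (_ : x0fun _ _ _ = fun w => w * x0fun rho 0 p w).
    exact: (taylorM (@taylor_id R)).
  apply/funext => w; apply: etrans (x0funM rho 0 w _ _) _.
  by apply: (congr1 (fun t => t * _)); exact: x0fun_X0.
- rewrite (_ : x0fun _ _ _ = fun w => rho w * x0fun rho 0 p w).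
    exact: (taylorM rT).
  apply/funext => w; apply: etrans (x0funM rho 0 w _ _) _.
  apply: (congr1 (fun t => t * _)); apply: etrans (x0fun_Rho rho 0 w r) _.
  by rewrite mulr0 addr0.
Qed.

Hypothesis Irho_nonempty : Irho rho !=set0.

Lemma ncrestr_eq0 f : ncrestr rho f = (fun=> 0) -> cls rho 0 f = 0.
Proof.
have [s [c [us xc -> ->]]] := alg0_normal f => h.
have H0 (u : R) : 0 < rhoR rho u -> forall k, k \in s -> x0fun rho 0 (c k) u%:C = 0.
  move=> ru k ks; set q := Num.sqrt (rhoR rho u); have q0 : 0 < q by rewrite sqrtr_gt0.
  have qC : q%:C != 0 by rewrite -cmod_eq0 cmod_real gtr0_norm// gt_eqF.
  (* On the circle over u one has X_+ = q t and X_- = q t^-1 with |t| = 1, hence the factor q^|k|,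
     which is nonzero and is removed at the end. *)
  have := @laurent_circle R s (fun k => q%:C ^+ `|k|%N * x0fun rho 0 (c k) u%:C) us _ k ks.
  move=> lau; have : q%:C ^+ `|k|%N * x0fun rho 0 (c k) u%:C = 0.
    apply: lau => t t1.
    have t2 : complex.Re t ^+ 2 + complex.Im t ^+ 2 = 1.
      move: t1; rewrite /cmod normc_def /= => /(congr1 (fun x => x ^+ 2)).
      by rewrite sqr_sqrtr ?addr_ge0 ?sqr_ge0// expr1n.
    have Mp : Mrho rho (q * complex.Re t, q * complex.Im t, u).
      by rewrite /Mrho /= !exprMn -mulrDr t2 mulr1 sqr_sqrtr// ltW.
    pose p : Mrho rho := exist (fun v => v \in Mrho rho) _ (mem_set Mp).
    apply: etrans _ (congr1 (fun F => F p) h).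
    apply: eq_bigr => l _; rewrite mulrAC; congr (_ * _).
    have tV : t^-1 = complex.Re t -i* complex.Im t.
      have t0 : t != 0 by rewrite -cmod_eq0 t1 oner_neq0.
      apply: (mulfI t0); rewrite divff//; move: t2; case: (t) => a b /= ab.
      by apply: complex_ext => /=; nra.
    rewrite /ladderfun /xpfun /xmfun /=.
    case: l => n /=.
      rewrite -exprMn; congr (_ ^+ _); case: (t) => a b /=.
      by apply: complex_ext => /=; ring.
    rewrite NegzE -exprnN -exprVn -exprMn tV; congr (_ ^+ _).
    by apply: complex_ext => /=; ring.
  by move/eqP; rewrite mulf_eq0 expf_eq0 (negPf qC) andbF => /eqP.
have [u Iu] := Irho_nonempty.
rewrite big_seq big1// => k ks.
(* The function vanishes on a real interval around u, and zeros accumulating at one point are enough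
   for it to vanish on all of C. *)
have z0 : forall z, x0fun rho 0 (c k) z = 0.
  apply: (@taylor_identity R _ u%:C (taylor_x0fun (xc k))) => d d0.
  have /nbhs_ballP [e /= e0 ue] := rhoR_gt0_near rA Iu.
  have [t [t0 td te]] := ex_lt_min d0 e0; exists t%:C.
  have ct : cmod t%:C = t by rewrite cmod_real gtr0_norm.
  split; [by rewrite -cmod_eq0 ct gt_eqF|by rewrite ct|].
  rewrite -rmorphD; apply: H0 => //; apply: ue.
  by rewrite /ball /= opprD addrA subrr sub0r normrN gtr0_norm.
have c0 : cls rho 0 (c k) = 0.
  apply: etrans (@cls_x0fun R rho 0 (c k) 0 (xc k) (@x0poly0 R) _) (cls0 rho 0) => w.
  by rewrite z0; exact: (esym (x0fun0 rho 0 w)).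
apply: etrans (cls_mul rho 0 (ladder R k) (c k)) _.
by rewrite c0; exact: mulr0.
Qed.

Lemma ncrestr_relator f : relator rho 0 f -> ncrestr rho f = fun=> 0.
Proof.
move=> rf; apply/funext => p; rewrite /ncrestr; set v := (fun x : gen => _).
have v2 x y : nceval v (ncvar R x * ncvar R y) = v x * v y.
  exact: (etrans (ncevalM v _ _) (congr2 *%R (nceval_var v x) (nceval_var v y))).
have v2B x y g : nceval v (ncvar R x * ncvar R y - g) = v x * v y - nceval v g.
  exact: (etrans (ncevalB v _ g) (congr1 (fun t => t - nceval v g) (v2 x y))).
have vC x y : nceval v (ncvar R x * ncvar R y - ncvar R y * ncvar R x) = 0.
  apply: etrans (v2B x y _) _; apply: etrans (congr1 (fun t => _ - t) (v2 y x)) _.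
  by rewrite mulrC subrr.
have vpm : v Xp * v Xm = rho (zfun rho p) := ladder_funM rho_real true p.
case: rf => [g xg g0|||r|r||].
- apply: etrans _ (g0 (zfun rho p)); rewrite /x0fun.
  elim/x0poly_ind: {g0} xg => {g} [|g g' IH IH'|a g IH||g IH|r g IH].
  + by rewrite !nceval0.
  + by rewrite !ncevalD IH IH'.
  + by rewrite !ncevalZ IH.
  + by rewrite !nceval1.
  + by rewrite !nceval_varM IH.
  + by rewrite !nceval_varM IH mulr0 addr0.
- apply: etrans (ncevalB v _ (0 *: ncvar R Xp)) _.
  by rewrite (ncevalZ v 0 (ncvar R Xp)) mul0r subr0; exact: vC.
- apply: etrans (ncevalD v _ (0 *: ncvar R Xm)) _.
  by rewrite (ncevalZ v 0 (ncvar R Xm)) mul0r addr0; exact: vC.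
- apply: etrans (v2B _ _ _) _; apply: etrans (congr1 (fun t => _ - t) (v2 _ _)) _.
  by rewrite mulrC subrr.
- apply: etrans (v2B _ _ _) _; apply: etrans (congr1 (fun t => _ - t) (v2 _ _)) _.
  by rewrite mulrC subrr.
- apply: etrans (v2B _ _ _) _; apply: etrans (congr1 (fun t => _ - t) (nceval_var v _)) _.
  by rewrite vpm subrr.
- apply: etrans (v2B _ _ _) _; apply: etrans (congr1 (fun t => _ - t) (nceval_var v _)) _.
  by rewrite mulrC vpm subrr.
Qed.

Lemma ncrestr_cls f g : cls rho 0 f = cls rho 0 g -> ncrestr rho f = ncrestr rho g.
Proof.
move=> /cls_eqP /relidealP h; apply/funext => p.
apply/eqP; rewrite -subr_eq0; apply/eqP; apply: etrans (esym (ncevalB _ f g)) _.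
pose I : set N := [set f' | ncrestr rho f' = fun=> 0].
have hI : two_sided_ideal I.
  split=> [|a b Ia Ib|a b c Ib]; apply/funext => q.
  - exact: nceval0.
  - apply: etrans (ncevalD _ a b) _.
    exact: (etrans (congr2 +%R (congr1 (fun F => F q) Ia) (congr1 (fun F => F q) Ib)) (addr0 0)).
  - apply: etrans (ncevalM _ (a * b) c) _; apply: etrans (congr1 (fun t => t * _) (ncevalM _ a b)) _.
    apply: etrans (congr1 (fun t => _ * t * _) (congr1 (fun F => F q) Ib)) _.
    by rewrite mulr0 mul0r.
have rI : relator rho 0 `<=` I by move=> f'; exact: ncrestr_relator.
exact: (congr1 (fun F => F p) (h I (conj hI rI))).
Qed.

End ClassicalLimit.

(** * Polynomial functions on the surface *)

Section PolynomialFunctions.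
Import -(notations, coercions) mpoly.
Variables (R : realType) (rho : R[i] -> R[i]).
Local Notation C := R[i].
Local Notation N := (ncpoly R).
Hypothesis rho_real : real_valued rho.
Implicit Types (f g : N) (P Q : mpoly.mpoly 3 C).

Definition coord (p : Mrho rho) : 'I_3 -> C :=
  tnth [tuple (val p).1.1%:C; (val p).1.2%:C; (val p).2%:C].

Definition meval_fun P : Mrho rho -> C := fun p => mpoly.meval (coord p) P.

Lemma meval_funD P Q p : meval_fun (P + Q) p = meval_fun P p + meval_fun Q p.
Proof. exact: mpoly.mevalD. Qed.
Lemma meval_funM P Q p : meval_fun (P * Q) p = meval_fun P p * meval_fun Q p.
Proof. exact: mpoly.mevalM. Qed.
Lemma meval_funZ c P p : meval_fun (c *: P) p = c * meval_fun P p.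
Proof. exact: mpoly.mevalZ. Qed.

Let Xv (i : 'I_3) : mpoly.mpoly 3 C := mpoly.mpolyX C (mpoly.mnm1 i).

Lemma meval_fun_var i p : meval_fun (Xv i) p = coord p i.
Proof. exact: mpoly.mevalXU. Qed.

Let i0 : 'I_3 := inord 0.
Let i1 : 'I_3 := inord 1.
Let i2 : 'I_3 := inord 2.

Let coordE p : [/\ coord p i0 = (val p).1.1%:C, coord p i1 = (val p).1.2%:C
  & coord p i2 = (val p).2%:C].
Proof. by split; rewrite /coord (tnth_nth 0) /= inordK. Qed.

(** The function rho(z) need not be a polynomial in z, but on the surface it equals x^2 + y^2; this
    is why the generators [Rho] restrict to polynomial functions. *)
Let genP (x : gen) : mpoly.mpoly 3 C :=
  match x with
  | X0 => Xv i2 | Xp => Xv i0 + 'i *: Xv i1 | Xm => Xv i0 + (- 'i) *: Xv i1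
  | Rho _ => Xv i0 * Xv i0 + Xv i1 * Xv i1
  end.

Lemma meval_fun_gen x p : meval_fun (genP x) p = gen_fun x p.
Proof.
have [h0 h1 h2] := coordE p.
case: x => [|||r].
- by rewrite meval_fun_var h2.
- rewrite meval_funD meval_funZ !meval_fun_var h0 h1 /= /xpfun.
  move: (sval p).1.1 (sval p).1.2 => a b.
  by apply: complex_ext => /=; ring.
- rewrite meval_funD meval_funZ !meval_fun_var h0 h1 /= /xmfun.
  move: (sval p).1.1 (sval p).1.2 => a b.
  by apply: complex_ext => /=; ring.
- rewrite meval_funD !meval_funM !meval_fun_var h0 h1.
  have Mp : Mrho rho (val p) by apply: set_mem; exact: valP.
  rewrite -!rmorphM -rmorphD -!expr2; apply: etrans _ (esym (rho_real_value rho_real _)).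
  by rewrite -Mp.
Qed.

Lemma ncrestr_polyfun f : polyfun rho (ncrestr rho f).
Proof.
suff [P PE] : exists P, ncrestr rho f =1 meval_fun P by exists P; exact/funext.
elim/ncpoly_ind: f => [|f g [P fP] [Q gQ]|c f [P fP]||x f [P fP]].
- exists 0 => p; apply: etrans (nceval0 _) _; exact: (esym (mpoly.meval0 (coord p))).
- exists (P + Q) => p; apply: etrans (ncevalD _ f g) _.
  apply: etrans _ (esym (meval_funD P Q p)); exact: (congr2 +%R (fP p) (gQ p)).
- exists (c *: P) => p; apply: etrans (ncevalZ _ c f) _.
  apply: etrans _ (esym (meval_funZ c P p)); exact: (congr1 ( *%R c) (fP p)).
- exists 1 => p; apply: etrans (nceval1 _) _; exact: (esym (mpoly.meval1 (coord p))).
- exists (genP x * P) => p; apply: etrans (nceval_varM _ x f) _.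
  apply: etrans _ (esym (meval_funM (genP x) P p)).
  exact: (congr2 *%R (esym (meval_fun_gen x p)) (fP p)).
Qed.

Let genN (i : 'I_3) : N :=
  if i == i0 then 2^-1 *: (ncvar R Xp + ncvar R Xm)
  else if i == i1 then (2 * 'i)^-1 *: (ncvar R Xp - ncvar R Xm) else ncvar R X0.

Lemma nceval_exp v f n : nceval v (f ^+ n) = nceval v f ^+ n.
Proof.
elim: n => [|n IH]; first exact: nceval1.
apply: etrans (congr1 (nceval v) (exprS f n)) _; apply: etrans (ncevalM v f (f ^+ n)) _.
by rewrite IH -exprS.
Qed.

Lemma nceval_monomial v f g h k l m : nceval v (f ^+ k * (g ^+ l * h ^+ m)) =
  nceval v f ^+ k * (nceval v g ^+ l * nceval v h ^+ m).
Proof.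
apply: etrans (ncevalM v (f ^+ k) (g ^+ l * h ^+ m)) _.
apply: (congr2 *%R (nceval_exp v f k)).
apply: etrans (ncevalM v (g ^+ l) (h ^+ m)) _.
exact: (congr2 *%R (nceval_exp v g l) (nceval_exp v h m)).
Qed.

Lemma ncrestr_coord i p : ncrestr rho (genN i) p = coord p i.
Proof.
have [h0 h1 h2] := coordE p.
rewrite /genN; have [->|n0] := eqVneq i i0.
  rewrite h0; apply: etrans (ncevalZ _ _ (ncvar R Xp + ncvar R Xm)) _.
  apply: etrans (congr1 ( *%R _) (ncevalD _ (ncvar R Xp) (ncvar R Xm))) _.
  apply: etrans (congr1 ( *%R _) (congr2 +%R (nceval_var _ Xp) (nceval_var _ Xm))) _.
  rewrite /xpfun /xmfun; move: (val p).1.1 (val p).1.2 => a b.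
  have -> : a +i* b + (a -i* b) = 2 * a%:C.
    by apply: complex_ext => /=; ring.
  by rewrite mulKf// pnatr_eq0.
have [->|n1] := eqVneq i i1.
  rewrite h1; apply: etrans (ncevalZ _ _ (ncvar R Xp - ncvar R Xm)) _.
  apply: etrans (congr1 ( *%R _) (ncevalB _ (ncvar R Xp) (ncvar R Xm))) _.
  apply: etrans (congr1 ( *%R _) (congr2 (fun x y => x - y) (nceval_var _ Xp) (nceval_var _ Xm))) _.
  rewrite /xpfun /xmfun; move: (val p).1.1 (val p).1.2 => a b.
  have -> : a +i* b - (a -i* b) = (2 * 'i) * b%:C.
    by apply: complex_ext => /=; ring.
  by rewrite mulKf// mulf_neq0 ?pnatr_eq0// neq0Ci.
have -> : i = i2.
  move: n0 n1; rewrite -!val_eqE /= !inordK//; case: i => [[|[|[|m]]] hm] //= _ _.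
  by apply: val_inj; rewrite /= inordK.
by rewrite h2; exact: nceval_var.
Qed.

Lemma polyfun_ncrestr F : polyfun rho F -> exists f, ncrestr rho f = F.
Proof.
move=> [P ->].
exists (\sum_(m <- mpoly.msupp P) mpoly.mcoeff m P *:
  (genN i0 ^+ mpoly.fun_of_multinom m i0 * (genN i1 ^+ mpoly.fun_of_multinom m i1 *
   genN i2 ^+ mpoly.fun_of_multinom m i2))).
apply/funext => p; apply: etrans _ (esym (mpoly.mevalE (coord p) P)).
have e i : nceval (fun x => match x with
                   | X0 => zfun rho p | Xp => xpfun rho p | Xm => xmfun rho p
                   | Rho _ => rho (zfun rho p)
                   end) (genN i) = coord p i by exact: ncrestr_coord.
rewrite /ncrestr; move: (fun x : gen => _) e => v e.
rewrite (big_morph (nceval v) (ncevalD v) (nceval0 v)); apply: eq_bigr => m _.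
rewrite (ncevalZ v (mpoly.mcoeff m P)); apply: congr1.
apply: etrans (nceval_monomial v _ _ _ _ _ _) _.
rewrite (e i0) (e i1) (e i2) !big_ord_recl big_ord0 mulr1.
have -> : ord0 = i0 by apply: val_inj; rewrite /= inordK.
have -> : lift i0 ord0 = i1 by apply: val_inj; rewrite /= !inordK.
have -> : lift i0 (lift ord0 ord0) = i2 by apply: val_inj; rewrite /= !inordK.
by [].
Qed.

End PolynomialFunctions.

(** * The isomorphism at eps = 0 *)

Section CommutativeLimit.
Variables (R : realType) (rho : R[i] -> R[i]).
Local Notation C := R[i].
Local Notation N := (ncpoly R).
Hypothesis rhoA : analytic rho.
Hypothesis rho_real : real_valued rho.
Hypothesis Irho_nonempty : Irho rho !=set0.
Implicit Types (f g : N) (a b : alg rho 0).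

(** Restriction of a chosen representative; [ncrestr_cls] makes the choice harmless and
    [ncrestr_eq0] makes the map injective. *)
Let phi a : Mrho rho -> C := ncrestr rho (repr a).

Let phiE f : phi (cls rho 0 f) = ncrestr rho f.
Proof. by apply: (ncrestr_cls rho_real); exact: cls_repr. Qed.

Let phiD a b : phi (a + b) = phi a + phi b.
Proof.
have e : a + b = cls rho 0 (repr a + repr b).
  exact: (etrans (congr2 +%R (esym (cls_repr a)) (esym (cls_repr b))) (esym (clsD rho 0 _ _))).
apply: etrans (etrans (congr1 phi e) (phiE _)) _; apply/funext => p; exact: ncevalD.
Qed.

Let phiM a b : phi (a * b) = phi a * phi b.
Proof.
have e : a * b = cls rho 0 (repr a * repr b).
  exact: (etrans (congr2 *%R (esym (cls_repr a)) (esym (cls_repr b))) (esym (cls_mul rho 0 _ _))).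
apply: etrans (etrans (congr1 phi e) (phiE _)) _; apply/funext => p; exact: ncevalM.
Qed.

Let phi0 : phi 0 = 0.
Proof.
apply: etrans (etrans (congr1 phi (esym (cls0 rho 0))) (phiE 0)) _.
apply/funext => p; exact: nceval0.
Qed.

Let phi1 : phi 1 = 1.
Proof.
apply: etrans (etrans (congr1 phi (esym (cls1 rho 0))) (phiE 1)) _.
apply/funext => p; exact: nceval1.
Qed.

Let phiZ c a : phi (c *: a) = c *: phi a.
Proof.
have e : c *: a = cls rho 0 (c *: repr a).
  exact: (etrans (congr1 (GRing.scale c) (esym (cls_repr a))) (esym (cls_scale rho 0 c _))).
apply: etrans (etrans (congr1 phi e) (phiE _)) _; apply/funext => p; exact: ncevalZ.
Qed.

Let phi_inj : injective phi.
Proof.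
move=> a b ab; rewrite -[a]cls_repr -[b]cls_repr; apply/eqP; rewrite -subr_eq0.
apply/eqP; apply: etrans (esym (clsB rho 0 (repr a) (repr b))) _.
apply: (ncrestr_eq0 rhoA rho_real Irho_nonempty); apply/funext => p.
apply: etrans (ncevalB _ (repr a) (repr b)) _.
by have := congr1 (fun F => F p) ab; rewrite /phi /ncrestr => ->; rewrite subrr.
Qed.

Lemma alg0_commutative : commutative (@GRing.mul (alg rho 0)).
Proof.
move=> a b; apply: phi_inj; apply: etrans (phiM a b) _.
apply: etrans _ (esym (phiM b a)); apply/funext => p; exact: mulrC.
Qed.

Lemma alg0_polyfun : exists Phi : {rmorphism alg rho 0 -> (Mrho rho -> C)},
  [/\ scalable Phi, injective Phi & range Phi = polyfun rho] /\
  [/\ Phi (cls rho 0 (ncvar R X0)) = zfun rho,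
      Phi (cls rho 0 (ncvar R Xp)) = xpfun rho
    & Phi (cls rho 0 (ncvar R Xm)) = xmfun rho].
Proof.
pose addphi := GRing.isNmodMorphism.Build (alg rho 0) (Mrho rho -> C) phi (conj phi0 phiD).
pose mulphi := GRing.isMonoidMorphism.Build (alg rho 0) (Mrho rho -> C) phi (conj phi1 phiM).
pose Phi : {rmorphism alg rho 0 -> (Mrho rho -> C)} := HB.pack phi addphi mulphi.
exists Phi; split; split.
- exact: phiZ.
- exact: phi_inj.
- apply/seteqP; split=> [F [a _ <-]|F PF]; first exact: ncrestr_polyfun.
  have [f <-] := polyfun_ncrestr PF; exists (cls rho 0 f) => //; exact: phiE.
- by apply: etrans (phiE _) _; apply/funext => p; exact: nceval_var.
- by apply: etrans (phiE _) _; apply/funext => p; exact: nceval_var.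
- by apply: etrans (phiE _) _; apply/funext => p; exact: nceval_var.
Qed.

End CommutativeLimit.

(** * Surfaces of revolution *)

Section Homeomorphisms.

Lemma within_continuousP (T U : topologicalType) (A : set T) (B : set U) (f : T -> U) :
  {within A, continuous f} -> {homo f : x / A x >-> B x} ->
  forall x, A x -> f @ within A (nbhs x) --> within B (nbhs (f x)).
Proof.
move=> /subspace_continuousP cf AB x Ax V BV.
have h : \forall y \near x, A y -> B (f y) -> V (f y) := cf x Ax _ BV.
suff : \forall y \near x, A y -> V (f y) by [].
by apply: filterS h => y h Ay; apply: h => //; exact: AB.
Qed.

Lemma homeomorphic_trans (T U V : topologicalType) (A : set T) (B : set U) (D : set V) :
  homeomorphic A B -> homeomorphic B D -> homeomorphic A D.
Proof.
have comp (T1 T2 T3 : topologicalType) (A1 : set T1) (A2 : set T2) (f : T1 -> T2) (g : T2 -> T3) :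
    {within A1, continuous f} -> {within A2, continuous g} -> {homo f : x / A1 x >-> A2 x} ->
    {within A1, continuous (g \o f)}.
  move=> cf /subspace_continuousP cg fA; apply/subspace_continuousP => x Ax.
  exact: (cvg_comp _ _ (within_continuousP cf fA Ax) (cg _ (fA _ Ax))).
move=> [f [f' [cf cf' fA fB [fK fK']]]] [g [g' [cg cg' gB gD [gK gK']]]].
exists (g \o f), (f' \o g'); split.
- exact: comp cf cg fA.
- exact: comp cg' cf' gD.
- by move=> x /fA /gB.
- by move=> x /gD /fB.
- split=> x Ax /=; first by rewrite gK ?fK//; exact: fA.
  by rewrite fK' ?gK'//; exact: gD.
Qed.

Variable R : realType.
Local Notation E := (R * R * R)%type.
Implicit Types (p q t u : R -> R) (J K : set R).

Definition revolution p J : set E := [set v | J v.2 /\ v.1.1 ^+ 2 + v.1.2 ^+ 2 = p v.2].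

(** The circle over z is sent to height t z and rescaled from radius sqrt(p z) to sqrt(q (t z)). At
    a pole the quotient is 0 because the inverse of 0 is 0, and the image lies on the axis as it
    should. *)
Definition revolution_map p q t (v : E) : E :=
  let s := Num.sqrt (q (t v.2)) / Num.sqrt (p v.2) in (s * v.1.1, s * v.1.2, t v.2).

Lemma revolution_pole p J (v : E) : revolution p J v -> p v.2 = 0 -> v = (0, 0, v.2).
Proof.
case: v => [[x y] z] [_ /= <-] /eqP; rewrite paddr_eq0 ?sqr_ge0// !sqrf_eq0.
by move=> /andP[/eqP -> /eqP ->].
Qed.

(** The scaling factor may be unbounded near a pole, so continuity there is not that of a product.
    The images of x and y are instead bounded by the new radius sqrt(q (t z)), which tends to 0
    because poles go to poles. *)
Lemma revolution_map_continuous p q t J : continuous p -> continuous q ->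
  {within J, continuous t} -> (forall z, J z -> p z = 0 -> q (t z) = 0) ->
  {within revolution p J, continuous (revolution_map p q t)}.
Proof.
move=> cp cq ct pq; apply/subspace_continuousP => v Av; have [Jv pv] := Av.
set W := within _ _; have FW : Filter W by exact: within_filter.
have c1 : x.1.1 @[x --> W] --> v.1.1.
  by apply: cvg_within_filter; apply: (@cvg_comp _ _ _ fst fst (nbhs v) (nbhs v.1)); exact: cvg_fst.
have c2 : x.1.2 @[x --> W] --> v.1.2.
  by apply: cvg_within_filter; apply: (@cvg_comp _ _ _ fst snd (nbhs v) (nbhs v.1)); [exact: cvg_fst|exact: cvg_snd].
have c3 : x.2 @[x --> W] --> v.2 by apply: cvg_within_filter; exact: cvg_snd.
have c3J : x.2 @[x --> W] --> within J (nbhs v.2).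
  move=> V JV.
  have h : \forall x \near v, revolution p J x -> J x.2 -> V x.2 := c3 _ JV.
  suff : \forall x \near v, revolution p J x -> V x.2 by [].
  by apply: filterS h => x h Ax; apply: h => //; case: Ax.
have ctv : t x.2 @[x --> W] --> t v.2.
  by move/subspace_continuousP : ct => /(_ _ Jv) ct; exact: (cvg_comp _ _ c3J ct).
have cqv : Num.sqrt (q (t x.2)) @[x --> W] --> Num.sqrt (q (t v.2)).
  exact: (cvg_comp _ _ (cvg_comp _ _ ctv (cq _)) (@sqrt_continuous R _)).
have cpv : Num.sqrt (p x.2) @[x --> W] --> Num.sqrt (p v.2).
  exact: (cvg_comp _ _ (cvg_comp _ _ c3 (cp _)) (@sqrt_continuous R _)).
have coord (c : E -> R) : c x @[x --> W] --> c v -> (forall x, c x ^+ 2 <= x.1.1 ^+ 2 + x.1.2 ^+ 2) ->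
    Num.sqrt (q (t x.2)) / Num.sqrt (p x.2) * c x @[x --> W] -->
    Num.sqrt (q (t v.2)) / Num.sqrt (p v.2) * c v.
  move=> cc cle; have [p0|p0] := eqVneq (Num.sqrt (p v.2)) 0; last first.
    by apply: cvgM => //; apply: cvgM => //; apply: cvgV.
  have pv0 : p v.2 = 0.
    by apply/eqP; rewrite eq_le -sqrtr_eq0 p0 eqxx /= -pv addr_ge0 ?sqr_ge0.
  rewrite p0 invr0 mulr0 mul0r.
  rewrite (pq _ Jv pv0) sqrtr0 in cqv.
  apply: (@squeeze_cvgr _ _ _ _ (fun x => - Num.sqrt (q (t x.2))) (fun x => Num.sqrt (q (t x.2)))) => //.
    rewrite /W near_withinE; near=> x => -[Jx px].
    rewrite -ler_norml normrM normrM (ger0_norm (sqrtr_ge0 (q (t x.2)))) normfV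
      (ger0_norm (sqrtr_ge0 (p x.2))).
    rewrite -mulrA ler_piMr ?sqrtr_ge0//.
    have [->|px0] := eqVneq (Num.sqrt (p x.2)) 0; first by rewrite invr0 mul0r.
    rewrite mulrC ler_pdivrMr ?mul1r ?lt_def ?px0 ?sqrtr_ge0//.
    by rewrite -sqrtr_sqr ler_wsqrtr// -px.
  by rewrite -oppr0; exact: cvgN.
have le1 (x : E) : x.1.1 ^+ 2 <= x.1.1 ^+ 2 + x.1.2 ^+ 2 by rewrite lerDl sqr_ge0.
have le2 (x : E) : x.1.2 ^+ 2 <= x.1.1 ^+ 2 + x.1.2 ^+ 2 by rewrite lerDr sqr_ge0.
exact: (cvg_pair (cvg_pair (coord _ c1 le1) (coord _ c2 le2)) ctv).
Unshelve. all: by end_near. Qed.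

Lemma revolution_homeomorphic p q t u J K : continuous p -> continuous q ->
  {within J, continuous t} -> {within K, continuous u} ->
  {homo t : z / J z >-> K z} -> {homo u : z / K z >-> J z} ->
  (forall z, J z -> u (t z) = z) -> (forall z, K z -> t (u z) = z) ->
  (forall z, J z -> 0 <= p z) -> (forall z, K z -> 0 <= q z) ->
  (forall z, J z -> (p z = 0 <-> q (t z) = 0)) ->
  homeomorphic (revolution p J) (revolution q K).
Proof.
have half p' q' t' u' J' K' : {homo t' : z / J' z >-> K' z} ->
    (forall z, J' z -> u' (t' z) = z) ->
    (forall z, J' z -> 0 <= p' z) -> (forall z, K' z -> 0 <= q' z) ->
    (forall z, J' z -> (p' z = 0 <-> q' (t' z) = 0)) ->
    (forall v, revolution p' J' v -> revolution q' K' (revolution_map p' q' t' v)) /\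
    (forall v, revolution p' J' v -> revolution_map q' p' u' (revolution_map p' q' t' v) = v).
  move=> JK tK p0 q0 pq; split=> v Av.
    have [Jv pv] := Av; split; first exact: JK.
    rewrite /revolution_map /= !exprMn -mulrDr pv exprVn !sqr_sqrtr ?p0 ?q0//; last exact: JK.
    have [pz|pz] := eqVneq (p' v.2) 0; last by rewrite mulfVK.
    by rewrite pz invr0 !mulr0; apply/esym/pq.
  have [Jv pv] := Av; have [pz|pz] := eqVneq (p' v.2) 0.
    by rewrite (revolution_pole Av pz) /revolution_map /= !mulr0 tK.
  have qz : q' (t' v.2) != 0 by apply: contra pz => /eqP h; apply/eqP/pq.
  have sp : Num.sqrt (p' v.2) != 0.
    by rewrite sqrtr_eq0 -ltNge lt_def pz p0.
  have sq : Num.sqrt (q' (t' v.2)) != 0.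
    by rewrite sqrtr_eq0 -ltNge lt_def qz q0//; exact: JK.
  case: v Av Jv pv pz qz sp sq => [[x y] z] /= Av Jv pv pz qz sp sq.
  by rewrite /revolution_map /= tK// !mulrA divfK// mulfV// !mul1r.
move=> cp cq ct cu JK KJ tK uK p0 q0 pq.
have qp z : K z -> (q z = 0 <-> p (u z) = 0).
  by move=> Kz; rewrite -{1}(uK z Kz); apply: iff_sym; apply: pq; exact: KJ.
have [m1 k1] := half p q t u J K JK tK p0 q0 pq.
have [m2 k2] := half q p u t K J KJ uK q0 p0 qp.
exists (revolution_map p q t), (revolution_map q p u); split => //.
- by apply: revolution_map_continuous => // z Jz /pq; exact.
- by apply: revolution_map_continuous => // z Kz /qp; exact.
Qed.

End Homeomorphisms.

(** * The surface without its isolated points *)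

Section Surface.
Variables (R : realType) (rho : R[i] -> R[i]).
Local Notation E := (R * R * R)%type.
Hypothesis rhoA : analytic rho.
Hypothesis rho_real : real_valued rho.
Hypothesis Irho_nonempty : Irho rho !=set0.
Let r := rhoR rho.
Let rA : real_analytic r := analytic_real rhoA.
Let rC : continuous r := rhoR_continuous rA.

Lemma closure_Irho_ge0 z : closure (Irho rho) z -> 0 <= r z.
Proof.
move=> cz; rewrite leNgt; apply/negP => rz.
have [t [rt]] := cz _ (cvgr_lt _ (@rC z) 0 rz).
by rewrite /= ltNge ltW.
Qed.

(** If the zeros were not isolated, rho would vanish identically, contrary to [Irho] being
    nonempty. *)
Lemma rhoR_zero_isolated z : r z = 0 ->
  exists2 d : R, 0 < d & forall s, `|s - z| < d -> r s = 0 -> s = z.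
Proof.
move=> rz; have rT := analytic_taylor rhoA.
have [[d d0 h]|[d d0 h]] := taylor_zeros rT z%:C.
  have rho0 : forall w, rho w = 0.
    apply: (taylor_identity (z0 := z%:C) rT) => e e0.
    have [t [t0 td te]] := ex_lt_min d0 e0; exists t%:C.
    have ct : cmod t%:C = t by rewrite cmod_real gtr0_norm.
    by split; [rewrite -cmod_eq0 ct gt_eqF|rewrite ct|apply: h; rewrite ct].
  by have [u] := Irho_nonempty; rewrite /Irho /= /rhoR rho0 ltxx.
exists d => // s sz rs; apply/eqP; rewrite -subr_eq0; apply/negPn/negP => nz.
have : rho (z%:C + (s - z)%:C) != 0.
  by apply: h; rewrite ?cmod_real// -cmod_eq0 cmod_real normr_eq0.
by rewrite -rmorphD addrC subrK (rho_real_value rho_real) -/(r s) rs eqxx.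
Qed.

(** Near a height outside the closure of [Irho] one has r <= 0, so the surface consists there of
    poles over isolated zeros of r. Over the closure, every point is approached along its
    meridian. *)
Lemma surface_revolution : surface rho = revolution r (closure (Irho rho)).
Proof.
apply/seteqP; split=> [v [Mv niv]|v [cv Mv]].
  split=> //; apply: contrapT => ncv; apply: niv; split; first exact: mem_set.
  have [e e0 eI] : exists2 e : R, 0 < e & forall s, `|s - v.2| < e -> r s <= 0.
    apply: contrapT => ne; apply: ncv => U /nbhs_ballP [e /= e0 eU].
    apply: contrapT => nI; apply: ne; exists e => // s sv.
    rewrite leNgt; apply/negP => rs; apply: nI; exists s; split => //.
    by apply: eU; rewrite /ball /= distrC.
  have le0 (w : E) : Mrho rho w -> `|w.2 - v.2| < e -> r w.2 = 0.
    move=> Mw we; apply/eqP; rewrite eq_le eI//=.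
    by rewrite /r -Mw addr_ge0 ?sqr_ge0.
  have rv : r v.2 = 0 by apply: le0 => //; rewrite subrr normr0.
  have pole (w : E) : Mrho rho w -> r w.2 = 0 -> w = (0, 0, w.2).
    by move=> Mw; apply: (@revolution_pole R r setT).
  have [d d0 iso] := rhoR_zero_isolated rv.
  exists [set w : E | `|w.2 - v.2| < Num.min e d].
    have : (fun w : E => w.2) @ v --> v.2 by exact: cvg_snd.
    move=> /cvgrPdist_lt; have m0 : 0 < Num.min e d by rewrite lt_min e0.
    by move=> /(_ _ m0); apply: filterS => w; rewrite /= distrC.
  apply/seteqP; split=> [w [/=]|_ ->]; last first.
    by split=> //=; rewrite subrr normr0 lt_min e0.
  rewrite lt_min => /andP[we wd] Mw; have rw := le0 w Mw we.
  by rewrite (pole w Mw rw) (iso _ wd rw) [RHS](pole v Mv rv).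
split=> // -[_ [V Vv VM]].
(* For a pole any angle will do; otherwise it is the polar angle of v. *)
have [phi vE] : exists phi, v = chart_pt rho phi v.2.
  have [r0|r0] := ltP 0 (r v.2); first exact: polar.
  have rv : r v.2 = 0 by apply/eqP; rewrite eq_le r0 closure_Irho_ge0.
  exists 0; rewrite (@revolution_pole R r setT v (conj I Mv) rv) /chart_pt /=.
  by rewrite -/r rv sqrtr0 !mul0r.
have : \forall s \near v.2, V (chart_pt rho phi s).
  have cc : chart_pt rho phi @ v.2 --> chart_pt rho phi v.2 by exact: (chart_pt_continuous rA).
  by apply: cc; rewrite -vE.
move=> /nbhs_ballP [d /= d0 dV].
(* A nearby height other than that of v with r > 0: if r > 0 at v, a small step stays in the
   positive set; if r = 0 there, the closure provides points of [Irho], which differ from v.2 as r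
   vanishes at v.2. *)
have [s [rs sv sd]] : exists s, [/\ 0 < r s, s != v.2 & `|s - v.2| < d].
  have [r0|r0] := ltP 0 (r v.2).
    have /nbhs_ballP [e /= e0 eI] := rhoR_gt0_near rA r0.
    have [t [t0 te td]] := ex_lt_min e0 d0; exists (v.2 + t); split.
    - by apply: eI; rewrite /ball /= opprD addrA subrr sub0r normrN gtr0_norm.
    - by rewrite -subr_eq0 addrC addKr gt_eqF.
    - by rewrite addrAC subrr add0r gtr0_norm.
  have [s [rs sd]] := cv _ (nbhsx_ballx v.2 d d0).
  exists s; split => //; last by move: sd; rewrite /ball /= distrC.
  by apply/negP => /eqP sE; move: rs; rewrite sE /Irho /= ltNge r0.
have : (V `&` Mrho rho) (chart_pt rho phi s).
  split; first by apply: dV; rewrite /ball /= distrC.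
  by apply: chart_pt_Mrho; exact: ltW.
rewrite VM => /(congr1 snd) /= sE; by rewrite sE eqxx in sv.
Qed.

End Surface.

(** * Model surfaces: sphere, disc and cylinder *)

Section Profiles.
Variable R : realType.
Implicit Types (a b m z : R) (A : set R).

Lemma closure_segment A m z : (forall s, 0 < s <= 1 -> A (z + s * (m - z))) -> closure A z.
Proof.
move=> h U /nbhs_ballP [e /= e0 eU].
pose s := Num.min 1 (e / (2 * (`|m - z| + 1))).
have d0 : 0 < `|m - z| + 1 by rewrite ltr_wpDl.
have s0 : 0 < s by rewrite lt_min ltr01 divr_gt0// mulr_gt0.
have s1 : s <= 1 by rewrite ge_min lexx.
have se : s * (2 * (`|m - z| + 1)) <= e.
  by rewrite -ler_pdivlMr ?mulr_gt0// ge_min lexx orbT.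
exists (z + s * (m - z)); split; first by apply: h; rewrite s0.
apply: eU; rewrite /ball /= opprD addrA subrr sub0r normrN normrM gtr0_norm//.
by have := normr_ge0 (m - z); nra.
Qed.

Lemma closure_oo a b : a < b ->
  closure [set z | a < z < b] = [set z | a <= z <= b].
Proof.
move=> ab; apply/seteqP; split=> z /=.
  have cl : closed [set z | a <= z <= b].
    rewrite (_ : mkset _ = [set z | a <= z] `&` [set z | z <= b]).
      by apply: closedI; [exact: closed_ge|exact: closed_le].
    by apply/seteqP; split=> s /= => [/andP[]|[-> ->]].
  move=> cz; have : [set z | a <= z <= b] z; last by [].
  rewrite ((closure_id _).1 cl).
  by apply: closureS cz => s /= /andP[/ltW -> /ltW ->].
move=> /andP[az zb]; apply: (@closure_segment _ ((a + b) / 2)) => s /andP[s0 s1] /=.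
have h1 : 0 < s * ((a + b) / 2 - a) by rewrite mulr_gt0//; lra.
have h2 : 0 < s * (b - (a + b) / 2) by rewrite mulr_gt0//; lra.
have h3 : 0 <= (1 - s) * (z - a) by rewrite mulr_ge0//; lra.
have h4 : 0 <= (1 - s) * (b - z) by rewrite mulr_ge0//; lra.
by apply/andP; split; nra.
Qed.

(** The condition e * e = 1 means e = 1 or e = -1, so that both kinds of rays are treated at
    once. *)
Lemma closure_ray e a : e * e = 1 ->
  closure [set z | 0 < e * (z - a)] = [set z | 0 <= e * (z - a)].
Proof.
move=> ee; have ce : continuous (fun z : R => e * (z - a)).
  move=> z; apply: cvgM; first exact: cvg_cst.
  by apply: cvgB; [exact: cvg_id|exact: cvg_cst].
apply/seteqP; split=> z /=.
  have cl : closed [set z | 0 <= e * (z - a)].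
    exact: (closed_comp (fun z _ => ce z) (@closed_ge R 0)).
  move=> cz; have : [set z | 0 <= e * (z - a)] z; last by [].
  by rewrite ((closure_id _).1 cl); apply: closureS cz => s /= /ltW.
move=> z0; apply: (@closure_segment _ (z + e)) => s /andP[s0 _] /=.
have -> : e * (z + s * (z + e - z) - a) = e * (z - a) + s * (e * e) by ring.
by rewrite ee mulr1 ltr_wpDl.
Qed.

(** The profile r(z) = z gives a paraboloid, the graph of x^2 + y^2 over the disc; the homeomorphism
    is the vertical projection. *)
Lemma disc_revolution :
  homeomorphic (revolution id [set w : R | 0 <= w < 1]) (disc R).
Proof.
exists (fun v => v.1), (fun x => (x, x.1 ^+ 2 + x.2 ^+ 2)); split.
- by apply: continuous_subspaceT => v; exact: cvg_fst.
- apply: continuous_subspaceT => x.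
  have sq (f : R * R -> R) : f y @[y --> x] --> f x -> f y ^+ 2 @[y --> x] --> f x ^+ 2.
    by move=> fx; exact: (cvg_comp _ _ fx (@exprn_continuous R 2 _)).
  have h1 : y.1 ^+ 2 @[y --> x] --> x.1 ^+ 2 by apply: (sq fst); exact: cvg_fst.
  have h2 : y.2 ^+ 2 @[y --> x] --> x.2 ^+ 2 by apply: (sq snd); exact: cvg_snd.
  have h0 : (fun y : R * R => y) y @[y --> x] --> x by exact: cvg_id.
  exact: (cvg_pair h0 (cvgD h1 h2)).
- by move=> [[x y] z] [/= /andP[_ z1] xy]; rewrite /disc /= xy.
- by move=> [x y]; rewrite /disc /= => xy; split=> //=; rewrite addr_ge0 ?sqr_ge0.
- by split=> [[[x y] z] [_ /= ->]|[x y]].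
Qed.

Lemma sphere_revolution :
  sphere R = revolution (fun w => 1 - w ^+ 2) [set w : R | -1 <= w <= 1].
Proof.
apply/seteqP; split=> [[[x y] z]|[[x y] z] [_]]; rewrite /sphere /revolution /=.
  move=> h; split; last by rewrite -h addrK.
  have z1 : z ^+ 2 <= 1 by rewrite -h lerDr addr_ge0 ?sqr_ge0.
  by apply/andP; split; nra.
by move=> ->; rewrite subrK.
Qed.

Lemma cylinder_revolution : cylinder R = revolution (fun=> 1) setT.
Proof. by apply/seteqP; split=> [[[x y] z]|[[x y] z] []]. Qed.

Variable p : R -> R.
Hypothesis cp : continuous p.

Lemma revolution_sphere a b : a < b -> (forall z, a <= z <= b -> 0 <= p z) ->
  (forall z, a <= z <= b -> (p z = 0 <-> ~ a < z < b)) ->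
  homeomorphic (revolution p [set z | a <= z <= b]) (sphere R).
Proof.
move=> ab p0 pz; rewrite sphere_revolution.
have ab0 : 0 < b - a by rewrite subr_gt0.
(* The affine map of [a, b] onto [-1, 1], under which the zeros of p become those of 1 - w^2. *)
pose t z := (2 * z - (a + b)) / (b - a).
pose u w := ((b - a) * w + (a + b)) / 2.
have tu w : t (u w) = w by rewrite /t /u; field; rewrite gt_eqF.
have ut z : u (t z) = z by rewrite /t /u; field; rewrite gt_eqF.
have tE z : 1 - t z ^+ 2 = 4 * (z - a) * (b - z) / (b - a) ^+ 2.
  by rewrite /t; field; rewrite gt_eqF.
have lin (c d : R) : continuous (fun z : R => c * z + d).
  move=> z; apply: cvgD; last exact: cvg_cst.
  by apply: cvgM; [exact: cvg_cst|exact: cvg_id].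
apply: (@revolution_homeomorphic _ _ _ t u) => //.
- by move=> w; apply: cvgB; [exact: cvg_cst|exact: exprn_continuous].
- apply: continuous_subspaceT => z; apply: cvgM; last exact: cvg_cst.
  exact: (lin 2 (- (a + b))).
- apply: continuous_subspaceT => z; apply: cvgM; last exact: cvg_cst.
  exact: lin.
- move=> z /= /andP[az zb]; rewrite /t ler_pdivlMr// ler_pdivrMr//.
  by apply/andP; split; lra.
- move=> w /= /andP[w1 w2]; rewrite /u; apply/andP; split; nra.
- by move=> w /= /andP[w1 w2]; nra.
- move=> z /= hz; apply: (iff_trans (pz z hz)); rewrite tE.
  move: hz => /andP[az zb]; split=> [/negP|/eqP].
    rewrite negb_and -!leNgt => /orP[h|h].
      by have -> : z = a; [apply/eqP; rewrite eq_le h|rewrite subrr mulr0 !mul0r].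
    by have -> : z = b; [apply/eqP; rewrite eq_le h zb|rewrite subrr mulr0 mul0r].
  rewrite mulf_eq0 invr_eq0 expf_eq0 /= (gt_eqF ab0) orbF => /eqP h /andP[h1 h2].
  have : 0 < 4 * (z - a) * (b - z) by rewrite !mulr_gt0// subr_gt0.
  by rewrite h ltxx.
Qed.

Lemma revolution_disc e a : e * e = 1 -> (forall z, 0 <= e * (z - a) -> 0 <= p z) ->
  (forall z, 0 <= e * (z - a) -> (p z = 0 <-> ~ 0 < e * (z - a))) ->
  homeomorphic (revolution p [set z | 0 <= e * (z - a)]) (disc R).
Proof.
move=> ee p0 pz; apply: homeomorphic_trans disc_revolution.
(* The map s / (1 + s) of the distance s to the endpoint takes the ray onto [0, 1), with the
   endpoint going to 0. With the absolute value the denominator is positive on the whole line, so t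
   is continuous everywhere. *)
pose t z := `|z - a| / (1 + `|z - a|).
pose u w := a + e * (w / (1 - w)).
have d0 z : 0 < 1 + `|z - a| by rewrite ltr_pwDl.
have ne : `|e| = 1.
  by apply/eqP; rewrite -(@eqrXn2 _ 2)// expr1n -normrX expr2 ee normr1.
have nz z : 0 <= e * (z - a) -> `|z - a| = e * (z - a).
  by move=> h; rewrite -[RHS]ger0_norm// normrM ne mul1r.
apply: (@revolution_homeomorphic _ _ _ t u) => //.
- by move=> z; exact: cvg_id.
- apply: continuous_subspaceT => z.
  have cn : (fun s => `|s - a|) @ z --> `|z - a|.
    by apply: cvg_norm; apply: cvgB; [exact: cvg_id|exact: cvg_cst].
  apply: cvgM => //; apply: cvgV; first by rewrite gt_eqF.
  by apply: cvgD => //; exact: cvg_cst.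
- apply/subspace_continuousP => w /= /andP[w0 w1]; apply: cvg_within_filter.
  apply: cvgD; first exact: cvg_cst.
  apply: cvgM; first exact: cvg_cst.
  apply: cvgM; first exact: cvg_id.
  apply: cvgV; first by rewrite subr_eq0 eq_sym lt_eqF.
  by apply: cvgB; [exact: cvg_cst|exact: cvg_id].
- move=> z /= _; rewrite /t divr_ge0 ?(ltW (d0 z))//=.
  by rewrite ltr_pdivrMr// mul1r ltrDr.
- move=> w /= /andP[w0 w1]; rewrite /u addrAC subrr add0r mulrA ee mul1r.
  by rewrite divr_ge0// subr_ge0 ltW.
- move=> z /= z0; rewrite /u /t nz//.
  have hz : 1 + e * (z - a) != 0 by rewrite gt_eqF// ltr_pwDl.
  have -> : e * (e * (z - a) / (1 + e * (z - a)) / (1 - e * (z - a) / (1 + e * (z - a)))) =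
      (e * e) * (z - a).
    by field; rewrite addrK oner_neq0 hz.
  by rewrite ee mul1r addrC subrK.
- move=> w /= /andP[w0 w1]; rewrite /t /u addrAC subrr add0r normrM ne mul1r.
  have w10 : 0 < 1 - w by rewrite subr_gt0.
  rewrite ger0_norm ?divr_ge0 ?(ltW w10)//.
  by field; rewrite subrK oner_neq0 gt_eqF.
- by move=> z /= /andP[].
- move=> z /= z0; apply: (iff_trans (pz z z0)); rewrite /t nz//; split=> [/negP|/eqP].
    by rewrite -leNgt => h; have -> : e * (z - a) = 0; [apply/eqP; rewrite eq_le h|rewrite mul0r].
  rewrite mulf_eq0 invr_eq0 [X in _ || X]gt_eqF ?orbF; last by rewrite ltr_pwDl.
  by move=> /eqP ->; rewrite ltxx.
Qed.

Lemma revolution_cylinder : (forall z, 0 < p z) ->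
  homeomorphic (revolution p setT) (cylinder R).
Proof.
move=> p0; rewrite cylinder_revolution.
apply: (@revolution_homeomorphic _ _ _ id id) => //.
- by move=> z; exact: cvg_cst.
- by apply: continuous_subspaceT => z; exact: cvg_id.
- by apply: continuous_subspaceT => z; exact: cvg_id.
- by move=> z _; exact: ltW.
- by move=> z _; split=> [|/eqP]; [move=> pz; have := p0 z; rewrite pz ltxx|rewrite oner_eq0].
Qed.

End Profiles.

(** * The three cases for the set where rho is positive *)

Section Classification.
Variables (R : realType) (rho : R[i] -> R[i]).
Hypothesis rhoA : analytic rho.
Hypothesis rho_real : real_valued rho.
Hypothesis Irho_nonempty : Irho rho !=set0.
Let r := rhoR rho.
Let rC : continuous r := rhoR_continuous (analytic_real rhoA).
Let I := Irho rho.

(** The interior of an interval is an open interval, an open ray or the whole line; being open, [I]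
    is itself of this form. *)
Let Irho_open : I° = I.
Proof.
apply/seteqP; split; first exact: interior_subset.
by move=> z rz; exact: (rhoR_gt0_near (analytic_real rhoA) rz).
Qed.

Let closureI_zero z : closure I z -> (r z = 0 <-> ~ I z).
Proof.
move=> cz; rewrite /I /Irho /=; split=> [rz|/negP]; first by rewrite -/(r z) rz ltxx.
by rewrite -leNgt => rz; apply/eqP; rewrite eq_le rz (closure_Irho_ge0 rhoA cz).
Qed.

Let ray e a : e * e = 1 -> I = [set z | 0 < e * (z - a)] ->
  homeomorphic (surface rho) (disc R).
Proof.
move=> ee IE; rewrite (surface_revolution rhoA rho_real Irho_nonempty).
have cE : closure I = [set z | 0 <= e * (z - a)] by rewrite IE closure_ray.
rewrite -/I cE; apply: (revolution_disc rC ee) => z hz.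
  by apply: (closure_Irho_ge0 rhoA); rewrite -/I cE.
have := @closureI_zero z; rewrite cE => /(_ hz); by rewrite {1}IE.
Qed.

Lemma surface_classification : connected I ->
  [\/ [/\ has_lbound I, has_ubound I & homeomorphic (surface rho) (sphere R)],
      (has_lbound I /\ ~ has_ubound I \/ has_ubound I /\ ~ has_lbound I) /\
        homeomorphic (surface rho) (disc R)
    | I = setT /\ homeomorphic (surface rho) (cylinder R)].
Proof.
move=> /connected_intervalP iI.
have [hl|hl] := pselect (has_lbound I); have [hu|hu] := pselect (has_ubound I).
- apply: Or31; split=> //.
  have IE : I = [set z | inf I < z < sup I] by rewrite -{1}Irho_open interval_bounded_interior.
  have ab : inf I < sup I.
    have [u Iu] := Irho_nonempty.
    have /andP[] : [set z | inf I < z < sup I] u by rewrite -IE.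
    exact: lt_trans.
  have cE : closure I = [set z | inf I <= z <= sup I] by rewrite {1}IE closure_oo.
  rewrite (surface_revolution rhoA rho_real Irho_nonempty) -/I cE.
  apply: (revolution_sphere rC ab) => z hz.
    by apply: (closure_Irho_ge0 rhoA); rewrite -/I cE.
  by have := @closureI_zero z; rewrite cE => /(_ hz); rewrite {1}IE.
- apply: Or32; split; first by left.
  apply: (@ray 1 (inf I)); first by rewrite mulr1.
  rewrite -{1}Irho_open interval_right_unbounded_interior//.
  by apply/seteqP; split=> z /=; rewrite mul1r subr_gt0.
- apply: Or32; split; first by right.
  apply: (@ray (-1) (sup I)); first by rewrite mulrNN mulr1.
  rewrite -{1}Irho_open interval_left_unbounded_interior//.
  by apply/seteqP; split=> z /=; rewrite mulN1r opprB subr_gt0.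
- apply: Or33.
  have IT : I = setT by exact: interval_unbounded_setT.
  split=> //; rewrite (surface_revolution rhoA rho_real Irho_nonempty) -/I IT closureT.
  by apply: (revolution_cylinder rC) => z; have : I z by rewrite IT.
Qed.

End Classification.

Theorem theorem2 (R : realType) (rho : R[i] -> R[i])
    (rho_analytic : analytic rho) (rho_real : real_valued rho)
    (Irho_nonempty : Irho rho !=set0) :
  [/\ commutative (@GRing.mul (alg rho 0)) /\
      exists Phi : {rmorphism alg rho 0 -> (Mrho rho -> R[i])},
        [/\ scalable Phi, injective Phi & range Phi = polyfun rho] /\
        [/\ Phi (cls rho 0 (ncvar R X0)) = zfun rho,
            Phi (cls rho 0 (ncvar R Xp)) = xpfun rho
          & Phi (cls rho 0 (ncvar R Xm)) = xmfun rho],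
      exists br : (Mrho rho -> R[i]) -> (Mrho rho -> R[i]) -> Mrho rho -> R[i],
        [/\ poisson_bracket br,
            forall f : ncpoly R, smooth_on_M (ncrestr rho f),
            forall f g : ncpoly R,
              alg_lim (scaled_commutator rho f g)
                      (br (ncrestr rho f) (ncrestr rho g))
          & forall f g : Mrho rho -> R[i], smooth_on_M f -> smooth_on_M g ->
              forall phi z : R, 0 < rhoR rho z ->
                in_chart (br f g) phi z =
                'i%C * (d_phi (in_chart f) phi z * d_z (in_chart g) phi z
                        - d_phi (in_chart g) phi z * d_z (in_chart f) phi z)]
    & connected (Irho rho) ->
      [\/ [/\ has_lbound (Irho rho), has_ubound (Irho rho)
            & homeomorphic (surface rho) (sphere R)],
          (has_lbound (Irho rho) /\ ~ has_ubound (Irho rho) \/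
           has_ubound (Irho rho) /\ ~ has_lbound (Irho rho)) /\
          homeomorphic (surface rho) (disc R)
        | Irho rho = setT /\ homeomorphic (surface rho) (cylinder R)]].
Proof.
split.
- split; first exact: alg0_commutative rho_analytic rho_real Irho_nonempty.
  exact: alg0_polyfun rho_analytic rho_real Irho_nonempty.
- exists (@bracket R rho); split.
  + exact: bracket_poisson (analytic_real rho_analytic).
  + exact: smooth_ncrestr rho_analytic rho_real.
  + move=> f g; have lim := alg_cvg_scaled_commutator rho_analytic rho_real f g.
    by split=> // L' /alg_cvg_unique; apply.
  + move=> f g Sf Sg phi z; exact: bracket_chart (analytic_real rho_analytic) _ _ _ _ Sf Sg.
- exact: surface_classification rho_analytic rho_real Irho_nonempty.
Qed.
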